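(* Assume that either (1) $\mathbf{X}$ is uniformly distributed on $\mathcal{X}$, where $\mathcal{X}\subseteq\mathbb{R}^n$ is bounded and convex, or (2) $\mathbf{X}\sim\mathcal{N}(\mathbf{0},\mathbf{I})$ on $\mathbb{R}^n$ (so $\mathcal{X}=\mathbb{R}^n$). Let $\epsilon>0$ and $\|\mathbf{W}-\hat{\mathbf{W}}\|\le\epsilon$. Then there is a constant $C>0$, depending only on the distribution of $\mathbf{X}$ (in particular not on $f$, $k$, $N$, $\epsilon$ or $\hat{\mathbf{W}}$), such that for every integer $N\ge1$ $$\mathbb{E}\Big[\mathbb{E}_{\mathbf{X}}\big[(f(\mathbf{X})-f_{\hat g_N}(\mathbf{X},\cdot))^2\big]\Big]\le C\,(1+N^{-1/2})^2\Big(\epsilon(\lambda_1+\cdots+\lambda_k)^{1/2}+(\lambda_{k+1}+\cdots+\lambda_n)^{1/2}\Big)^2.$$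
   Context: Let $n\ge2$ and let $\rho_{\mathbf{X}}:\mathbb{R}^n\to[0,\infty)$ be a probability density with respect to Lebesgue measure. Put $\mathcal{X}=\{\mathbf{x}:\rho_{\mathbf{X}}(\mathbf{x})>0\}$; it is assumed that $\mathcal{X}$ is open, that $\partial\mathcal{X}$ has Lebesgue measure zero, and that $\rho_{\mathbf{X}}$ is bounded and continuous on $\mathcal{X}$. Let $\mathbf{X}$ be a random vector with density $\rho_{\mathbf{X}}$ on a probability space $(\Omega,\mathcal{A},\mathbb{P})$. Let $f:\mathcal{X}\to\mathbb{R}$ be measurable with partial derivatives that are square integrable with respect to $\rho_{\mathbf{X}}$. Define $\mathbf{C}=\int_{\mathcal{X}}\nabla f(\mathbf{x})\nabla f(\mathbf{x})^\top\rho_{\mathbf{X}}(\mathbf{x})\,d\mathbf{x}=\mathbf{W}\Lambda\mathbf{W}^\top$, with $\Lambda=\mathrm{diag}(\lambda_1,\dots,\lambda_n)$, $\lambda_1\ge\dots\ge\lambda_n\ge0$, and $\mathbf{W}$ an orthogonal matrix of eigenvectors. Fix $k\in\{1,\dots,n-1\}$. Let $\hat{\mathbf{W}}=[\hat{\mathbf{W}}_1\;\hat{\mathbf{W}}_2]$ be an orthogonal $n\times n$ matrix (a perturbation of $\mathbf{W}$) with $\hat{\mathbf{W}}_1\in\mathbb{R}^{n\times k}$, $\hat{\mathbf{W}}_2\in\mathbb{R}^{n\times(n-k)}$. $\|\cdot\|$ is the matrix norm induced by the Euclidean norm. Put $\hat{\mathcal{Y}}=\hat{\mathbf{W}}_1^\top\mathcal{X}$,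 $\rho_{\hat{\mathbf{Y}}}(\hat{\mathbf{y}})=\int_{\mathbb{R}^{n-k}}\rho_{\mathbf{X}}(\hat{\mathbf{W}}_1\hat{\mathbf{y}}+\hat{\mathbf{W}}_2\hat{\mathbf{z}})\,d\hat{\mathbf{z}}$, and for $\hat{\mathbf{y}}\in\hat{\mathcal{Y}}$ (where $\rho_{\hat{\mathbf{Y}}}(\hat{\mathbf{y}})>0$) put $\rho_{\hat{\mathbf{Z}}|\hat{\mathbf{Y}}}(\hat{\mathbf{z}}|\hat{\mathbf{y}})=\rho_{\mathbf{X}}(\hat{\mathbf{W}}_1\hat{\mathbf{y}}+\hat{\mathbf{W}}_2\hat{\mathbf{z}})/\rho_{\hat{\mathbf{Y}}}(\hat{\mathbf{y}})$; let $\mathbb{P}^{\hat{\mathbf{y}}}_{\hat{\mathbf{Z}}|\hat{\mathbf{Y}}}$ be the probability measure on $\mathbb{R}^{n-k}$ with this density. It is assumed that $\hat{\mathbf{z}}\mapsto f(\hat{\mathbf{W}}_1\hat{\mathbf{y}}+\hat{\mathbf{W}}_2\hat{\mathbf{z}})$ is integrable with respect to this measure for every $\hat{\mathbf{y}}\in\hat{\mathcal{Y}}$. For $\hat{\mathbf{y}}\in\hat{\mathcal{Y}}$ define $$\hat g_N(\hat{\mathbf{y}},\omega)=\frac1N\sum_{j=1}^N f(\hat{\mathbf{W}}_1\hat{\mathbf{y}}+\hat{\mathbf{W}}_2\hat{\mathbf{Z}}^{\hat{\mathbf{y}}}_j(\omega)),$$ where, for each $\hat{\mathbf{y}}$, $\hat{\mathbf{Z}}^{\hat{\mathbf{y}}}_1,\dots,\hat{\mathbf{Z}}^{\hat{\mathbf{y}}}_N$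 are i.i.d. random vectors on $\Omega$ with law $\mathbb{P}^{\hat{\mathbf{y}}}_{\hat{\mathbf{Z}}|\hat{\mathbf{Y}}}$, and each map $(\hat{\mathbf{y}},\omega)\mapsto\hat{\mathbf{Z}}^{\hat{\mathbf{y}}}_j(\omega)$ is $\mathcal{B}(\hat{\mathcal{Y}})\otimes\mathcal{A}$-measurable. For $\mathbf{x}\in\mathcal{X}$ put $f_{\hat g_N}(\mathbf{x},\omega)=\hat g_N(\hat{\mathbf{W}}_1^\top\mathbf{x},\omega)$. $\mathbb{E}_{\mathbf{X}}$ denotes integration in $\mathbf{x}$ against $\rho_{\mathbf{X}}(\mathbf{x})d\mathbf{x}$ with the sampling variable $\omega$ held fixed; the outer $\mathbb{E}$ is integration over $\omega$ with respect to $\mathbb{P}$. *)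

(* Defs.v *)
From HB Require Import structures.
From mathcomp Require Import all_boot all_order all_algebra.
From mathcomp Require Import all_classical all_reals all_analysis.

Set Implicit Arguments.
Unset Strict Implicit.
Unset Printing Implicit Defensive.

Import Order.TTheory GRing.Theory Num.Theory.
Import numFieldNormedType.Exports.

Local Open Scope classical_set_scope.
Local Open Scope ring_scope.

Section borel_structure.
Context (R : realType) (n : nat).

Definition borel_cV : set (set 'cV[R]_n) := <<s [set U | open U] >>.

Let borel0 : borel_cV set0.
Proof. exact: sigma_algebra0. Qed.

Let borelC A : borel_cV A -> borel_cV (~` A).
Proof. exact: sigma_algebraC. Qed.

Let borel_bigcup (F : (set 'cV[R]_n)^nat) :
  (forall i, borel_cV (F i)) -> borel_cV (\bigcup_i F i).
Proof. exact: sigma_algebra_bigcup. Qed.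

HB.instance Definition _ := @isMeasurable.Build default_measure_display
  'cV[R]_n borel_cV borel0 borelC borel_bigcup.

End borel_structure.

Section borel_cV.
Context {R : realType}.
Implicit Types n : nat.

Lemma measurable_open_cV n (U : set 'cV[R]_n) : open U -> measurable U.
Proof. by move=> oU; exact: sub_sigma_algebra. Qed.

Lemma measurable_coord_cV n (i : 'I_n) :
  measurable_fun [set: 'cV[R]_n] (fun v : 'cV[R]_n => v i ord0).
Proof.
apply: (measurability _ (measurable_realfun.RGenOpens.measurableE R)) => _ [_ [a [b ->]] <-].
rewrite setTI; apply: measurable_open_cV.
apply: open_comp; last exact: interval_open.
by move=> x _; exact: coord_continuous.
Qed.

Let box n (q : 'cV[rat * rat]_n) : set 'cV[R]_n :=
  [set v | forall i, v i ord0 \in `](ratr (q i ord0).1), (ratr (q i ord0).2)[].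

Let open_boxE n (U : set 'cV[R]_n) : open U ->
  U = \bigcup_(k in [set: nat])
    (if unpickle k is Some q then
       if `[< box q `<=` U >] then box q else set0 else set0).
Proof.
move=> oU; apply/seteqP; split => [x Ux|x [k _]]; last first.
  by case: unpickle => // q; case: asboolP => // qU /qU.
have [e /= e0 xU] : exists2 e : R, 0 < e & ball x e `<=` U.
  by move: oU => /(_ x Ux) /nbhs_ballP[e e0 xU]; exists e.
have h i : exists q : rat * rat,
    [/\ ratr q.1 < x i ord0, x i ord0 < ratr q.2,
     x i ord0 - e < ratr q.1 & ratr q.2 < x i ord0 + e].
  have [|a] := @rat_in_itvoo R (x i ord0 - e) (x i ord0).
    by rewrite ltrBlDr ltrDl.
  rewrite in_itv/= => /andP[a1 a2].
  have [|b] := @rat_in_itvoo R (x i ord0) (x i ord0 + e).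
    by rewrite ltrDl.
  rewrite in_itv/= => /andP[b1 b2].
  by exists (a, b).
have [g gh] := choice h.
pose q : 'cV[rat * rat]_n := \matrix_(i, j) g i.
exists (pickle q) => //; rewrite pickleK.
have qU : box q `<=` U.
  move=> v bv; apply: xU; split => // i j; rewrite (ord1 j).
  have := bv i; rewrite in_itv/= mxE => /andP[va vb].
  have [_ _ c1 c2] := gh i.
  by rewrite /ball/= ltr_distlC (lt_trans c1 va) (lt_trans vb c2).
case: asboolP => // _ i; rewrite mxE in_itv/=.
by have [-> -> _ _] := gh i.
Qed.

Lemma measurable_fun_cVP d (T : measurableType d) n (f : T -> 'cV[R]_n) :
  (forall i, measurable_fun [set: T] (fun t => f t i ord0)) ->
  measurable_fun [set: T] f.
Proof.
move=> mf; apply: (measurability [set U : set 'cV[R]_n | open U] erefl).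
move=> _ [U oU <-]; rewrite setTI (open_boxE oU) preimage_bigcup.
apply: bigcupT_measurable => k; case: unpickle => [q|]; last first.
  by rewrite preimage_set0.
case: asboolP => _; last by rewrite preimage_set0.
rewrite (_ : _ @^-1` _ = \bigcap_(i in [set: 'I_n])
  ((fun t => f t i ord0) @^-1`
     `](ratr (q i ord0).1), (ratr (q i ord0).2)[%classic)).
  apply: fin_bigcap_measurable => // i _.
  by rewrite -[X in measurable X]setTI; exact: mf.
by apply/seteqP; split => [t bt i _|t bt i]; exact: bt.
Qed.

End borel_cV.

Section lebesgue_cV.
Context {R : realType}.
Local Open Scope ereal_scope.

Definition cons_cV n (p : measurableTypeR R * 'cV[R]_n) : 'cV[R]_n.+1 :=
  col_mx (p.1)%:M p.2 : 'cV[R]_(1 + n).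

Let uncons_cV n (v : 'cV[R]_n.+1) : measurableTypeR R * 'cV[R]_n :=
  (v ord0 ord0, dsubmx (v : 'cV[R]_(1 + n))).

Let cons_cVK n : cancel (@cons_cV n) (@uncons_cV n).
Proof.
move=> [a v]; rewrite /uncons_cV /cons_cV/= col_mxKd.
congr (_, _); have -> : (ord0 : 'I_n.+1) = lshift n (ord0 : 'I_1) by exact/val_inj.
by rewrite (@col_mxEu _ 1 n 1) mxE eqxx.
Qed.

Lemma cons_cV0 n p : @cons_cV n p ord0 ord0 = p.1.
Proof. by rewrite -[in RHS](cons_cVK p). Qed.

Lemma cons_cVS n p i : @cons_cV n p (lift ord0 i) ord0 = p.2 i ord0.
Proof.
have -> : lift ord0 i = rshift 1 i by exact/val_inj.
by rewrite (@col_mxEd _ 1 n 1).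
Qed.

Lemma measurable_cons_cV n : measurable_fun [set: _] (@cons_cV n).
Proof.
apply: measurable_fun_cVP => i; have [j ->|->] := unliftP ord0 i; last first.
  by under eq_fun do rewrite cons_cV0; exact: measurable_fst.
under eq_fun do rewrite cons_cVS.
by apply: (measurableT_comp (measurable_coord_cV j)); exact: measurable_snd.
Qed.

Let measurable_uncons_cV n : measurable_fun [set: _] (@uncons_cV n).
Proof.
apply/measurable_fun_pairP; split; first exact: measurable_coord_cV.
apply: measurable_fun_cVP => i.
under eq_fun do rewrite /= mxE.
exact: measurable_coord_cV.
Qed.

HB.instance Definition _ n :=
  @isMeasurableFun.Build _ _ _ _ (@cons_cV n) (@measurable_cons_cV n).

Section succ.
Context n (mu : {sigma_finite_measure set 'cV[R]_n -> \bar R}).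

Definition lebesgue_cV_succ : set 'cV[R]_n.+1 -> \bar R :=
  pushforward (lebesgue_measure \x mu) (@cons_cV n).

Let succ0 : lebesgue_cV_succ set0 = 0.
Proof. exact: measure0. Qed.

Let succ_ge0 A : 0 <= lebesgue_cV_succ A.
Proof. exact: measure_ge0. Qed.

Let succ_sigma_additive : semi_sigma_additive lebesgue_cV_succ.
Proof. exact: measure_semi_sigma_additive. Qed.

HB.instance Definition _ := isMeasure.Build _ _ _ lebesgue_cV_succ
  succ0 succ_ge0 succ_sigma_additive.

Let sigma_finite_succ : sigma_finite [set: 'cV[R]_n.+1] lebesgue_cV_succ.
Proof.
have /sigma_finiteP[F [FT ndF Foo]] :=
  sigma_finiteT (@lebesgue_measure R : {sigma_finite_measure set _ -> \bar R}).
have /sigma_finiteP[G [GT ndG Goo]] := sigma_finiteT mu.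
exists (fun k => @uncons_cV n @^-1` (F k `*` G k)).
  rewrite -preimage_bigcup (_ : bigcup _ _ = setT) ?preimage_setT//.
  apply/seteqP; split => // -[x y] _.
  have [k _ Fkx] : (\bigcup_k F k) x by rewrite -FT.
  have [l _ Gly] : (\bigcup_k G k) y by rewrite -GT.
  exists (maxn k l) => //; split => /=.
    by move: x Fkx; exact/subsetPset/ndF/leq_maxl.
  by move: y Gly; exact/subsetPset/ndG/leq_maxr.
move=> k; have [mF Fk] := Foo k; have [mG Gk] := Goo k; split.
  by rewrite -[X in measurable X]setTI; apply: measurable_uncons_cV => //;
    exact: measurableX.
rewrite /lebesgue_cV_succ /pushforward -comp_preimage.
rewrite (_ : _ \o _ = id) ?preimage_id; last exact/funext/cons_cVK.
by rewrite product_measure1E// lte_mul_pinfty// ge0_fin_numE.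
Qed.

HB.instance Definition _ := Measure_isSigmaFinite.Build _ _ _
  lebesgue_cV_succ sigma_finite_succ.

End succ.

Fixpoint lebesgue_cV n : {sigma_finite_measure set 'cV[R]_n -> \bar R} :=
  match n with
  | 0%N => \d_(0%R : 'cV[R]_0)
  | m.+1 => lebesgue_cV_succ (lebesgue_cV m)
  end.

Lemma lebesgue_cV_box n (A : 'I_n -> set R) : (forall i, measurable (A i)) ->
  lebesgue_cV n [set v | forall i, A i (v i ord0)] =
  \prod_(i < n) lebesgue_measure (A i).
Proof.
elim: n A => [A _|n IHn A mA].
  by rewrite big_ord0 /= diracE mem_set// => -[].
have mB : measurable [set v : 'cV[R]_n | forall i, A (lift ord0 i) (v i ord0)].
  rewrite [X in measurable X](_ : _ = \bigcap_(i in [set: 'I_n])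
    ((fun v : 'cV[R]_n => v i ord0) @^-1` A (lift ord0 i))).
    apply: fin_bigcap_measurable => // i _.
    by rewrite -[X in measurable X]setTI; exact: measurable_coord_cV.
  by apply/seteqP; split => [v Av i _|v Av i]; exact: Av.
rewrite big_ord_recl -IHn; last by move=> i; exact: mA.
rewrite -product_measure1E//; [|exact: mA].
rewrite /= /lebesgue_cV_succ /pushforward; congr (product_measure1 _ _ _).
apply/seteqP; split => p /=.
- move=> Ap; split=> [|i]; first by rewrite -cons_cV0.
  by rewrite -cons_cVS.
- move=> [A0 Ap] i; have [j ->|->] := unliftP ord0 i; last by rewrite cons_cV0.
  by rewrite cons_cVS.
Qed.

End lebesgue_cV.

Section matrices.
Context {R : realType}.

Definition enorm n (x : 'cV[R]_n) : R := Num.sqrt (\sum_i x i ord0 ^+ 2).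

Definition opnorm n (A : 'M[R]_n) : R :=
  sup [set enorm (A *m x) | x in [set x : 'cV[R]_n | enorm x <= 1]].

(* [A1 A2] as a square matrix *)
Definition hcat n k (hk : (k <= n)%N) (A1 : 'M[R]_(n, k))
    (A2 : 'M[R]_(n, n - k)) : 'M[R]_n :=
  castmx (erefl n, subnKC hk) (row_mx A1 A2).

End matrices.

Section densities.
Context {R : realType} {n : nat}.
Implicit Types rho : 'cV[R]_n -> R.

Definition supp rho : set 'cV[R]_n := [set x | 0 < rho x].

Definition is_density rho : Prop :=
  [/\ measurable_fun [set: 'cV[R]_n] rho, forall x, 0 <= rho x &
      (\int[lebesgue_cV n]_x (rho x)%:E = 1)%E].

Definition regular_density rho : Prop :=
  [/\ is_density rho,
      open (supp rho),
      lebesgue_cV n (closure (supp rho) `\` (supp rho)°) = 0%E,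
      exists M : R, forall x, supp rho x -> rho x <= M &
      {within supp rho, continuous rho}].

(* Both densities below are fixed pointwise; among regular densities this
   only pins down the law, by continuity on the open set supp rho. *)
Definition uniform_density rho : Prop :=
  forall x, supp rho x -> rho x = (fine (lebesgue_cV n (supp rho)))^-1.

Definition std_normal_density rho : Prop :=
  forall x, rho x = Num.sqrt (2 * pi) ^- n * expR (- (enorm x ^+ 2 / 2)).

Definition has_density d (Omega : measurableType d) (P : probability Omega R)
    (X : {RV P >-> 'cV[R]_n}) rho : Prop :=
  forall A : set 'cV[R]_n, measurable A ->
    distribution P X A = (\int[lebesgue_cV n]_(x in A) (rho x)%:E)%E.

End densities.

Section gradients.
Context {R : realType} {n : nat}.
Implicit Types (f rho : 'cV[R]_n -> R).

Definition e_ (i : 'I_n) : 'cV[R]_n := delta_mx i ord0.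

Definition grad f (x : 'cV[R]_n) : 'cV[R]_n := \col_i 'D_(e_ i) f x.

Definition grad_cov f rho : 'M[R]_n := \matrix_(i, j)
  (\int[lebesgue_cV n]_(x in supp rho) ((grad f x *m (grad f x)^T) i j * rho x)).

(* f is only meaningful on supp rho; since supp rho is open, the partial
   derivatives there do not depend on the values of f outside *)
Definition square_integrable_partials f rho : Prop :=
  (forall i x, supp rho x -> derivable f x (e_ i)) /\
  (forall i, (lebesgue_cV n).-integrable (supp rho)
     (fun x => (('D_(e_ i) f x) ^+ 2 * rho x)%:E)).

End gradients.

Section ridge.
Context {R : realType} {n k m : nat}.
Variables (f rho : 'cV[R]_n -> R) (W1 : 'M[R]_(n, k)) (W2 : 'M[R]_(n, m)).

Definition active_set : set 'cV[R]_k := [set W1^T *m x | x in supp rho].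

Definition marginal_density (y : 'cV[R]_k) : R :=
  \int[lebesgue_cV m]_z rho (W1 *m y + W2 *m z).

Definition cond_density (y : 'cV[R]_k) (z : 'cV[R]_m) : R :=
  rho (W1 *m y + W2 *m z) / marginal_density y.

(* z |-> f (W1 y + W2 z) is defined on the slice of supp rho above y, which
   carries the whole conditional law *)
Definition cond_integrable : Prop := forall y, active_set y ->
  (lebesgue_cV m).-integrable [set z | supp rho (W1 *m y + W2 *m z)]
    (fun z => (f (W1 *m y + W2 *m z) * cond_density y z)%:E).

Section sampling.
Context d (Omega : measurableType d) (P : probability Omega R) (N : nat).
Variable Z : 'I_N -> 'cV[R]_k -> Omega -> 'cV[R]_m.

Definition mutually_independent (V : 'I_N -> Omega -> 'cV[R]_m) : Prop :=
  forall (J : {set 'I_N}) (A : 'I_N -> set 'cV[R]_m),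
    (forall j, measurable (A j)) ->
    P (\bigcap_(j in [set` J]) V j @^-1` A j) =
      (\prod_(j in J) P (V j @^-1` A j))%E.

Definition iid_cond_samples : Prop :=
  [/\ forall j, measurable_fun (active_set `*` [set: Omega])
        (fun p : 'cV[R]_k * Omega => Z j p.1 p.2),
      forall y, active_set y -> forall j, measurable_fun [set: Omega] (Z j y),
      forall y, active_set y -> forall j (A : set 'cV[R]_m), measurable A ->
        P (Z j y @^-1` A) =
          (\int[lebesgue_cV m]_(z in A) (cond_density y z)%:E)%E &
      forall y, active_set y -> mutually_independent (Z ^~ y)].

(* f is extended by 0 outside supp rho, where a sample falls with
   probability 0 *)
Definition mc_average (y : 'cV[R]_k) (w : Omega) : R :=
  N%:R^-1 * \sum_(j < N) patch (cst 0) (supp rho) f (W1 *m y + W2 *m Z j y w).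

Definition mc_approx (x : 'cV[R]_n) (w : Omega) : R :=
  mc_average (W1^T *m x) w.

End sampling.
End ridge.

(* Main.v *)
(** By convexity of the square, the mean squared error of an average of N
    samples is at most that of one sample. Integrating over the sampling
    variable and translating [z = W2^T x + u] in the fibre turns this error into
    [J = \int_x \int_u (f x - f (x + W2 u))^2 rho x rho (x + W2 u) / V x] with
    [V x = \int_u rho (x + W2 u)]. For almost every [x] the increment of [f]
    along [W2 u] is the average over [s] in [0, 1] of its directional
    derivatives at [x + s W2 u]. Cauchy-Schwarz, Tonelli and the translation
    [x |-> x - s W2 u] then give [J <= C \int |W2^T grad f|^2 rho] as soon as
    [\int_s \int_u |u|^2 rho (x - s W2 u) rho (x + (1 - s) W2 u) <= C V x rho x].
    For the uniform law this holds since the diameter of the support is finite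
    and one of [s], [1 - s] is at least 1/2; for the Gaussian law and
    [s <= 1/2], with [b = W2^T x], it reduces to the inequality
    [|b - s u|^2 + |b + (1 - s) u|^2 - |b|^2 >= (|b + (1 - s) u|^2 + s |b|^2) / 4].
    Finally [\int |W2^T grad f|^2 rho] is the trace of [W2^T C W2], that is
    [\sum_i lam_i |W2^T w_i|^2], where [|W2^T w_i| <= 1] always, and
    [|W2^T w_i| = |W2^T (w_i - what_i)| <= eps] for [i < k]. *)
Require Import Defs.
From HB Require Import structures.
From mathcomp Require Import all_boot all_order all_algebra.
From mathcomp Require Import all_classical all_reals all_analysis.
From mathcomp Require Import measurable_realfun ring lra.

Set Implicit Arguments.
Unset Strict Implicit.
Unset Printing Implicit Defensive.

Import Order.TTheory GRing.Theory Num.Theory.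
Import numFieldNormedType.Exports.

Local Open Scope classical_set_scope.
Local Open Scope ring_scope.

(** * Affine changes of variables and Lipschitz tests on column vectors *)

Section affine_invariance.
Context {R : realType}.
Local Notation leb := (@lebesgue_measure R).
Local Open Scope ereal_scope.

(** The obstacle is regularity. Partial derivatives of [f] exist at every point of the open support,
    but in the lemmas on increments the function is assumed neither differentiable nor locally
    integrable, so there is no chain rule along [W2 u] and no distributional derivative to start
    from. What survives is one-dimensional: a partial derivative is integrable along almost every
    coordinate segment, and an everywhere differentiable function with integrable derivative is the
    integral of that derivative. Oblique increments are then assembled from coordinate ones by
    testing against Lipschitz functions.

    A point [x] is kept whole and its fibre is parametrised as [x + W2 u]. Every change of variables
    is then a translation or a scalar dilation, which the recursive definition of [lebesgue_cV]
    handles coordinate by coordinate.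

    Both laws are treated alike through the properties in [admissible_law]: convexity of the
    support, a positive lower bound of [rho] on its bounded parts, and the kernel bound. *)

Lemma measurable_affine (a b : R) :
  measurable_fun [set: R] (fun r : R => a * r + b)%R.
Proof. by apply: measurable_funD => //; exact: measurable_funM. Qed.

(** Lebesgue measure is determined by half-open intervals, so only their affine preimages are
    measured; for [a < 0] these are half open at the other end. *)
Lemma lebesgue_measure_affine (a b : R) (A : set R) : a != 0%R ->
  measurable A ->
  leb A = `|a|%R%:E * leb ((fun r => a * r + b)%R @^-1` A).
Proof.
move=> a0 mA.
pose h (r : measurableTypeR R) : measurableTypeR R := (a * r + b)%R.
rewrite (@lebesgue_measure_unique R
  (mscale (NngNum (normr_ge0 a)) (pushforward leb h)))//.
  exact: measurable_affine.
move=> mh _ [[x y] _ <-] /=; rewrite /mscale/= /pushforward /h.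
have [yx|xy] := leP y x.
  rewrite [X in leb X = _](_ : _ = set0); last first.
    by apply/seteqP; split => // r /=; rewrite in_itv/= => /andP[? ?]; lra.
  rewrite [X in _ * leb X](_ : _ = set0) ?measure0 ?mule0//.
  by apply/seteqP; split => // r /=; rewrite in_itv/= => /andP[? ?]; lra.
have [a_gt0|a_lt0|a00] := ltgtP 0%R a; last by rewrite a00 eqxx in a0.
- rewrite [X in _ * leb X](_ : _ = `](x - b) / a, (y - b) / a]%classic)%R.
    rewrite !lebesgue_measure_itv/= !lte_fin xy ltr_pM2r ?invr_gt0//.
    rewrite ltrD2r xy gtr0_norm// -!EFinD -EFinM; congr (_%:E).
    by field; rewrite gt_eqF.
  apply/seteqP; split => r /=; rewrite !in_itv/= => /andP[xr ry].
    by rewrite ltr_pdivrMr// ler_pdivlMr//; apply/andP; split; lra.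
  move: xr ry; rewrite ltr_pdivrMr// ler_pdivlMr// => ? ?.
  by apply/andP; split; lra.
- rewrite [X in _ * leb X](_ : _ = `[(y - b) / a, (x - b) / a[%classic)%R.
    rewrite !lebesgue_measure_itv/= !lte_fin xy ltr_nM2r ?invr_lt0//.
    rewrite ltrD2r xy ltr0_norm// -!EFinD -EFinM; congr (_%:E).
    by field; rewrite lt_eqF.
  apply/seteqP; split => r /=; rewrite !in_itv/= => /andP[xr ry].
    by rewrite ler_ndivrMr// ltr_ndivlMr//; apply/andP; split; lra.
  move: xr ry; rewrite ler_ndivrMr// ltr_ndivlMr// => ? ?.
  by apply/andP; split; lra.
Qed.

Lemma ge0_integral_affine (a b : R) (phi : R -> \bar R) : a != 0%R ->
  measurable_fun [set: R] phi -> (forall r, 0 <= phi r) ->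
  \int[leb]_r phi r = `|a|%R%:E * \int[leb]_r phi (a * r + b)%R.
Proof.
move=> a0 mphi phi0.
pose h (r : measurableTypeR R) : measurableTypeR R := (a * r + b)%R.
have mh := measurable_affine a b : measurable_fun [set: _] h.
rewrite (eq_measure_integral
  (mscale (NngNum (normr_ge0 a)) (pushforward leb h)))//.
  rewrite ge0_integral_mscale// ge0_integral_pushforward ?preimage_setT//.
by move=> A mA _; rewrite [LHS](lebesgue_measure_affine b a0 mA).
Qed.

Lemma measurable_fun_addr_cV d (T : measurableType d) n (f g : T -> 'cV[R]_n) :
  measurable_fun [set: T] f -> measurable_fun [set: T] g ->
  measurable_fun [set: T] (fun t => f t + g t)%R.
Proof.
move=> mf mg; apply: measurable_fun_cVP => i.
under eq_fun do rewrite mxE.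
by apply: measurable_funD; exact: (measurableT_comp (measurable_coord_cV i)).
Qed.

Lemma measurable_fun_scaler_cV d (T : measurableType d) n (c : T -> R)
    (f : T -> 'cV[R]_n) :
  measurable_fun [set: T] c -> measurable_fun [set: T] f ->
  measurable_fun [set: T] (fun t => c t *: f t)%R.
Proof.
move=> mc mf; apply: measurable_fun_cVP => i.
under eq_fun do rewrite mxE.
by apply: measurable_funM => //; exact: (measurableT_comp (measurable_coord_cV i)).
Qed.

Lemma measurable_fun_mulmx d (T : measurableType d) n m (A : 'M[R]_(n, m))
    (f : T -> 'cV[R]_m) :
  measurable_fun [set: T] f -> measurable_fun [set: T] (fun t => A *m f t)%R.
Proof.
move=> mf; apply: measurable_fun_cVP => i.
under eq_fun do rewrite mxE.
apply: measurable_sum => j; apply: measurable_funM => //.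
exact: (measurableT_comp (measurable_coord_cV j)).
Qed.

Lemma measurable_affine_cV n (a : R) (b : 'cV[R]_n) :
  measurable_fun [set: 'cV[R]_n] (fun v => a *: v + b)%R.
Proof.
by apply: measurable_fun_addr_cV => //; exact: measurable_fun_scaler_cV.
Qed.

Lemma measurable_shift_cV n (b : 'cV[R]_n) :
  measurable_fun [set: 'cV[R]_n] (fun v => v + b)%R.
Proof. exact: measurable_fun_addr_cV. Qed.

Lemma ge0_integral_cV_succ n (phi : 'cV[R]_n.+1 -> \bar R) :
  measurable_fun [set: _] phi -> (forall v, 0 <= phi v) ->
  \int[lebesgue_cV n.+1]_v phi v =
  \int[leb]_r \int[lebesgue_cV n]_u phi (cons_cV (r, u)).
Proof.
move=> mphi phi0; rewrite ge0_integral_pushforward ?preimage_setT//.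
  rewrite fubini_tonelli1//; last by move=> x; exact: phi0.
  exact: (measurableT_comp mphi (@measurable_cons_cV R n)).
Qed.

Lemma cons_cV_affine n (a r b : R) (u c : 'cV[R]_n) :
  (cons_cV (a * r + b, a *: u + c) = a *: cons_cV (r, u) + cons_cV (b, c))%R.
Proof.
apply/colP => i; have [j ->|->] := unliftP ord0 i.
  by rewrite [RHS]mxE [X in _ = (X + _)%R]mxE !cons_cVS/= mxE [X in (X + _)%R = _]mxE.
by rewrite [RHS]mxE [X in _ = (X + _)%R]mxE !cons_cV0.
Qed.

Lemma cons_cV_surj n (v : 'cV[R]_n.+1) : exists r u, v = cons_cV (r, u).
Proof.
exists (v ord0 ord0), (\col_i v (lift ord0 i) ord0).
apply/colP => i; have [j ->|->] := unliftP ord0 i.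
  by rewrite cons_cVS/= mxE.
by rewrite !cons_cV0.
Qed.

(** Tonelli peels off the first coordinate, where the one-dimensional formula gives one factor
    [|a|]; induction gives the others. In dimension 0 there is a single point. *)
Lemma ge0_integral_affine_cV n (a : R) (b : 'cV[R]_n)
    (phi : 'cV[R]_n -> \bar R) : a != 0%R ->
  measurable_fun [set: _] phi -> (forall v, 0 <= phi v) ->
  \int[lebesgue_cV n]_v phi v =
  (`|a| ^+ n)%R%:E * \int[lebesgue_cV n]_v phi (a *: v + b)%R.
Proof.
move=> a0; elim: n b phi => [b phi mphi phi0|n IHn b phi mphi phi0].
  rewrite expr0 mul1e; apply: eq_integral => v _; congr phi.
  by apply/colP => -[].
have mphia : measurable_fun [set: _] (fun v : 'cV[R]_n.+1 => phi (a *: v + b)%R).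
  by apply: measurableT_comp => //; exact: measurable_affine_cV.
have [b0 [c bE]] := cons_cV_surj b.
have mF : measurable_fun [set: R]
    (fun r : R => \int[lebesgue_cV n]_u phi (cons_cV (r, u))).
  apply: (@measurable_fun_fubini_tonelli_F _ _ _ _ _ (lebesgue_cV n)
    (phi \o @cons_cV R n)) => //.
  - exact: (measurableT_comp mphi (@measurable_cons_cV R n)).
  - by move=> x; exact: phi0.
have mFa : measurable_fun [set: R] (fun r : R =>
    \int[lebesgue_cV n]_u phi (a *: cons_cV (r, u) + b)%R).
  apply: (@measurable_fun_fubini_tonelli_F _ _ _ _ _ (lebesgue_cV n)
    ((fun v : 'cV[R]_n.+1 => phi (a *: v + b)%R) \o @cons_cV R n)) => //.
  - exact: (measurableT_comp mphia (@measurable_cons_cV R n)).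
  - by move=> x; exact: phi0.
rewrite !ge0_integral_cV_succ//.
rewrite (@ge0_integral_affine a b0)//; last by move=> r; exact: integral_ge0.
under eq_integral => r _.
  rewrite (IHn c); first last.
  - by [].
  - apply: measurableT_comp => //.
    apply: measurableT_comp; first exact: measurable_cons_cV.
    exact: measurable_pair1.
  under eq_integral do rewrite cons_cV_affine -bE.
  over.
rewrite ge0_integralZl//.
- by rewrite muleA -EFinM exprS.
- by move=> r _; exact: integral_ge0.
Qed.

Lemma ge0_integral_shift_cV n (b : 'cV[R]_n) (phi : 'cV[R]_n -> \bar R) :
  measurable_fun [set: _] phi -> (forall v, 0 <= phi v) ->
  \int[lebesgue_cV n]_v phi (v + b)%R = \int[lebesgue_cV n]_v phi v.
Proof.
move=> mphi phi0; rewrite [RHS](@ge0_integral_affine_cV _ 1%R b)//.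
  by rewrite normr1 expr1n mul1e; under [RHS]eq_integral do rewrite scale1r.
Qed.

End affine_invariance.

Section integrable_shift.
Context {R : realType} {n : nat}.
Local Notation mu := (lebesgue_cV n : {measure set 'cV[R]_n -> \bar R}).
Implicit Types (g : 'cV[R]_n -> R) (b : 'cV[R]_n).
Local Open Scope ereal_scope.

Lemma integrable_shift_cV g b : mu.-integrable setT (EFin \o g) ->
  mu.-integrable setT (EFin \o (fun x => g (x + b)%R)).
Proof.
move=> /integrableP[mg ig]; apply/integrableP; split.
  by apply: (measurableT_comp mg); exact: measurable_shift_cV.
rewrite -(ge0_integral_shift_cV b) in ig => //.
exact: measurableT_comp.
Qed.

Lemma integral_shift_cV g b : measurable_fun setT g ->
  \int[mu]_x (g (x + b)%R)%:E = \int[mu]_x (g x)%:E.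
Proof.
move=> mg; rewrite integralE [RHS]integralE; congr (_ - _).
  rewrite -[RHS](ge0_integral_shift_cV b)//.
    by apply: eq_integral => x _; rewrite !funeposE.
  exact/measurable_funepos/measurable_EFinP.
rewrite -[RHS](ge0_integral_shift_cV b)//.
  by apply: eq_integral => x _; rewrite !funenegE.
exact/measurable_funeneg/measurable_EFinP.
Qed.

Lemma continuous_measurable_cV g : continuous g -> measurable_fun setT g.
Proof.
move=> cg; apply: (measurability _ (measurable_realfun.RGenOpens.measurableE R)).
move=> _ [_ [a [b ->]] <-]; rewrite setTI; apply: measurable_open_cV.
apply: open_comp; last exact: interval_open.
by move=> x _; exact: cg.
Qed.

Lemma lipschitz_measurable_cV g (L : R) :
  (forall x y, `|g x - g y| <= L * `|x - y|)%R -> measurable_fun setT g.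
Proof.
move=> gL; apply: continuous_measurable_cV => x A /nbhs_ballP[e /= e0 eA].
have L0 : (0 < `|L| + 1)%R by rewrite ltr_wpDl.
apply/nbhs_ballP; exists (e / (`|L| + 1))%R => /=; first by rewrite divr_gt0.
move=> y; rewrite -ball_normE/= => xy; apply: eA; rewrite -ball_normE/=.
apply: (le_lt_trans (gL _ _)).
apply: (@le_lt_trans _ _ ((`|L| + 1) * `|x - y|)%R).
  by rewrite ler_wpM2r// (le_trans (ler_norm _))// lerDl.
by rewrite mulrC -ltr_pdivlMr.
Qed.

End integrable_shift.

(** * Lipschitz cutoff functions of open sets *)

Section distance_to_complement.
Context {R : realType} {n : nat}.
Implicit Types (V : set 'cV[R]_n) (x y : 'cV[R]_n).

(** Distance to the complement of [V], capped at 1 so that the supremum is finite when [V] is the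
    whole space. The ball of radius 0 is empty, so 0 is always admissible. *)
Definition inradius V x : R := sup [set r | 0 <= r <= 1 /\ ball x r `<=` V].

Let S V x := [set r : R | 0 <= r <= 1 /\ ball x r `<=` V].

Let S0 V x : S V x 0.
Proof.
split; first by rewrite lexx ler01.
by move=> y; rewrite -ball_normE/= => /(le_lt_trans (normr_ge0 _)); rewrite ltxx.
Qed.

Let Ssup V x : has_sup (S V x).
Proof. by split; [exists 0|exists 1 => r [/andP[]]]. Qed.

Lemma inradius_ge0 V x : 0 <= inradius V x.
Proof. by apply: (sup_upper_bound (Ssup V x)); exact: S0. Qed.

Lemma inradius_sub V x r : r < inradius V x -> ball x r `<=` V.
Proof.
rewrite -subr_gt0 => r0; have [r' [_ r'V]] := sup_adherent r0 (Ssup V x).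
by rewrite subKr => /ltW rr' y /(le_ball rr'); exact: r'V.
Qed.

Lemma inradius_gt0 V x : open V -> V x -> 0 < inradius V x.
Proof.
move=> oV Vx; have /nbhs_ballP[e /= e0 eV] := oV _ Vx.
apply: (@lt_le_trans _ _ (Num.min e 1)); first by rewrite lt_min e0 ltr01.
apply: (sup_upper_bound (Ssup V x)); split.
  by rewrite ge_min lexx orbT andbT le_min ltW//= ler01.
by apply: subset_trans eV; apply: le_ball; rewrite ge_min lexx.
Qed.

Lemma inradius0 V x : ~ V x -> inradius V x = 0.
Proof.
move=> Vx; apply/eqP; rewrite eq_le inradius_ge0 andbT leNgt; apply/negP => r0.
apply: Vx; have [//|r0'] := ltP 0 (inradius V x / 2); last by lra.
by move=> r0'; apply: (@inradius_sub V x (inradius V x / 2)); [lra|exact: ballxx].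
Qed.

(** The ball of radius [r] around [u] contains the ball of radius [r - |u - v|] around [v]. *)
Lemma inradius_lipschitz V x y : `|inradius V x - inradius V y| <= `|x - y|.
Proof.
have H u v : inradius V u <= inradius V v + `|u - v|.
  apply: sup_le_ub; first by exists 0; exact: S0.
  move=> r [/andP[r0 r1] rV]; rewrite -lerBlDr.
  have [ruv|uvr] := leP r `|u - v|.
    by rewrite (le_trans _ (inradius_ge0 V v))// subr_le0.
  apply: (sup_upper_bound (Ssup V v)); split.
    by rewrite subr_ge0 (ltW uvr)/= lerBlDr (le_trans r1)// lerDl.
  move=> z vz; apply: rV; move: vz; rewrite -!ball_normE/= => vz.
  rewrite (le_lt_trans (ler_distD v _ _))//; lra.
have := H x y; have := H y x; rewrite (distrC y) ler_norml.
move: (inradius V x) (inradius V y) `|x - y| => a b c {}H ?.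
by rewrite lerBlDl -lerBlDr; apply/andP; split; lra.
Qed.

Lemma open_inradius_gt V (r : R) : open [set x | r < inradius V x].
Proof.
rewrite openE => x /= rx; apply/nbhs_ballP; exists (inradius V x - r).
  by rewrite /= subr_gt0.
move=> y; rewrite -ball_normE/= => xy.
have := inradius_lipschitz V x y; rewrite ler_norml => /andP[_].
by move=> /le_lt_trans /(_ xy); rewrite ltrBlDl addrC -ltrBlDl opprB subrKC.
Qed.

Let minr1_lipschitz (c d : R) : `|Num.min 1 c - Num.min 1 d| <= `|c - d|.
Proof.
case: (leP 1 c) => c1; case: (leP 1 d) => d1; rewrite ?subrr ?normr0//.
- by rewrite !ger0_norm ?subr_ge0 ?(ltW d1)// ?lerB// ltW// (lt_le_trans d1).
- by rewrite !ler0_norm ?subr_le0 ?(ltW c1)// ?lerN2 ?lerB// ltW// (lt_le_trans c1).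
Qed.

(** Lipschitz functions that vanish off [V] and increase to its indicator when [V] is open; they
    serve as test functions. *)
Definition cutoff V (j : nat) x : R := Num.min 1 (j%:R * inradius V x).

Lemma cutoff_ge0 V j x : 0 <= cutoff V j x.
Proof. by rewrite le_min ler01 mulr_ge0// inradius_ge0. Qed.

Lemma cutoff_le1 V j x : cutoff V j x <= 1.
Proof. by rewrite ge_min lexx. Qed.

Lemma cutoff_out V j x : ~ V x -> cutoff V j x = 0.
Proof. by move=> Vx; rewrite /cutoff inradius0// mulr0; apply/min_r. Qed.

Lemma cutoff_lipschitz V j x y : `|cutoff V j x - cutoff V j y| <= j%:R * `|x - y|.
Proof.
apply: le_trans (minr1_lipschitz _ _) _.
by rewrite -mulrBr normrM normr_nat ler_wpM2l// inradius_lipschitz.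
Qed.

Lemma cutoff_cvg V x : open V -> cutoff V j x @[j --> \oo] --> (\1_V x : R).
Proof.
move=> oV; rewrite indicE; case: (boolP (x \in V)) => [/[!inE] Vx|/negP Vx].
  apply: cvg_near_cst; near=> j; apply/min_l.
  rewrite -ler_pdivrMr ?inradius_gt0//; near: j.
  exact: nbhs_infty_ger.
by apply: cvg_near_cst; apply: nearW => j; rewrite cutoff_out// => /mem_set.
Unshelve. all: by end_near. Qed.

End distance_to_complement.

Section ae_eq0_tests.
Context {R : realType} {n : nat}.
Local Notation mu := (lebesgue_cV n : {measure set 'cV[R]_n -> \bar R}).
Local Open Scope ereal_scope.

(** Open sets form a pi-system generating the Borel sets, so by Dynkin's lemma the integral of [h]
    vanishes over every measurable set. *)
Lemma ae_eq0_open (h : 'cV[R]_n -> R) : mu.-integrable setT (EFin \o h) ->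
  (forall V : set 'cV[R]_n, open V -> \int[mu]_(x in V) (h x)%:E = 0) ->
  {ae mu, forall x, h x = 0%R}.
Proof.
move=> ih h0.
have H A : measurable A -> \int[mu]_(x in A) (h x)%:E = 0.
  move=> mA; apply: (@dynkin_induction _ 'cV[R]_n [set U | open U]
    (fun A => \int[mu]_(x in A) (h x)%:E = 0) erefl _ _ _ _ _ A mA).
  - by move=> B C oB oC; exact: openI.
  - by apply: h0; exact: openT.
  - exact: h0.
  - move=> B mB B0.
    have := h0 _ openT; rewrite -(setUv B) integral_setU//.
    + by rewrite B0 add0e.
    + exact: measurableC.
    + by rewrite setUv; exact: measurable_int ih.
    + exact/disj_setPCl.
  - move=> F mF tF F0; rewrite integral_bigcup//.
      by apply: eseries0 => i _ _; exact: F0.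
    apply: integrableS ih => //; exact: bigcupT_measurable.
have : ae_eq mu setT (EFin \o h) (cst 0).
  by apply: integral_ae_eq => // E _ mE; rewrite integral_cst// mul0e; exact: H.
by apply: filterS => x /(_ I) /= [].
Qed.

(** The cutoffs converge to the indicator of [V], dominated by [|h|]. Only [V] inside [D] is tested
    because increments of [F] are controlled only against functions supported in [D]. *)
Lemma ae_eq0_cutoff (D : set 'cV[R]_n) (h : 'cV[R]_n -> R) : open D ->
  mu.-integrable setT (EFin \o h) -> (forall x, ~ D x -> h x = 0%R) ->
  (forall V j, open V -> V `<=` D -> \int[mu]_x (cutoff V j x * h x)%:E = 0) ->
  {ae mu, forall x, h x = 0%R}.
Proof.
move=> oD ih hD h0; apply: ae_eq0_open => // U oU; pose V := U `&` D.
have oV : open V by exact: openI.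
have mV : measurable V by exact: measurable_open_cV.
have mU : measurable U by exact: measurable_open_cV.
have mh : measurable_fun setT h by apply/measurable_EFinP; exact: measurable_int ih.
have -> : \int[mu]_(x in U) (h x)%:E = \int[mu]_x (\1_V x * h x)%:E.
  rewrite integral_mkcond; apply: eq_integral => x _ /=; rewrite patchE indicE /V in_setI.
  case: (x \in U); rewrite ?mul0r//=; case: (boolP (x \in D)); rewrite ?mul1r//.
  by move=> /negP Dx; rewrite hD ?mulr0// => /mem_set.
have /cvg_lim <- // : (fun j => \int[mu]_x (cutoff V j x * h x)%:E) @ \oo -->
    \int[mu]_x (\1_V x * h x)%:E.
  apply: (@dominated_cvg _ _ _ mu setT measurableT _ _ (fun x => `|(h x)%:E|)) => //.
  - move=> j; apply/measurable_EFinP; apply: measurable_funM => //.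
    by apply: lipschitz_measurable_cV => x y; exact: cutoff_lipschitz.
  - move=> x _; apply: cvg_EFin; first exact: nearW.
    by apply: cvgM; [exact: cutoff_cvg|exact: cvg_cst].
  - exact: integrable_abse.
  - move=> j x _; rewrite lee_fin normrM ler_piMl// ger0_norm ?cutoff_ge0//.
    exact: cutoff_le1.
apply: lim_near_cst => //; apply: nearW => j; apply: h0 => //.
exact: subIsetr.
Qed.

End ae_eq0_tests.

(** * The fundamental theorem for everywhere differentiable functions *)

Section everywhere_differentiable_FTC.
Context {R : realType}.
Local Notation mu := (@lebesgue_measure R).
Local Open Scope ereal_scope.

(* Half of the Vitali-Caratheodory theorem; the level sets of [h] are covered
   by open sets of almost the same measure. *)
Lemma locally_dominating (a b : R) (h : R -> R) (e : R) : (a < b)%R ->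
  (0 < e)%R -> mu.-integrable `[a, b] (EFin \o h) ->
  (forall x, `[a, b]%classic x -> 0 <= h x)%R ->
  exists G : R -> \bar R,
    [/\ measurable_fun [set: R] G, forall x, 0 <= G x,
        \int[mu]_(x in `[a, b]) G x <= \int[mu]_(x in `[a, b]) (h x)%:E + e%:E &
        forall x, `[a, b]%classic x -> \forall t \near x, (h x)%:E <= G t].
Proof.
move=> ab e0 ih h0; set I := `[a, b]%classic.
have mI : measurable (I : set (measurableTypeR R)) by exact: measurable_itv.
have muI : mu I = (b - a)%:E by rewrite lebesgue_measure_itv/= lte_fin ab EFinB.
(* Rounding [h] up to a multiple of [eta] costs at most half of [e]; the other half pays for the
   open neighbourhoods of the level sets. *)
pose eta := (e / 2 / (b - a))%R.
have eta0 : (0 < eta)%R by rewrite !divr_gt0// subr_gt0.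
have mh : measurable_fun (I : set (measurableTypeR R)) h by apply/measurable_EFinP; exact: measurable_int ih.
pose E k := I `&` [set x | Num.Def.truncn (h x / eta) == k].
have EP k x : E k x -> (k%:R * eta <= h x < k.+1%:R * eta)%R.
  move=> [Ix /= /eqP <-]; rewrite -ler_pdivlMr// -ltr_pdivrMr//.
  by apply: truncn_itv; rewrite divr_ge0 ?h0// ltW.
have mE k : measurable (E k : set (measurableTypeR R)).
  rewrite (_ : E k = (I `&` (h @^-1` `[k%:R * eta, k.+1%:R * eta[%classic))%R).
    exact: mh.
  apply/seteqP; split => x [Ix /=].
    by move=> /(conj Ix) /EP; rewrite in_itv.
  rewrite in_itv/= -ler_pdivlMr// -ltr_pdivrMr// => hk; split => //=.
  by rewrite truncn_eq// divr_ge0 ?h0// ltW.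
have Efin k : mu (E k) < +oo.
  apply: (@le_lt_trans _ _ (mu I)); last by rewrite muI ltry.
  by apply: le_measure; rewrite ?inE; [exact: mE|exact: mI|move=> x []].
pose c k := (k.+1%:R * eta)%R.
have c0 k : (0 < c k)%R by rewrite mulr_gt0.
(* The excess of [U k] over [E k], weighted by the level [c k], is below [e / 2] times
   [1 / 2^(k+1)]; these bounds sum to [e / 2]. *)
have /choice[U HU] k : exists U : set R, [/\ open U, E k `<=` U &
    mu (U `\` E k) < (e / 2 / (2 ^ k.+1)%:R / c k)%:E].
  apply: lebesgue_regularity_outer; [exact: mE|exact: Efin|].
  by rewrite !divr_gt0// ltr0n expn_gt0.
have mU k : measurable (U k : set (measurableTypeR R)) by apply: open_measurable; have [] := HU k.
(* Since [U k] is an open neighbourhood of every point [x] of [E k], a single term of the sum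
   already keeps [G] above [h x] near [x]. *)
pose G x := \sum_(k <oo) (c k * \1_(U k) x)%:E.
have mG k (D : set (measurableTypeR R)) : measurable_fun D (fun x => (c k * \1_(U k) x)%:E).
  by apply/measurable_EFinP; apply: measurable_funM => //; exact: measurable_indic.
have G0 k x : 0 <= (c k * \1_(U k) x)%:E.
  by rewrite lee_fin mulr_ge0// ltW.
have cG k x : U k x -> (c k)%:E <= G x.
  move=> Ukx; rewrite /G (@nneseriesD1 _ _ k)//.
  by rewrite indicE mem_set// mulr1 leeDl// nneseries_ge0.
exists G; split.
- by apply: ge0_emeasurable_sum => [k x _ _|k _]; [exact: G0|exact: mG].
- by move=> x; exact: nneseries_ge0.
- rewrite integral_nneseries//.
  have trE : trivIset setT E.
    apply/trivIsetP => i j _ _ ij; rewrite -subset0 => x [[_ /= /eqP ii] [_ /= /eqP jj]].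
    by move: ij; rewrite -ii -jj eqxx.
  have EI : \bigcup_k E k = I.
    apply/seteqP; split => [x [k _ []]//|x Ix].
    by exists (Num.Def.truncn (h x / eta)) => //; split => //=.
  apply: (@le_trans _ _ (\sum_(k <oo)
     (\int[mu]_(x in E k) (h x + eta)%:E + (e / 2 / (2 ^ k.+1)%:R)%:E))).
    apply: lee_nneseries => [k _ _|k _]; first exact: integral_ge0.
    under eq_integral do rewrite EFinM.
    rewrite ge0_integralZl_EFin ?(ltW (c0 k))//; last first.
      by apply/measurable_EFinP; apply: measurable_indic; exact: mU.
    rewrite integral_indic//.
    apply: (@le_trans _ _ ((c k)%:E * (mu (E k) + (e / 2 / (2 ^ k.+1)%:R / c k)%:E))).
      rewrite lee_pmul2l//; last by rewrite lte_fin.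
      apply: (@le_trans _ _ (mu (U k))).
        apply: le_measure; rewrite ?inE; [|exact: mU|exact: subIsetl].
        by apply: measurableI; [exact: mU|exact: mI].
      have [_ EU UE] := HU k.
      rewrite -(setDUK EU) measureU//; first by rewrite leeD2l// ltW.
      - by apply: measurableD; [exact: mU|exact: mE].
      - by rewrite setDIK.
    rewrite muleDr//; last by rewrite ge0_adde_def// inE ?measure_ge0// lee_fin
      !divr_ge0// ltW.
    rewrite -EFinM mulrC divfK ?gt_eqF// leeD2r//.
    rewrite -integral_cst//; apply: ge0_le_integral => //.
    - by move=> x _; rewrite /= lee_fin ltW.
    - apply/measurable_EFinP/measurable_funD => //.
      by apply: measurable_funS mh => // x [].
    - move=> x /EP /andP[+ _]; rewrite lee_fin /c -natr1 mulrDl mul1r => ?.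
      by rewrite lerD2r.
  have IE : \int[mu]_(x in I) (h x + eta)%:E =
      \int[mu]_(x in I) (h x)%:E + (e / 2)%:E.
    under eq_integral do rewrite EFinD.
    rewrite integralD//; last first.
      by apply/integrableP; split => //; rewrite integral_cst//= muI -EFinM ltry.
    rewrite integral_cst//= muI -EFinM; congr (_ + _%:E).
    by rewrite /eta divfK// subr_eq0 gt_eqF.
  apply: (@le_trans _ _ ((\int[mu]_(x in I) (h x)%:E + (e / 2)%:E) + (e / 2)%:E)).
    rewrite -IE -EI ge0_integral_bigcup//; first last.
    - by rewrite EI => x Ix; rewrite lee_fin addr_ge0 ?(ltW eta0)// h0.
    - by rewrite EI; apply/measurable_EFinP/measurable_funD.
    apply: epsilon_trick; last by rewrite divr_ge0// ltW.
    move=> k; apply: integral_ge0 => x [Ix _].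
    by rewrite lee_fin addr_ge0 ?(ltW eta0)// h0.
  by rewrite -addeA -EFinD -splitr.
- move=> x Ix; set k := Num.Def.truncn (h x / eta).
  have Ekx : E k x by split => /=.
  have [oU EU _] := HU k.
  have : nbhs x (U k) by apply: open_nbhs_nbhs; split => //; exact: EU.
  apply: filterS => t Ut; apply: le_trans (cG k t Ut).
  by rewrite lee_fin /c ltW//; have /andP[] := EP _ _ Ekx.
Qed.

Lemma derivative_nearP (phi : R -> R) (x g e : R) : is_derive x 1%R phi g ->
  (0 < e)%R -> \forall t \near x, (`|phi t - phi x - g * (t - x)| <= e * `|t - x|)%R.
Proof.
move=> [dphi gE] e0; move: dphi gE; rewrite /derivable /derive => dphi gE.
have : (h^-1 *: (phi (h *: 1 + x) - phi x) @[h --> 0^'] --> g)%R by rewrite -gE.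
move=> /cvgrPdist_le /(_ _ e0) [d /= d0 Hd].
exists d => //= t xt; have [->|tx] := eqVneq t x.
  by rewrite !subrr mulr0 subr0 normr0 mulr0.
have tx0 : (t - x != 0)%R by rewrite subr_eq0.
have := Hd (t - x)%R; rewrite /= sub0r normrN distrC => /(_ xt tx0).
rewrite [X in phi X](_ : _ = t)%R; last by rewrite /GRing.scale/= mulr1 subrK.
rewrite -(ler_pM2r (_ : 0 < `|t - x|)%R) ?normr_gt0//.
by rewrite -normrM mulrBl /GRing.scale/= mulrAC mulVf// mul1r => H; rewrite [X in (X <= _)%R]distrC (distrC x).
Qed.

(** Let [S] collect the [x] at which the inequality holds with slack [e * (x - a)]. Continuity of
    [phi] puts [sup S] in [S]; were it less than [b], differentiability there would carry the
    inequality further to the right. *)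
Lemma le_integral_of_derive_le (phi g : R -> R) (G : R -> \bar R) (a b : R) :
  (a < b)%R -> (forall t, `[a, b]%classic t -> is_derive t 1%R phi (g t)) ->
  measurable_fun [set: R] G -> (forall x, 0 <= G x) ->
  (forall x, `[a, b]%classic x -> \forall t \near x, (g x)%:E <= G t) ->
  (phi b - phi a)%:E <= \int[mu]_(t in `[a, b]) G t.
Proof.
move=> ab dphi mG G0 gG.
have mGD (D : set (measurableTypeR R)) : measurable_fun D G by exact: measurable_funTS.
pose I x := \int[mu]_(t in `[a, x]) G t.
have I_mono x y : (x <= y)%R -> I x <= I y.
  by move=> xy; apply: ge0_subset_integral => //; exact: subset_itvl.
apply/lee_addgt0Pr => e0 e0_gt0; pose e := (e0 / (b - a))%R.
have e_gt0 : (0 < e)%R by rewrite divr_gt0// subr_gt0.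
have -> : e0 = (e * (b - a))%R by rewrite /e divfK// subr_eq0 gt_eqF.
pose S := [set x | (a <= x <= b)%R /\ (phi x - phi a)%:E <= I x + (e * (x - a))%:E].
have Sa : S a.
  split; first by rewrite lexx ltW.
  by rewrite !subrr mulr0 adde0 integral_ge0.
have Sub : has_sup S by split; [exists a|exists b => x [/andP[]]].
set s := sup S.
have as_ : (a <= s)%R by exact: sup_upper_bound.
have sb : (s <= b)%R by apply: sup_le_ub; [exists a|move=> x [/andP[]]].
have sab : `[a, b]%classic s by rewrite /= in_itv/= as_.
have cphi : {for s, continuous phi}.
  by apply: differentiable_continuous; apply/derivable1_diffP; have [] := dphi _ sab.
have Ss : S s.
  split; first by rewrite as_.
  apply/lee_addgt0Pr => e1 e1_gt0.
  move/cvgrPdist_le : cphi => /(_ _ e1_gt0) [d /= d0 Hd].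
  have [x Sx sx] := sup_adherent d0 Sub.
  have xs : (x <= s)%R by exact: sup_upper_bound.
  have := Hd x; rewrite /= ger0_norm ?subr_ge0// => /(_ _).
  have -> : (s - x < d)%R by rewrite -/s in sx; lra.
  move=> /(_ isT); rewrite ler_norml => /andP[_ px].
  have [_ Px] := Sx.
  apply: (@le_trans _ _ ((phi x - phi a)%:E + e1%:E)).
    by rewrite -EFinD lee_fin; lra.
  rewrite leeD2r// (le_trans Px)// leeD ?I_mono// lee_fin ler_pM2l//; lra.
suff -> : b = s by case: Ss.
apply/eqP; rewrite eq_sym eq_le sb leNgt; apply/negP => sb'.
have [d /= d0 Hd] := derivative_nearP (dphi _ sab) e_gt0.
have [d' /= d'0 Hd'] := gG _ sab.
have [r [r0 rd rd' rb]] : exists r,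
    [/\ 0 < r, r < d, r < d' & s + r <= b]%R.
  have [m m0 [md md']] : exists2 m, (0 < m)%R & (m < d /\ m < d')%R.
    by have [dd'|d'd] := leP d d'; [exists (d / 2)%R|exists (d' / 2)%R];
      try split; lra.
  by have [mbs|bsm] := leP m (b - s)%R; [exists m|exists (b - s)%R]; split; lra.
have : S (s + r)%R.
  split; first by rewrite rb andbT; lra.
  (* Just beyond [s] the integral of [G] grows at least at rate [g s], because [G] dominates this
     one value on a whole neighbourhood. *)
  have Isr : I s + (g s * r)%:E <= I (s + r)%R.
    rewrite /I (@itv_bndbnd_setU _ _ (BLeft a) (BRight s) (BRight (s + r)%R))
      ?bnd_simp ?lerDl ?(ltW r0)//.
    rewrite ge0_integral_setU//=; last first.
      by apply: lt_disjoint => x y; rewrite !in_itv/= => /andP[_ xs] /andP[sy _]; exact: le_lt_trans sy.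
    rewrite leeD2l//.
    have [gs0|gs0] := leP (g s) 0%R.
      apply: (@le_trans _ _ 0); last exact: integral_ge0.
      by rewrite lee_fin mulr_le0_ge0// ltW.
    apply: (@le_trans _ _ (\int[mu]_(t in `]s, (s + r)%R]) (g s)%:E)).
      rewrite integral_cst//= lebesgue_measure_itv/= lte_fin ltrDl r0 -EFinB.
      by rewrite -EFinM addrAC subrr add0r.
    apply: ge0_le_integral => //.
      by move=> x _; rewrite lee_fin ltW.
    move=> x; rewrite /= in_itv/= => /andP[sx xr]; apply: Hd' => /=.
    by rewrite ltr0_norm ?subr_lt0//; lra.
  have [_ Ps] := Ss.
  apply: (@le_trans _ _ ((phi s - phi a)%:E + (g s * r + e * r)%:E)).
    rewrite -EFinD lee_fin.
    have := Hd (s + r)%R; rewrite /= opprD addrA subrr sub0r normrN gtr0_norm// => /(_ rd).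
    rewrite ler_norml addrAC subrr add0r gtr0_norm// => /andP[_]; lra.
  apply: (@le_trans _ _ ((I s + (g s * r)%:E) + (e * (s + r - a))%:E)).
    apply: le_trans (leeD2r _ Ps) _.
    by rewrite -2!(addeA (I s)) leeD2l// -!EFinD lee_fin; lra.
  exact: leeD2r.
move=> /(sup_upper_bound Sub); rewrite -/s; lra.
Qed.

(** Truncating [g] below at [- n] and adding [n] gives a nonnegative function with a locally
    dominating [G] of nearly the same integral; the derivative of [t |-> phi t + n * t] is at most
    this function. Dominated convergence removes the truncation. *)
Lemma derive_integral_ge (phi g : R -> R) (a b : R) : (a < b)%R ->
  (forall t, `[a, b]%classic t -> is_derive t 1%R phi (g t)) ->
  mu.-integrable `[a, b] (EFin \o g) ->
  (phi b - phi a)%:E <= \int[mu]_(t in `[a, b]) (g t)%:E.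
Proof.
move=> ab dphi ig; set I := `[a, b]%classic.
have mI : measurable (I : set (measurableTypeR R)) by exact: measurable_itv.
have mg : measurable_fun (I : set (measurableTypeR R)) g.
  by apply/measurable_EFinP; exact: measurable_int ig.
pose k (n : nat) t := (Num.max (g t) (- n%:R))%R.
have mk n : measurable_fun (I : set (measurableTypeR R)) (EFin \o k n).
  by apply/measurable_EFinP; exact: measurable_maxr.
have kg n t : (`|k n t| <= `|g t|)%R.
  rewrite /k; case: (leP (g t) (- n%:R)%R) => [gn|//].
  rewrite normrN ger0_norm// ler0_norm; first by rewrite lerNr.
  by rewrite (le_trans gn)// oppr_le0.
have ik n : mu.-integrable I (EFin \o k n).
  by apply: le_integrable ig => // t _ /=; rewrite lee_fin.
have phik n : (phi b - phi a)%:E <= \int[mu]_(t in I) (k n t)%:E.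
  apply/lee_addgt0Pr => e e0.
  have in_ : mu.-integrable I (EFin \o cst n%:R).
    apply: measurable_bounded_integrable => //=.
      by rewrite lebesgue_measure_itv/= lte_fin ab ltry.
    exact: bounded_cst.
  have [||G [mG G0 Ge kG]] := @locally_dominating a b (fun t => k n t + n%:R)%R e ab e0.
  - have := integrableD mI (ik n) in_; exact: eq_integrable.
  - by move=> t _; rewrite -lerBlDr sub0r le_max lexx orbT.
  have : ((phi b + n%:R * b) - (phi a + n%:R * a))%:E <= \int[mu]_(t in `[a, b]) G t.
    apply: (@le_integral_of_derive_le (fun t => phi t + n%:R * t)%R
      (fun t => g t + n%:R)%R) => //.
    - move=> t /dphi dt; apply: is_deriveD.
      by apply: is_derive_eq; rewrite /GRing.scale/= mulr1.
    - move=> x /kG; apply: filterS => t; apply: le_trans.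
      by rewrite lee_fin lerD2r le_max lexx.
  move=> /le_trans /(_ Ge).
  under eq_integral do rewrite EFinD.
  rewrite integralD//; last exact: ik.
  rewrite integral_cst//= lebesgue_measure_itv/= lte_fin ab.
  rewrite -EFinB -EFinM addeAC => H.
  rewrite -(@leeD2rE _ (n%:R * (b - a))%:E)//.
  by rewrite -EFinD (le_trans _ H)// lee_fin; lra.
have [| |_ _ cvg] := dominated_convergence mI mk (measurable_int _ ig) _ (integrable_abse ig).
- apply: aeW => t It; apply: cvg_near_cst.
  near=> n; rewrite /= /k; congr EFin; apply/max_l.
  rewrite lerNl; near: n; exact: nbhs_infty_ger.
- by apply: aeW => t n It /=; rewrite lee_fin.
rewrite -(cvg_lim _ cvg)//; apply: lime_ge; last exact: nearW.
by apply/cvg_ex; eexists; exact: cvg.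
Unshelve. all: by end_near. Qed.

(** The converse inequality is the previous one for [- phi]. The derivative is merely integrable,
    which is all that partial derivatives offer along a line. *)
Lemma integral_derive (phi g : R -> R) (a b : R) : (a < b)%R ->
  (forall t, `[a, b]%classic t -> is_derive t 1%R phi (g t)) ->
  mu.-integrable `[a, b] (EFin \o g) ->
  \int[mu]_(t in `[a, b]) (g t)%:E = (phi b - phi a)%:E.
Proof.
move=> ab dphi ig; apply/eqP; rewrite eq_le derive_integral_ge// andbT.
have dNphi t : `[a, b]%classic t -> is_derive t 1%R (- phi)%R (- g t)%R.
  by move=> /dphi dt; exact: is_deriveN.
have H := @derive_integral_ge (- phi)%R (fun t => - g t)%R a b ab dNphi.
have mI : measurable (`[a, b]%classic : set (measurableTypeR R)) by exact: measurable_itv.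
have := H (integrableN ig); under eq_integral do rewrite EFinN.
rewrite integralN; last exact: integrable_add_def.
by rewrite leeNr -EFinN => /le_trans; apply; rewrite lee_fin !fctE; lra.
Qed.

End everywhere_differentiable_FTC.

(** * Increments as averages of directional derivatives *)

Section unit_interval.
Context {R : realType}.
Local Notation leb := (@lebesgue_measure R).
Local Open Scope ereal_scope.

(** Averages over [[0, 1]] as a probability on the whole line, so that product measures and Fubini
    apply directly. *)
Definition unif01 : probability (measurableTypeR R) R := uniform_prob (@ltr01 R).

Let mI : measurable (`[0%R, 1%R]%classic : set (measurableTypeR R)).
Proof. exact: measurable_itv. Qed.

Let unif01_sub (A : set (measurableTypeR R)) : measurable A ->
  A `<=` `[0%R, 1%R]%classic -> unif01 A = leb A.
Proof.
move=> mA AI; rewrite /unif01/= /uniform_prob integral_uniform_pdf.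
rewrite setIidl// (eq_integral (cst 1)) ?integral_cst ?mul1e//.
move=> x /[!inE] /AI; rewrite /= in_itv/= => x01.
by rewrite /uniform_pdf x01 subr0 invr1.
Qed.

Let unif01_out : unif01 (~` `[0%R, 1%R]%classic) = 0.
Proof.
rewrite probability_setC// unif01_sub// lebesgue_measure_itv/= lte_fin ltr01.
by rewrite oppr0 adde0 subee.
Qed.

Let ge0_integral_unif01 (f : R -> \bar R) : measurable_fun [set: measurableTypeR R] f ->
  (forall s, 0 <= f s) -> \int[unif01]_s f s = \int[leb]_(s in `[0%R, 1%R]) f s.
Proof.
move=> mf f0.
rewrite (ge0_negligible_integral _ _ _ _ unif01_out)//; last exact: measurableC.
rewrite setDE setCK setTI; apply: eq_measure_integral => A mA AI.
exact: unif01_sub.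
Qed.

Lemma integral_unif01 (f : R -> \bar R) : measurable_fun [set: measurableTypeR R] f ->
  \int[unif01]_s f s = \int[leb]_(s in `[0%R, 1%R]) f s.
Proof.
move=> mf; rewrite integralE [RHS]integralE !ge0_integral_unif01//.
  exact: measurable_funeneg.
exact: measurable_funepos.
Qed.

Lemma integrable_unif01 (f : R -> \bar R) : unif01.-integrable setT f ->
  leb.-integrable `[0%R, 1%R] f.
Proof.
move=> /integrableP[mf f_oo]; apply/integrableP; split.
  exact: measurable_funTS.
rewrite -integral_unif01//; exact: measurableT_comp.
Qed.

Lemma integral_unif01_cst (c : R) : \int[unif01]_s c%:E = c%:E.
Proof. by rewrite integral_cst// [X in _ * X](probability_setT unif01) mule1. Qed.

(** Jensen's inequality for the square: integrate [2 |c| |h| <= h^2 + c^2] and use that [|c|] is at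
    most the integral of [|h|]. The right-hand side may be infinite; only the finite [c^2] is
    cancelled. *)
Lemma sqr_integral_unif01 (h : R -> R) (c : R) :
  measurable_fun [set: measurableTypeR R] h ->
  \int[unif01]_s (h s)%:E = c%:E ->
  (c ^+ 2)%:E <= \int[unif01]_s (h s ^+ 2)%:E.
Proof.
move=> mh hc.
have mh2 : measurable_fun [set: measurableTypeR R] (fun s => (h s ^+ 2)%:E).
  by apply/measurable_EFinP; exact: measurable_funX.
have mhn : measurable_fun [set: measurableTypeR R] (fun s => (`|h s|)%:E).
  by apply/measurable_EFinP; exact: measurableT_comp.
have H : \int[unif01]_s (2 * `|c| * `|h s|)%:E <=
    \int[unif01]_s (h s ^+ 2 + c ^+ 2)%:E.
  apply: ge0_le_integral => //.
  - apply/measurable_EFinP; apply: measurable_funM => //.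
    exact/measurable_EFinP.
  - apply/measurable_EFinP; apply: measurable_funD => //.
    exact/measurable_EFinP.
  - move=> s _; rewrite lee_fin -real_normK ?num_real// -(real_normK (num_real c)).
    by rewrite -subr_ge0 (_ : _ - _ = (`|h s| - `|c|) ^+ 2)%R ?sqr_ge0//; ring.
move: H; under eq_integral do rewrite EFinM.
rewrite ge0_integralZl_EFin ?mulr_ge0//.
under [X in _ <= X]eq_integral do rewrite EFinD.
rewrite ge0_integralD//; last by move=> s _; rewrite lee_fin sqr_ge0.
  rewrite integral_unif01_cst => H.
  have {}H : (2 * `|c| * `|c|)%:E <= \int[unif01]_s (h s ^+ 2)%:E + (c ^+ 2)%:E.
    apply: le_trans H; rewrite EFinM lee_wpmul2l ?lee_fin ?mulr_ge0//.
    rewrite -abse_EFin -hc; apply: le_abse_integral => //.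
    exact/measurable_EFinP.
  rewrite -(@leeD2rE _ (c ^+ 2)%:E)// (le_trans _ H)// -EFinD lee_fin.
  by rewrite -mulrA -expr2 real_normK ?num_real//; lra.
by move=> s _; rewrite lee_fin sqr_ge0.
Qed.

End unit_interval.

Section coordinate_increments.
Context {R : realType} {n : nat}.
Local Notation mu := (lebesgue_cV n : {sigma_finite_measure set 'cV[R]_n -> \bar R}).
Local Notation leb := (@lebesgue_measure R).
Local Notation unif01 := (@unif01 R).
Implicit Types (F g phi : 'cV[R]_n -> R) (u v w x y : 'cV[R]_n).

Lemma norm_coord_cV_le x i : `|x i ord0| <= `|x|.
Proof.
rewrite [leRHS]/Num.Def.normr /= mx_normrE; apply/bigmax_geP; right.
by exists (i, ord0).
Qed.

Lemma norm_cV_le x (r : R) : 0 <= r -> (forall i, `|x i ord0| <= r) -> `|x| <= r.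
Proof.
move=> r0 xr; rewrite [leLHS]/Num.Def.normr /= mx_normrE; apply/bigmax_leP; split => //.
by move=> [i j] _ /=; rewrite (ord1 j).
Qed.

Lemma is_derive_line F y u (s g : R) : is_derive (y + s *: u) u F g ->
  is_derive s 1 (fun r : R => F (y + r *: u)) g.
Proof.
have E : (fun h : R => h^-1 *: (F (y + (h *: 1 + s) *: u) - F (y + s *: u))) =
         (fun h : R => h^-1 *: (F (h *: u + (y + s *: u)) - F (y + s *: u))).
  apply/funext => h; congr (_ *: (F _ - _)).
  by rewrite (_ : h *: 1 = h) ?scalerDl 1?addrCA// /GRing.scale/= mulr1.
by move=> [dF Fg]; split; rewrite /derivable /derive /= E.
Qed.

Lemma is_derive_line_scaled F y u (c s g : R) :
  is_derive (y + (s * c) *: u) u F g ->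
  is_derive s 1 (fun r : R => F (y + (r * c) *: u)) (c * g).
Proof.
move=> /is_derive_line dF.
have dc : is_derive s 1 (fun r : R => r * c) c.
  by apply: is_derive_eq; rewrite /GRing.scale/= mulr1 mulr0 add0r.
by rewrite mulrC; exact: (@is_derive1_comp _ (fun r : R => F (y + r *: u)) _ s _ _ dF dc).
Qed.

Lemma measurable_segment d (T : measurableType d) (a : T -> 'cV[R]_n)
    (s : T -> R) u :
  measurable_fun setT a -> measurable_fun setT s ->
  measurable_fun setT (fun t => a t + s t *: u).
Proof.
move=> ma ms; apply: measurable_fun_addr_cV => //.
exact: measurable_fun_scaler_cV.
Qed.

Section segment.
Variables (phi g : 'cV[R]_n -> R) (a u : 'cV[R]_n).
Hypotheses (mphi : measurable_fun setT phi) (phi1 : forall x, `|phi x| <= 1).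
Hypothesis ig : mu.-integrable setT (EFin \o g).

Let mg : measurable_fun setT g.
Proof. by apply/measurable_EFinP; exact: measurable_int ig. Qed.

Let f (p : 'cV[R]_n * measurableTypeR R) := (phi p.1 * g (p.1 + a + p.2 *: u))%:E.

Let mf : measurable_fun [set: 'cV[R]_n * measurableTypeR R] f.
Proof.
apply/measurable_EFinP/measurable_funM; first exact: measurableT_comp.
apply: (measurableT_comp mg); apply: measurable_segment.
  by apply: measurable_fun_addr_cV => //; exact: measurable_fst.
exact: measurable_snd.
Qed.

Lemma integrable_shift_mul b :
  mu.-integrable setT (EFin \o (fun x => phi x * g (x + b))).
Proof.
apply: (le_integrable _ _ _ (integrable_shift_cV b ig)) => //.
  apply/measurable_EFinP/measurable_funM => //.
  by apply: (measurableT_comp mg); exact: measurable_shift_cV.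
by move=> x _ /=; rewrite lee_fin normrM ler_piMl.
Qed.

(** For fixed [s], translation invariance and [|phi| <= 1] bound the integral over [x] by the L1
    norm of [g]. *)
Lemma integrable_segment : (mu \x unif01)%E.-integrable setT f.
Proof.
apply/integrable21ltyP => //.
apply: (@le_lt_trans _ _ (\int[unif01]_s (\int[mu]_x (`|g x|)%:E))%E).
  apply: ge0_le_integral => //.
  - by move=> s _; exact: integral_ge0.
  - apply: (@measurable_fun_fubini_tonelli_G _ _ _ _ _ mu (fun p => `|f p|%E)) => //.
    exact: measurableT_comp.
  - move=> s _.
    rewrite -(@integral_shift_cV _ _ (fun x => `|g x|) (a + s *: u)); last first.
      exact: measurableT_comp.
    apply: ge0_le_integral => //.
    + by apply: measurableT_comp => //; exact: (measurableT_comp mf).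
    + apply/measurable_EFinP; apply: measurableT_comp => //.
      by apply: (measurableT_comp mg); exact: measurable_shift_cV.
    + by move=> x _; rewrite lee_fin normrM addrA ler_piMl.
rewrite integral_cst// [X in (_ * X)%E](probability_setT unif01) mule1.
by case/integrableP : ig.
Qed.

Lemma Fubini_segment :
  (\int[mu]_x \int[unif01]_s (phi x * g (x + a + s *: u))%:E =
   \int[unif01]_s \int[mu]_x (phi x * g (x + a + s *: u))%:E)%E.
Proof. exact: (Fubini integrable_segment). Qed.

Lemma ae_integrable_segment :
  {ae mu, forall x, unif01.-integrable setT (fun s => (phi x * g (x + a + s *: u))%:E)}.
Proof. exact: (ae_integrable1 integrable_segment). Qed.

Lemma integrable_integral_segment :
  mu.-integrable setT (fun x => \int[unif01]_s (phi x * g (x + a + s *: u))%:E)%E.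
Proof. exact: (integrable_fubini_F integrable_segment). Qed.

End segment.

(** The cross-correlation of [phi] and [g]; with [g] a partial derivative it is the tested
    derivative as a function of the displacement. *)
Definition smear phi g w : R := \int[mu]_x (phi x * g (x + w)).

Definition L1norm g : R := \int[mu]_x `|g x|.

Lemma L1norm_ge0 g : 0 <= L1norm g.
Proof. by apply: Rintegral_ge0 => x _. Qed.

(** A translation moves the displacement from the merely integrable [g] onto the Lipschitz factor
    [phi]. *)
Lemma smear_lipschitz phi g (L : R) w w' :
  (forall x, `|phi x| <= 1) -> (forall x y, `|phi x - phi y| <= L * `|x - y|) ->
  mu.-integrable setT (EFin \o g) ->
  `|smear phi g w - smear phi g w'| <= L * L1norm g * `|w - w'|.
Proof.
move=> phi1 phiL ig.
have mphi : measurable_fun setT phi by exact: lipschitz_measurable_cV phiL.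
have mg : measurable_fun setT g.
  by apply/measurable_EFinP; exact: measurable_int ig.
have mphis z : measurable_fun setT (fun x => phi (x - z)).
  by apply: (measurableT_comp mphi); exact: measurable_shift_cV.
have smearE z : smear phi g z = \int[mu]_x (phi (x - z) * g x).
  rewrite /smear /Rintegral; congr fine.
  rewrite -[RHS](@integral_shift_cV _ _ (fun x => phi (x - z) * g x) z).
    by apply: eq_integral => x _; rewrite addrK.
  exact: measurable_funM.
have iphi z : mu.-integrable setT (EFin \o (fun x => phi (x - z) * g x)).
  have := @integrable_shift_mul (fun x => phi (x - z)) g (mphis z) (fun x => phi1 _) ig 0.
  by apply: eq_integrable => // x _ /=; rewrite addr0.
rewrite !smearE -RintegralB//.
apply: (le_trans (le_normr_Rintegral _ _)) => //.
  by have := integrableB measurableT (iphi w) (iphi w'); apply: eq_integrable.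
rewrite mulrAC /L1norm -RintegralZl//; last first.
  exact: integrable_norm.
apply: le_Rintegral => //.
- apply: integrable_norm.
  by have := integrableB measurableT (iphi w) (iphi w'); apply: eq_integrable.
- have := integrableZl measurableT (L * `|w - w'|) (integrable_norm ig).
  exact: eq_integrable.
- move=> x _; rewrite -mulrBl normrM ler_wpM2r//.
  by rewrite (le_trans (phiL _ _))// opprB addrC addrA subrK -normrN opprB.
Qed.

End coordinate_increments.

Section increments_aux.
Context {R : realType}.
Local Notation leb := (@lebesgue_measure R).
Local Notation unif01 := (@unif01 R).

Lemma ae_eq_integrable d (T : measurableType d) (mu : {measure set T -> \bar R})
    (f g : T -> \bar R) : measurable_fun setT g -> ae_eq mu setT f g ->
  mu.-integrable setT f -> mu.-integrable setT g.
Proof.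
move=> mg fg /integrableP[mf foo]; apply/integrableP; split => //.
rewrite -(@ge0_ae_eq_integral _ _ _ mu setT (abse \o f))//.
- exact: measurableT_comp.
- exact: measurableT_comp.
- by move=> x _ /=.
- by move: fg; apply: filterS => x /(_ I) fgx _ /=; rewrite fgx.
Qed.

Lemma Rintegral_sum d (T : measurableType d) (mu : {measure set T -> \bar R})
    (I : Type) (s : seq I) (f : I -> T -> R) :
  (forall i, mu.-integrable setT (EFin \o f i)) ->
  \int[mu]_x (\sum_(i <- s) f i x) = \sum_(i <- s) \int[mu]_x f i x.
Proof.
move=> fi; rewrite {1}/Rintegral; under eq_integral do rewrite -sumEFin.
rewrite integral_sum// -sum_fine// => i _.
exact: (integrable_fin_num measurableT (fi i)).
Qed.

Lemma integrable_sumr d (T : measurableType d) (mu : {measure set T -> \bar R})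
    (I : Type) (s : seq I) (f : I -> T -> R) :
  (forall i, mu.-integrable setT (EFin \o f i)) ->
  mu.-integrable setT (EFin \o (fun x => \sum_(i <- s) f i x)).
Proof.
move=> fi.
have := @integrable_sum _ _ _ mu setT measurableT I s xpredT
  (fun i => EFin \o f i) (fun i _ => fi i).
by apply: eq_integrable => // x _ /=; rewrite sumEFin.
Qed.

Lemma lipschitz_continuous (b : R -> R) (K : R) :
  (forall s t, `|b s - b t| <= K * `|s - t|) -> continuous b.
Proof.
move=> bK s; have K0 : 0 < `|K| + 1 by rewrite ltr_wpDl.
apply/cvgrPdist_le => e e0; near=> t.
apply: (le_trans (bK _ _)); apply: (@le_trans _ _ ((`|K| + 1) * `|s - t|)).
  by rewrite ler_wpM2r// (le_trans (ler_norm _))// lerDl.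
rewrite mulrC -ler_pdivlMr//; near: t.
by apply: cvgr_dist_le; [exact: cvg_id|rewrite divr_gt0].
Unshelve. all: by end_near. Qed.

Lemma lipschitz_integrable_unif01 (b : R -> R) (K M : R) :
  (forall s t, `|b s - b t| <= K * `|s - t|) -> (forall s, `|b s| <= M) ->
  unif01.-integrable setT (EFin \o b).
Proof.
move=> bK bM; apply: measurable_bounded_integrable => //.
- by rewrite [X in (X < _)%E](probability_setT unif01) ltry.
- by apply: continuous_measurable_fun; exact: lipschitz_continuous bK.
- exists M; split; first by rewrite num_real.
  by move=> z Mz s _ /=; rewrite (le_trans (bM _))// ltW.
Qed.

Lemma unif01_lipschitz (b : R -> R) (K M : R) :
  (forall s t, `|b s - b t| <= K * `|s - t|) -> (forall s, `|b s| <= M) ->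
  `|\int[unif01]_s b s - b 0| <= K.
Proof.
move=> bK bM; have K0 : 0 <= K.
  by have := bK 1 0; rewrite subr0 normr1 mulr1; exact: le_trans.
have mb : measurable_fun [set: R] b.
  by apply: continuous_measurable_fun; exact: lipschitz_continuous bK.
have ib : leb.-integrable `[0, 1] (EFin \o b).
  by apply: integrable_unif01; exact: lipschitz_integrable_unif01 bK bM.
have I01 : leb `[0, 1]%classic = 1%E.
  by rewrite lebesgue_measure_itv/= lte_fin ltr01 oppr0 adde0.
have icst (k : R) : leb.-integrable `[0, 1] (EFin \o cst k).
  apply: measurable_bounded_integrable => //=; last exact: bounded_cst.
  by rewrite I01 ltry.
have cstE (k : R) : \int[leb]_(s in `[0, 1]) (cst k s) = k.
  by rewrite Rintegral_cst// [X in fine X]I01/= mulr1.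
have -> : \int[unif01]_s b s = \int[leb]_(s in `[0, 1]) b s.
  by rewrite /Rintegral integral_unif01//; exact/measurable_EFinP.
rewrite -[X in _ - X]cstE -RintegralB//.
have iB : leb.-integrable `[0, 1] (EFin \o (fun s => b s - cst (b 0) s)).
  have mI : measurable (`[0, 1]%classic : set (measurableTypeR R)).
    exact: measurable_itv.
  by have := integrableB mI ib (icst (b 0)); exact: eq_integrable.
apply: (le_trans (le_normr_Rintegral _ _)) => //.
rewrite -[leRHS]cstE; apply: le_Rintegral => //.
  exact: integrable_norm.
move=> s; rewrite /= in_itv/= => /andP[s0 s1].
by rewrite (le_trans (bK _ _))// ler_piMr// subr0 ger0_norm.
Qed.

Lemma is_derive_quadratic (A : R -> R) (t b h0 C : R) : 0 < h0 ->
  (forall h, `|h| < h0 -> `|A (t + h) - A t - h * b| <= C * h ^+ 2) ->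
  is_derive t 1 A b.
Proof.
move=> h00 AC.
have H : h^-1 *: (A (h *: 1 + t) - A t) @[h --> 0^'] --> b.
  apply/cvgrPdist_le => e e0.
  have C0 : 0 < `|C| + 1 by rewrite ltr_wpDl.
  near=> h.
  have hn0 : h != 0 by near: h; exact: nbhs_dnbhs_neq.
  have := AC h; rewrite (_ : h *: 1 + t = t + h); last first.
    by rewrite /GRing.scale/= mulr1 addrC.
  have -> : `|h| < h0 by near: h; exact: dnbhs0_lt.
  move=> /(_ isT) Ah.
  rewrite -(ler_pM2r (_ : 0 < `|h|)) ?normr_gt0// -normrM mulrBl distrC.
  rewrite /GRing.scale/= mulrAC mulVf// mul1r (mulrC b).
  apply: (le_trans Ah); rewrite -(real_normK (num_real h)) expr2 mulrA.
  rewrite ler_wpM2r// (@le_trans _ _ ((`|C| + 1) * `|h|))//.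
    by rewrite ler_wpM2r// (le_trans (ler_norm _))// lerDl.
  rewrite mulrC -ler_pdivlMr//; near: h.
  by apply: dnbhs0_le; rewrite divr_gt0.
by split; [apply/cvg_ex; exists b|apply: cvg_lim].
Unshelve. all: by end_near. Qed.

End increments_aux.

Section coord_step.
Context {R : realType} {n : nat}.
Local Notation mu := (lebesgue_cV n : {sigma_finite_measure set 'cV[R]_n -> \bar R}).
Local Notation leb := (@lebesgue_measure R).
Local Notation unif01 := (@unif01 R).
Variables (F g phi : 'cV[R]_n -> R) (D : set 'cV[R]_n) (i : 'I_n).
Hypotheses (mF : measurable_fun setT F) (ig : mu.-integrable setT (EFin \o g)).
Hypotheses (mphi : measurable_fun setT phi) (phi1 : forall x, `|phi x| <= 1).
Hypothesis phiD : forall x, ~ D x -> phi x = 0.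
Variables (w : 'cV[R]_n) (c : R).
Hypothesis dF : forall x s, D x -> 0 <= s <= 1 ->
  is_derive (x + w + (s * c) *: e_ i) (e_ i) F (g (x + w + (s * c) *: e_ i)).

Let u := c *: (e_ i : 'cV[R]_n).

Let mg : measurable_fun setT g.
Proof. by apply/measurable_EFinP; exact: measurable_int ig. Qed.

Lemma measurable_increment (a b : 'cV[R]_n) :
  measurable_fun setT (fun x => phi x * (F (x + a) - F (x + b))).
Proof.
apply: measurable_funM => //; apply: measurable_funB.
  by apply: (measurableT_comp mF); exact: measurable_shift_cV.
by apply: (measurableT_comp mF); exact: measurable_shift_cV.
Qed.

(** Fubini makes [g] integrable along almost every segment, where the fundamental theorem turns its
    average into the increment. Off [D], where [F] is uncontrolled, both sides vanish with [phi]. *)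
Let ae_step : ae_eq mu setT
  (fun x => c%:E * \int[unif01]_s (phi x * g (x + w + s *: u))%:E)%E
  (fun x => (phi x * (F (x + (w + u)) - F (x + w)))%:E).
Proof.
have m1 : measurable_fun setT (cst 1 : 'cV[R]_n -> R) by [].
have n1 : forall x : 'cV[R]_n, `|cst 1 x : R| <= 1 by move=> x; rewrite normr1.
have := ae_integrable_segment w u m1 n1 ig; apply: filterS => x /= igx _.
have mgx : measurable_fun [set: measurableTypeR R] (fun s => g (x + w + s *: u)).
  by apply: (measurableT_comp mg); exact: measurable_segment.
have {}igx : unif01.-integrable setT (EFin \o (fun s => g (x + w + s *: u))).
  by apply: eq_integrable igx => // s _ /=; rewrite mul1r.
under eq_integral do rewrite EFinM.
rewrite integralZl//; have [/asboolP Dx|/asboolP Dx] := boolP `[< D x >]; last first.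
  by rewrite phiD// !mul0e mule0 mul0r.
rewrite muleCA EFinM; congr (_ * _)%E.
rewrite addrA.
have <- : (\int[leb]_(s in `[0%R, 1%R]) (c * g (x + w + s *: u))%:E =
    (F (x + w + u) - F (x + w))%:E)%E.
  have := @integral_derive R (fun s => F (x + w + (s * c) *: e_ i))
    (fun s => c * g (x + w + s *: u)) 0 1 ltr01.
  rewrite mul1r mul0r scale0r addr0 -/u; apply.
  - move=> t /=; rewrite in_itv/= => t01; apply: is_derive_line_scaled.
    by rewrite /u scalerA; exact: dF.
  - apply: integrable_unif01.
    by have := integrableZl measurableT c igx; exact: eq_integrable.
rewrite -integralZl// integral_unif01//.
by apply: measurable_funeM; exact/measurable_EFinP.
Qed.

(** Nothing bounds [F] itself; its tested increment inherits integrability from the average of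
    [g]. *)
Lemma integrable_coord_step :
  mu.-integrable setT (EFin \o (fun x => phi x * (F (x + (w + u)) - F (x + w)))).
Proof.
apply: (ae_eq_integrable _ ae_step).
  by apply/measurable_EFinP; exact: measurable_increment.
by apply: integrableZl => //; exact: integrable_integral_segment.
Qed.

Lemma integral_coord_step :
  \int[mu]_x (phi x * (F (x + (w + u)) - F (x + w))) =
  c * \int[unif01]_s smear phi g (w + s *: u).
Proof.
have iS := integrable_integral_segment w u mphi phi1 ig.
rewrite {1}/Rintegral -(ae_eq_integral _ _ _ _ _ ae_step)//; first last.
- by apply/measurable_EFinP; exact: measurable_increment.
- by apply: measurable_funeM; exact: measurable_int iS.
rewrite integralZl// fineM//; last exact: (integrable_fin_num measurableT iS).
rewrite Fubini_segment//; congr (_ * fine _); apply: eq_integral => s _.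
rewrite /smear /Rintegral fineK.
  by apply: eq_integral => x _; rewrite addrA.
exact: (integrable_fin_num measurableT (integrable_shift_mul mphi phi1 ig _)).
Qed.

Lemma smear_bound z : `|smear phi g z| <= L1norm g.
Proof.
have iz := integrable_shift_mul mphi phi1 ig z.
apply: (le_trans (le_normr_Rintegral _ _)) => //.
have -> : L1norm g = \int[mu]_x `|g (x + z)|.
  rewrite /L1norm /Rintegral (@integral_shift_cV _ _ (fun x => `|g x|))//.
  exact: measurableT_comp.
apply: le_Rintegral => //.
- exact: integrable_norm.
- by apply: integrable_norm => //; exact: integrable_shift_cV.
- by move=> x _; rewrite normrM ler_piMl.
Qed.

(** Along the segment [smear] is Lipschitz in [s] with a constant proportional to [|c|]. Replacing
    its average by its value at 0 costs that much, and the prefactor [c] makes the error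
    quadratic. *)
Lemma coord_step_estimate (L : R) : (forall x y, `|phi x - phi y| <= L * `|x - y|) ->
  `|\int[mu]_x (phi x * (F (x + (w + u)) - F (x + w))) - c * smear phi g w| <=
  L * L1norm g * c ^+ 2.
Proof.
move=> phiL; rewrite integral_coord_step -mulrBr normrM.
(* The Lipschitz bound at two distinct points forces [L >= 0]; such points exist because [i] shows
   that [n] is positive. *)
have L0 : 0 <= L.
  have := phiL (const_mx 1) 0; rewrite subr0; move: (normr_ge0 (phi (const_mx 1) - phi 0)).
  move=> /le_trans /[apply]; rewrite pmulr_lge0//.
  rewrite (lt_le_trans ltr01)// (le_trans _ (norm_coord_cV_le _ i))// mxE normr1//.
have ue : `|u| <= `|c|.
  rewrite /u normrZ ler_piMr//; apply: norm_cV_le => // j.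
  by rewrite !mxE eqxx andbT; case: eqP => _; rewrite ?normr1 ?normr0.
pose b s := smear phi g (w + s *: u).
have bK s t : `|b s - b t| <= L * L1norm g * `|c| * `|s - t|.
  apply: (le_trans (smear_lipschitz _ _ phi1 phiL ig)).
  rewrite -[leRHS]mulrA ler_wpM2l ?mulr_ge0 ?L1norm_ge0//.
  by rewrite opprD addrACA subrr add0r -scalerBl normrZ mulrC ler_wpM2r.
have := unif01_lipschitz bK (fun s => smear_bound _).
rewrite /b scale0r addr0 => H.
apply: (le_trans (ler_wpM2l _ H)) => //.
rewrite -[in leRHS](real_normK (num_real c)) le_eqVlt; apply/orP; left.
by apply/eqP; ring.
Qed.

End coord_step.

(** * Increments along an arbitrary vector inside a tube *)

Section tube.
Context {R : realType} {n : nat}.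
Local Notation mu := (lebesgue_cV n : {sigma_finite_measure set 'cV[R]_n -> \bar R}).
Local Notation leb := (@lebesgue_measure R).
Local Notation unif01 := (@unif01 R).
Variables (F : 'cV[R]_n -> R) (G : 'I_n -> 'cV[R]_n -> R) (K D : set 'cV[R]_n).
Variables (v : 'cV[R]_n) (delta eta : R).
Hypotheses (mF : measurable_fun setT F).
Hypothesis iG : forall i, mu.-integrable setT (EFin \o G i).
Hypothesis dF : forall i x, K x -> is_derive x (e_ i) F (G i x).
Hypotheses (delta0 : 0 < delta) (eta0 : 0 < eta).
Hypothesis tubeK : forall x (t : R) u, D x -> - eta < t < 1 + eta -> `|u| < delta ->
  K (x + t *: v + u).

(** Corners of the staircase from 0 to [v] that changes one coordinate at a time. Scaled by [h] it
    stays within [|h| |v|] of its start, whence the thickness [delta] of the tube. *)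
Let p (j : nat) : 'cV[R]_n := \col_i (if (i < j)%N then v i ord0 else 0).

Let p0 : p 0 = 0. Proof. by apply/colP => i; rewrite !mxE. Qed.

Let pn : p n = v. Proof. by apply/colP => i; rewrite !mxE ltn_ord. Qed.

Let pS (j : 'I_n) : p j.+1 = p j + v j ord0 *: e_ j.
Proof.
apply/colP => i; rewrite !mxE eqxx andbT ltnS leq_eqVlt.
have [->|ij] := eqVneq i j; first by rewrite eqxx ltnn mulr1 add0r.
by rewrite (negbTE (ij : (i : nat) != j)) orFb mulr0 addr0.
Qed.

Let p_seg (j : 'I_n) (s : R) : 0 <= s <= 1 -> `|p j + (s * v j ord0) *: e_ j| <= `|v|.
Proof.
move=> /andP[s0 s1]; apply: norm_cV_le => // i; rewrite !mxE eqxx andbT.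
apply: le_trans (norm_coord_cV_le v i).
have [->|ij] := eqVneq i j.
  by rewrite ltnn add0r mulr1 normrM ler_piMl// ger0_norm.
by rewrite mulr0 addr0; case: ifP => // _; rewrite normr0.
Qed.

Section test.
Variable phi : 'cV[R]_n -> R.
Hypotheses (mphi : measurable_fun setT phi) (phi1 : forall x, `|phi x| <= 1).
Hypothesis phiD : forall x, ~ D x -> phi x = 0.

Let incr (a b : 'cV[R]_n) x := phi x * (F (x + b) - F (x + a)).

Section small_step.
Variables (t h : R).
Hypotheses (t01 : - eta < t < 1 + eta) (hv : `|h| * `|v| < delta).

Let w j := t *: v + h *: p j.

Let wS (j : 'I_n) : w j.+1 = w j + (h * v j ord0) *: e_ j.
Proof. by rewrite /w pS scalerDr scalerA addrA. Qed.

Let dFw (j : 'I_n) x s : D x -> 0 <= s <= 1 ->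
  is_derive (x + w j + (s * (h * v j ord0)) *: e_ j) (e_ j) F
    (G j (x + w j + (s * (h * v j ord0)) *: e_ j)).
Proof.
move=> Dx s01; apply: dF.
rewrite (_ : x + w j + _ = x + t *: v + h *: (p j + (s * v j ord0) *: e_ j)).
  apply: tubeK => //; rewrite normrZ (le_lt_trans _ hv)// ler_wpM2l//.
  exact: p_seg.
by rewrite /w scalerDr scalerA !addrA; congr (_ + _ *: _); ring.
Qed.

Let incrE x : incr (t *: v) ((t + h) *: v) x =
  \sum_(j < n) incr (w j) (w j + (h * v j ord0) *: e_ j) x.
Proof.
rewrite /incr -mulr_sumr; congr (_ * _).
rewrite (eq_bigr (fun j : 'I_n => F (x + w j.+1) - F (x + w j))); last first.
  by move=> j _; rewrite wS.
rewrite -(big_mkord xpredT (fun j => F (x + w j.+1) - F (x + w j))).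
by rewrite telescope_sumr// /w p0 pn scaler0 addr0 scalerDl.
Qed.

Lemma integrable_small_step :
  mu.-integrable setT (EFin \o incr (t *: v) ((t + h) *: v)).
Proof.
have H (j : 'I_n) : mu.-integrable setT
    (EFin \o (fun x => incr (w j) (w j + (h * v j ord0) *: e_ j) x)).
  exact: (integrable_coord_step mF (iG j) mphi phi1 phiD (@dFw j)).
have := integrable_sumr (index_enum 'I_n) H.
by apply: eq_integrable => // x _; rewrite /= incrE.
Qed.

(** Each stair has two quadratic errors: that of its coordinate step, and that of evaluating [smear]
    at [t *: v] instead of at the corner [w j], which lies within [|h| |v|] of it. *)
Lemma small_step_estimate (L : R) :
  (forall x y, `|phi x - phi y| <= L * `|x - y|) ->
  `|\int[mu]_x incr (t *: v) ((t + h) *: v) x -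
     h * \sum_(j < n) v j ord0 * smear phi (G j) (t *: v)| <=
  (\sum_(j < n) (L * L1norm (G j)) * (v j ord0 ^+ 2 + `|v j ord0| * `|v|)) * h ^+ 2.
Proof.
move=> phiL.
have -> : \int[mu]_x incr (t *: v) ((t + h) *: v) x =
   \sum_(j < n) \int[mu]_x incr (w j) (w j + (h * v j ord0) *: e_ j) x.
  rewrite -Rintegral_sum.
    by apply: eq_Rintegral => x _; rewrite incrE.
  by move=> j; exact: (integrable_coord_step mF (iG j) mphi phi1 phiD (@dFw j)).
rewrite mulr_sumr -sumrB mulr_suml; apply: (le_trans (ler_norm_sum _ _ _)).
apply: ler_sum => j _.
set c := h * v j ord0.
have E1 := coord_step_estimate mF (iG j) mphi phi1 phiD (@dFw j) phiL.
have E2 := smear_lipschitz (w j) (t *: v) phi1 phiL (iG j).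
set I := Rintegral _ _ _; set S := smear phi (G j) (t *: v).
rewrite -/c -/I in E1; rewrite -/S in E2.
rewrite (_ : I - _ = (I - c * smear phi (G j) (w j)) + c * (smear phi (G j) (w j) - S)).
  apply: (le_trans (ler_normD _ _)).
  rewrite [leRHS](_ : _ = L * L1norm (G j) * c ^+ 2 +
    L * L1norm (G j) * (`|v j ord0| * `|v|) * h ^+ 2); last by rewrite /c; ring.
  rewrite lerD//.
  rewrite normrM (le_trans (ler_wpM2l _ E2))//.
  have wt : `|w j - t *: v| <= `|h| * `|v|.
    rewrite /w addrAC subrr add0r normrZ ler_wpM2l//.
    have := @p_seg j 0; rewrite mul0r scale0r addr0; apply.
    by rewrite lexx ler01.
  have LG0 : 0 <= L * L1norm (G j).
    move: E1; rewrite /c => /(le_trans (normr_ge0 _)).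
    have [->|h0] := eqVneq (c ^+ 2) 0; last first.
      by rewrite pmulr_lge0// lt_neqAle eq_sym h0 sqr_ge0.
    have L0 : 0 <= L.
      have := phiL (const_mx 1) 0; rewrite subr0.
      move=> /(le_trans (normr_ge0 _)); rewrite pmulr_lge0//.
      by rewrite (lt_le_trans ltr01)// (le_trans _ (norm_coord_cV_le _ j))// mxE normr1.
    by move=> _; rewrite mulr_ge0// L1norm_ge0.
  apply: (@le_trans _ _ (`|c| * (L * L1norm (G j) * (`|h| * `|v|)))).
    by rewrite !ler_wpM2l.
  rewrite /c normrM -(real_normK (num_real h)) le_eqVlt; apply/orP; left.
  by apply/eqP; ring.
by rewrite mulrBr addrA subrK mulrA.
Qed.

End small_step.

(** Single steps are admissible only for [|h| |v| < delta], so the path is cut into [M.+1] equal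
    pieces. *)
Lemma integrable_path (t : R) : - eta < t < 1 + eta ->
  mu.-integrable setT (EFin \o incr 0 (t *: v)).
Proof.
move=> /andP[t0 t1].
have [M Mv] : exists M : nat, `|t| * `|v| / delta < M.+1%:R.
  exists (Num.Def.truncn (`|t| * `|v| / delta)).
  have q0 : 0 <= `|t| * `|v| / delta by apply: divr_ge0; [exact: mulr_ge0|exact: ltW].
  by have /andP[] := truncn_itv q0.
pose h := t / M.+1%:R.
have hv : `|h| * `|v| < delta.
  rewrite /h normrM normfV (ger0_norm (ler0n _ _)) mulrAC ltr_pdivrMr//.
  by rewrite (mulrC delta) -ltr_pdivrMr.
have lt01 l : (l <= M.+1)%N -> - eta < l%:R * h < 1 + eta.
  move=> lM.
  have l0 : 0 <= l%:R / M.+1%:R :> R by rewrite divr_ge0.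
  have l1 : l%:R / M.+1%:R <= 1 :> R by rewrite ler_pdivrMr// mul1r ler_nat.
  rewrite (_ : l%:R * h = l%:R / M.+1%:R * t); last by rewrite /h; ring.
  move: (l%:R / M.+1%:R : R) l0 l1 => c c0 c1.
  have [t_ge0|/ltW t_le0] := leP 0 t.
    rewrite (lt_le_trans _ (mulr_ge0 c0 t_ge0)) ?oppr_lt0//=.
    by rewrite (le_lt_trans _ t1)// ler_piMl.
  rewrite (lt_le_trans t0) ?ler_niMl//=.
  by rewrite (le_lt_trans (mulr_ge0_le0 c0 t_le0))// addr_gt0.
have H l : (l <= M.+1)%N -> mu.-integrable setT (EFin \o incr 0 ((l%:R * h) *: v)).
  elim: l => [_|l IH lM].
    have := @integrable0 _ _ _ mu setT; apply: eq_integrable => // x _ /=.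
    by rewrite /incr mul0r scale0r addr0 subrr mulr0.
  have lM' : (l <= M.+1)%N by exact: ltnW.
  have := integrableD measurableT (IH lM') (integrable_small_step (lt01 _ lM') hv).
  apply: eq_integrable => // x _ /=.
  rewrite -EFinD /incr -mulrDr -natr1 mulrDl mul1r; congr (_ * _)%:E.
  by ring.
have := H M.+1 (leqnn _); rewrite /h mulrCA mulfV ?mulr1//.
Qed.

(** By the quadratic estimate the tested increment over [t *: v] is differentiable in [t]. The
    margin [eta] beyond [[0, 1]] provides the two-sided derivatives at both ends that the
    fundamental theorem asks for. *)
Lemma integral_path (L : R) : (forall x y, `|phi x - phi y| <= L * `|x - y|) ->
  \int[mu]_x incr 0 v x =
  \sum_(j < n) v j ord0 * \int[unif01]_s smear phi (G j) (s *: v).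
Proof.
move=> phiL.
pose A t := \int[mu]_x incr 0 (t *: v) x.
pose B t := \sum_(j < n) v j ord0 * smear phi (G j) (t *: v).
have bK j s t : `|smear phi (G j) (s *: v) - smear phi (G j) (t *: v)| <=
    L * L1norm (G j) * `|v| * `|s - t|.
  apply: (le_trans (smear_lipschitz _ _ phi1 phiL (iG j))).
  by rewrite -scalerBl normrZ mulrA mulrAC.
have iB j : unif01.-integrable setT (EFin \o (fun s => smear phi (G j) (s *: v))).
  apply: lipschitz_integrable_unif01 (bK j) _ => s.
  exact: (smear_bound (iG j) mphi phi1).
have ivB j : unif01.-integrable setT
    (EFin \o (fun s => v j ord0 * smear phi (G j) (s *: v))).
  by have := integrableZl measurableT (v j ord0) (iB j); exact: eq_integrable.
have -> : \sum_(j < n) v j ord0 * \int[unif01]_s smear phi (G j) (s *: v) =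
    \int[unif01]_s B s.
  rewrite /B Rintegral_sum//; apply: eq_bigr => j _.
  by rewrite -RintegralZl.
have A0 : A 0 = 0.
  rewrite /A /incr scale0r; under eq_Rintegral do rewrite subrr mulr0.
  by rewrite /Rintegral integral0.
have iBs : unif01.-integrable setT (EFin \o B) by exact: integrable_sumr.
have dA (t : R) : `[0, 1]%classic t -> is_derive t 1 A (B t).
  rewrite /= in_itv/= => /andP[t0 t1].
  have tt : - eta < t < 1 + eta.
    by rewrite (lt_le_trans _ t0) ?oppr_lt0//= (le_lt_trans t1)// ltrDl.
  (* The first bound on [h] keeps the staircase in the tube, the second keeps [t + h] within the
     margin [eta]. *)
  apply: (@is_derive_quadratic _ A t (B t) (Num.min (delta / (`|v| + 1)) eta)
    (\sum_(j < n) (L * L1norm (G j)) * (v j ord0 ^+ 2 + `|v j ord0| * `|v|))).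
    by rewrite lt_min eta0 divr_gt0// ltr_wpDl.
  move=> h; rewrite lt_min => /andP[hd he].
  have th : - eta < t + h < 1 + eta.
    move: he; rewrite ltr_norml => /andP[he1 he2]; apply/andP; split.
      by rewrite (lt_le_trans he1)// lerDr.
    by apply: ler_ltD.
  have hv : `|h| * `|v| < delta.
    move: hd; rewrite ltr_pdivlMr ?ltr_wpDl//; apply: le_lt_trans.
    by rewrite ler_wpM2l// lerDl.
  have := small_step_estimate tt hv phiL; congr (`|_ - _| <= _).
  rewrite /A -RintegralB//; [|exact: integrable_path..].
  apply: eq_Rintegral => x _; rewrite /incr; ring.
rewrite [RHS]/Rintegral integral_unif01; last exact: measurable_int iBs.
rewrite (integral_derive ltr01 dA (integrable_unif01 iBs)) A0 subr0.
by rewrite /A scale1r.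
Qed.

End test.

(* Only the partial derivatives of [F] exist, so there is no chain rule along
   [v]. Against a Lipschitz test function [phi] the coordinatewise increments
   are however additive up to [O(h^2)], which makes
   [t |-> \int phi x * (F (x + t v) - F x)] differentiable. *)
Lemma increment_ae : open D ->
  {ae mu, forall x, D x ->
    (F (x + v) - F x)%:E =
    \int[unif01]_s (\sum_(j < n) v j ord0 * G j (x + s *: v))%:E}%E.
Proof.
move=> oD; have mD : measurable D by exact: measurable_open_cV.
pose H x := \sum_(j < n) v j ord0 * \int[unif01]_s G j (x + s *: v).
pose h x := \1_D x * (F (x + v) - F x - H x).
have m1 : measurable_fun setT (\1_D : 'cV[R]_n -> R) by exact: measurable_indic.
have n1 x : `|\1_D x : R| <= 1.
  by rewrite indicE; case: (x \in D); rewrite ?normr1 ?normr0.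
have D1 x : ~ D x -> \1_D x = 0 :> R by move=> Dx; rewrite indicE memNset.
have eta1 : - eta < 1 < 1 + eta.
  by rewrite ltrDl eta0 (lt_trans _ ltr01)// oppr_lt0.
have mc : measurable_fun setT (cst 1 : 'cV[R]_n -> R) by [].
have nc (x : 'cV[R]_n) : `|cst 1 x : R| <= 1 by rewrite normr1.
pose J j x := \int[unif01]_s G j (x + s *: v).
have mG j : measurable_fun setT (G j).
  by apply/measurable_EFinP; exact: measurable_int (iG j).
have Gs j x : measurable_fun [set: measurableTypeR R] (fun s => G j (x + s *: v)).
  by apply: (measurableT_comp (mG j)); exact: measurable_segment.
have mJ j : measurable_fun setT (J j).
  apply: (measurableT_comp (@fine_measurable _ setT measurableT)).
  have := measurable_int _ (integrable_integral_segment 0 v mc nc (iG j)).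
  by apply: eq_measurable_fun => x _; apply: eq_integral => s _; rewrite mul1r addr0.
have JE j : {ae mu, forall x, unif01.-integrable setT (EFin \o (fun s => G j (x + s *: v)))}.
  have := ae_integrable_segment 0 v mc nc (iG j); apply: filterS => x.
  by apply: eq_integrable => // s _ /=; rewrite mul1r addr0.
(* The real average [J j x] is meaningful only where [G j] is integrable along the segment;
   elsewhere it may be a default value of [fine], so the identity holds almost everywhere. *)
have aeJ phi j : ae_eq mu setT
    (fun x => \int[unif01]_s (phi x * G j (x + 0 + s *: v))%:E)%E
    (EFin \o (fun x => phi x * J j x)).
  have := JE j; apply: filterS => x ix _ /=.
  under eq_integral do rewrite addr0 EFinM.
  by rewrite integralZl// EFinM /J /Rintegral fineK// (integrable_fin_num measurableT ix).
have iJ (phi : 'cV[R]_n -> R) j : measurable_fun setT phi -> (forall x, `|phi x| <= 1) ->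
    mu.-integrable setT (EFin \o (fun x => phi x * J j x)).
  move=> mphi phi1; apply: (ae_eq_integrable _ (aeJ phi j)).
    by apply/measurable_EFinP; exact: measurable_funM.
  exact: integrable_integral_segment.
have intJ (phi : 'cV[R]_n -> R) j : measurable_fun setT phi -> (forall x, `|phi x| <= 1) ->
    \int[mu]_x (phi x * J j x) = \int[unif01]_s smear phi (G j) (s *: v).
  move=> mphi phi1; have iS := integrable_integral_segment 0 v mphi phi1 (iG j).
  rewrite /Rintegral -(ae_eq_integral _ _ _ _ _ (aeJ phi j))//; first last.
  - by apply/measurable_EFinP; exact: measurable_funM.
  - exact: measurable_int iS.
  rewrite Fubini_segment//; congr fine; apply: eq_integral => s _.
  under eq_integral do rewrite addr0.
  rewrite /smear /Rintegral fineK//.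
  exact: (integrable_fin_num measurableT (integrable_shift_mul mphi phi1 (iG j) _)).
have iH (phi : 'cV[R]_n -> R) : measurable_fun setT phi -> (forall x, `|phi x| <= 1) ->
    mu.-integrable setT (EFin \o (fun x => \sum_(j < n) v j ord0 * (phi x * J j x))).
  move=> mphi phi1; apply: integrable_sumr => j.
  by have := integrableZl measurableT (v j ord0) (iJ phi j mphi phi1); exact: eq_integrable.
have iF (phi : 'cV[R]_n -> R) : measurable_fun setT phi -> (forall x, `|phi x| <= 1) ->
    (forall x, ~ D x -> phi x = 0) ->
    mu.-integrable setT (EFin \o (fun x => phi x * (F (x + v) - F x))).
  move=> mphi phi1 phiD; have := integrable_path mphi phi1 phiD eta1.
  by apply: eq_integrable => // x _ /=; rewrite scale1r addr0.
(* Against cutoffs of open subsets of [D] the two terms of [h] have equal integrals, by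
   [integral_path] and Fubini. *)
have h0 : {ae mu, forall x, h x = 0}.
  apply: (ae_eq0_cutoff oD).
  - have := integrableB measurableT (iF _ m1 n1 D1) (iH _ m1 n1).
    apply: eq_integrable => // x _; rewrite /= -EFinB /h [in RHS]mulrBr /H mulr_sumr.
    by under [in RHS]eq_bigr do rewrite mulrCA.
  - by move=> x /D1 Dx; rewrite /h Dx mul0r.
  move=> V k oV VD; pose phi := cutoff V k.
  have phiL := @cutoff_lipschitz _ _ V k : forall x y, `|phi x - phi y| <= _.
  have mphi : measurable_fun setT phi by exact: lipschitz_measurable_cV phiL.
  have phi1 x : `|phi x| <= 1 by rewrite ger0_norm ?cutoff_ge0 ?cutoff_le1.
  have phiV x : ~ D x -> phi x = 0 by move=> Dx; apply: cutoff_out => /VD.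
  have -> : (\int[mu]_x (phi x * h x)%:E = \int[mu]_x
     (phi x * (F (x + v) - F x) - \sum_(j < n) v j ord0 * (phi x * J j x))%:E)%E.
    apply: eq_integral => x _; congr EFin.
    under [in RHS]eq_bigr do rewrite mulrCA.
    rewrite -mulr_sumr -mulrBr /h indicE.
    by case: (boolP (x \in D)) => [_|/negP Dx]; rewrite ?mul1r// phiV ?mul0r// => /mem_set.
  under eq_integral do rewrite EFinB.
  rewrite integralB//; [|exact: iF|exact: iH].
  have E1 := integral_path mphi phi1 phiV phiL.
  have E2 : \int[mu]_x (\sum_(j < n) v j ord0 * (phi x * J j x)) =
      \sum_(j < n) v j ord0 * \int[unif01]_s smear phi (G j) (s *: v).
    rewrite Rintegral_sum => [|j].
      by apply: eq_bigr => j _; rewrite RintegralZl ?intJ//; exact: iJ.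
    by have := integrableZl measurableT (v j ord0) (iJ phi j mphi phi1); exact: eq_integrable.
  have iF0 := iF _ mphi phi1 phiV.
  rewrite -(fineK (integrable_fin_num measurableT iF0)).
  rewrite -(fineK (integrable_fin_num measurableT (iH _ mphi phi1))) -EFinB.
  congr EFin; apply/eqP; rewrite subr_eq0; apply/eqP.
  rewrite -[LHS]/(\int[mu]_x (phi x * (F (x + v) - F x))) -[RHS]/(Rintegral _ _ _) E2 -E1.
  by apply: eq_Rintegral => x _; rewrite addr0.
(* Outside one null set all [G j] are integrable along the segment, and the finite sum can be moved
   back under the average. *)
have JA : {ae mu, forall x, forall j,
    unif01.-integrable setT (EFin \o (fun s => G j (x + s *: v)))}.
  exact: filter_forall.
move: h0 JA; apply: filterS2 => x; rewrite /h => hx ix Dx.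
move: hx; rewrite indicE mem_set// mul1r => /eqP; rewrite subr_eq0 => /eqP ->.
have ivx j : unif01.-integrable setT
    (EFin \o (fun s => v j ord0 * G j (x + s *: v))).
  by have := integrableZl measurableT (v j ord0) (ix j); exact: eq_integrable.
have iS := integrable_sumr (index_enum 'I_n) ivx.
rewrite -(fineK (integrable_fin_num measurableT iS)); congr EFin.
rewrite -[RHS]/(Rintegral _ _ _) Rintegral_sum//; apply: eq_bigr => j _.
by rewrite RintegralZl//; exact: ix.
Qed.

End tube.

(** * Exhaustion of a convex open set by tubes *)

Section increments_convex.
Context {R : realType} {n : nat}.
Local Notation mu := (lebesgue_cV n : {sigma_finite_measure set 'cV[R]_n -> \bar R}).
Local Notation unif01 := (@unif01 R).
Variables (F : 'cV[R]_n -> R) (G : 'I_n -> 'cV[R]_n -> R) (X : set 'cV[R]_n).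
Hypotheses (oX : open X) (mF : measurable_fun setT F).
Hypothesis cX : forall x y (s : R), X x -> X y -> 0 <= s <= 1 -> X (x + s *: (y - x)).
Hypothesis mG : forall i, measurable_fun setT (G i).
Hypothesis iG : forall i r, mu.-integrable (X `&` [set x | `|x| <= r]) (EFin \o G i).
Hypothesis dF : forall i x, X x -> is_derive x (e_ i) F (G i x).

Lemma measurable_normr_cV : measurable_fun setT (fun x : 'cV[R]_n => `|x|).
Proof.
apply: (@lipschitz_measurable_cV _ _ _ 1) => x y.
by rewrite mul1r ler_dist_dist.
Qed.

Lemma measurable_ball_cV (r : R) : measurable [set x : 'cV[R]_n | `|x| <= r].
Proof.
rewrite (_ : [set x | _] = (fun x : 'cV[R]_n => `|x|) @^-1` `]-oo, r]%classic).
  by rewrite -[X in measurable X]setTI; exact: measurable_normr_cV.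
by apply/seteqP; split => x; rewrite /= in_itv.
Qed.

Let eq_integral_unif01 (f g : R -> \bar R) :
  measurable_fun [set: measurableTypeR R] f ->
  measurable_fun [set: measurableTypeR R] g ->
  (forall s, 0 <= s <= 1 -> f s = g s) ->
  (\int[unif01]_s f s = \int[unif01]_s g s)%E.
Proof.
move=> mf mg fg; rewrite !integral_unif01//; apply: eq_integral => s.
by rewrite inE/= in_itv/=; exact: fg.
Qed.

(** The distance of [x] and [x + v] from the complement yields a tube around the segment; the bound
    on [x] makes the partial derivatives integrable on that tube. *)
Let good (v : 'cV[R]_n) (j : nat) := [set x | j.+1%:R^-1 < inradius X x] `&`
  ((fun x => x + v) @^-1` [set x | j.+1%:R^-1 < inradius X x] `&` ball 0 j.+1%:R).

Let open_good v j : open (good v j).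
Proof.
apply: openI; first exact: open_inradius_gt.
apply: openI; last exact: ball_open.
apply: open_comp; last exact: open_inradius_gt.
move=> x _ A /nbhs_ballP[e /= e0 eA]; apply/nbhs_ballP; exists e => //= y.
rewrite -ball_normE/= => xy; apply: eA; rewrite -ball_normE/=.
by rewrite opprD addrACA subrr addr0.
Qed.

(** Let [s] be the point of [[0, 1]] nearest to [t]. The overshoot [(t - s) *: v] and [u] merge into
    one displacement [u'] shorter than [d]; then [x + u'] and [x + v + u'] lie in [X], and convexity
    gives the points between them. *)
Let good_tube v j x t u : good v j x ->
  - (j.+1%:R^-1 / (2 * (`|v| + 1))) < t < 1 + j.+1%:R^-1 / (2 * (`|v| + 1)) ->
  `|u| < j.+1%:R^-1 / 2 -> X (x + t *: v + u).
Proof.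
set d := j.+1%:R^-1; set eta := d / _.
have v1 : 0 < `|v| + 1 by rewrite ltr_wpDl.
have d0 : 0 < d by rewrite invr_gt0.
have eta0 : 0 < eta by rewrite divr_gt0// mulr_gt0.
have etav : eta * `|v| < d / 2.
  rewrite /eta invfM mulrA -mulrA gtr_pMr ?divr_gt0// mulrC ltr_pdivrMr// mul1r.
  by rewrite ltrDl.
move=> [xX [xvX _]] /andP[t0 t1] ud.
have [s [s0 s1 ts]] : exists s : R, [/\ 0 <= s, s <= 1 & `|t - s| <= eta].
  have [t00|t00] := leP 0 t; last first.
    exists 0; split; rewrite ?ler01// subr0 ltr0_norm//.
    by rewrite lerNl ltW.
  have [t11|t11] := leP t 1; first by exists t; split => //; rewrite subrr normr0 ltW.
  exists 1; split; rewrite ?ler01// gtr0_norm ?subr_gt0// lerBlDl ltW//.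
pose u' := u + (t - s) *: v.
have u'd : `|u'| < d.
  rewrite (le_lt_trans (ler_normD _ _))// normrZ (splitr d) ltrD//.
  by rewrite (le_lt_trans _ etav)// ler_wpM2r.
have xu : X (x + u').
  apply: (inradius_sub xX); rewrite -ball_normE/= opprD addrA subrr sub0r normrN//.
have xvu : X (x + v + u').
  apply: (inradius_sub xvX); rewrite -ball_normE/= opprD addrA subrr sub0r normrN//.
rewrite (_ : _ + u = (x + u') + s *: (x + v + u' - (x + u'))).
  by apply: cX => //; rewrite s0.
have -> : x + v + u' - (x + u') = v.
  by rewrite -(addrA x v) opprD addrACA subrr add0r addrK.
by rewrite /u' -!addrA -scalerDl subrK (addrC u).
Qed.

Lemma increment_ae_convex v : {ae mu, forall x, X x -> X (x + v) ->
  ((F (x + v) - F x)%:E =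
   \int[unif01]_s (\sum_(j < n) v j ord0 * G j (x + s *: v))%:E)%E}.
Proof.
have H j : {ae mu, forall x, good v j x -> ((F (x + v) - F x)%:E =
   \int[unif01]_s (\sum_(i < n) v i ord0 * G i (x + s *: v))%:E)%E}.
  set d := j.+1%:R^-1 : R; set eta := d / (2 * (`|v| + 1)).
  have v1 : 0 < `|v| + 1 by rewrite ltr_wpDl.
  have d0 : 0 < d by rewrite invr_gt0.
  have eta0 : 0 < eta by rewrite divr_gt0// mulr_gt0.
  (* Bounds the norm of every point of the tube, term by term in [x + t *: v + u]. *)
  pose r := j.+1%:R + (1 + eta) * `|v| + d / 2.
  pose K := X `&` [set x | `|x| <= r].
  have mK : measurable K.
    by apply: measurableI; [exact: measurable_open_cV|exact: measurable_ball_cV].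
  pose Gr i x := \1_K x * G i x.
  have mGr i : measurable_fun setT (Gr i).
    by apply: measurable_funM => //; exact: measurable_indic.
  have iGr i : mu.-integrable setT (EFin \o Gr i).
    have := iG i r; rewrite integrable_mkcond//; apply: eq_integrable => // x _ /=.
    by rewrite patchE /Gr indicE; case: (x \in _); rewrite ?mul1r ?mul0r.
  have GK i x : K x -> Gr i x = G i x.
    by move=> Kx; rewrite /Gr indicE mem_set// mul1r.
  have dFr i x : K x -> is_derive x (e_ i) F (Gr i x).
    by move=> Kx; rewrite GK//; apply: dF; case: Kx.
  have tube x (t : R) u : good v j x -> - eta < t < 1 + eta -> `|u| < d / 2 ->
      K (x + t *: v + u).
    move=> gx t01 ud; split; first exact: (@good_tube v j).
    move: gx => [_ [_]]; rewrite -ball_normE/= sub0r normrN => xj.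
    rewrite (le_trans (ler_normD _ _))// lerD ?(ltW ud)//.
    rewrite (le_trans (ler_normD _ _))// lerD ?(ltW xj)// normrZ ler_wpM2r//.
    move: t01 => /andP[t0 t1]; rewrite ler_norml (ltW t1) andbT.
    by rewrite (le_trans _ (ltW t0))// lerN2 lerDr ler01.
  have d20 : 0 < d / 2 by rewrite divr_gt0.
  have := increment_ae mF iGr dFr d20 eta0 tube (@open_good v j).
  apply: filterS => x + gx => /(_ gx) ->.
  have mS (G' : 'I_n -> 'cV[R]_n -> R) : (forall i, measurable_fun setT (G' i)) ->
    measurable_fun [set: measurableTypeR R]
      (fun s => (\sum_(i < n) v i ord0 * G' i (x + s *: v))%:E).
    move=> mG'; apply/measurable_EFinP; apply: measurable_sum => i.
    apply: measurable_funM => //; apply: (measurableT_comp (mG' i)).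
    exact: measurable_segment.
  apply: eq_integral_unif01; [exact: mS|exact: mS|move=> s /andP[s0 s1]].
  congr EFin; apply: eq_bigr => i _; rewrite GK// -[x + _]addr0; apply: tube => //.
    by rewrite (lt_le_trans _ s0) ?oppr_lt0//= (le_lt_trans s1)// ltrDl.
  by rewrite normr0.
(* Countably many null sets have a null union, so it remains to find one [good v j] containing [x]:
   [j.+1] must exceed [|x|] and both inverse radii. *)
have := ae_foralln H; apply: filterS => x Hx Xx Xxv.
have r1 := inradius_gt0 oX Xx; have r2 := inradius_gt0 oX Xxv.
pose m := Num.max (Num.max (inradius X x)^-1 (inradius X (x + v))^-1) `|x|.
apply: (Hx (Num.Def.truncn m)).
have m0 : 0 <= m by rewrite le_max normr_ge0 orbT.
have /andP[_] := truncn_itv m0; set k := _.+1; rewrite !gt_max => /andP[/andP[k1 k2] k3].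
split => /=; first by rewrite -[ltRHS]invrK ltf_pV2// posrE ?invr_gt0.
split => /=; first by rewrite -[ltRHS]invrK ltf_pV2// posrE ?invr_gt0.
by rewrite -ball_normE/= sub0r normrN.
Qed.

Lemma sqr_increment_ae_convex v : {ae mu, forall x, X x -> X (x + v) ->
  (((F x - F (x + v)) ^+ 2)%:E <=
   \int[unif01]_s ((\sum_(j < n) v j ord0 * G j (x + s *: v)) ^+ 2)%:E)%E}.
Proof.
have := increment_ae_convex v; apply: filterS => x H Xx Xxv.
rewrite -sqrrN opprB; apply: sqr_integral_unif01; last by rewrite -H.
apply: measurable_sum => i; apply: measurable_funM => //.
by apply: (measurableT_comp (mG i)); exact: measurable_segment.
Qed.

End increments_convex.

(** * The kernel inequality *)

Section tonelli3.
Context d1 d2 d3 (A : measurableType d1) (B : measurableType d2)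
  (C : measurableType d3) (R : realType).
Variables (m1 : {sigma_finite_measure set A -> \bar R})
  (m2 : {sigma_finite_measure set B -> \bar R})
  (m3 : {sigma_finite_measure set C -> \bar R}).
Local Open Scope ereal_scope.

(** Exchange [b] with [c], then [a] with [c], then [a] with [b]. *)
Lemma tonelli_reverse (f : A * (B * C) -> \bar R) : measurable_fun setT f ->
  (forall p, 0 <= f p) ->
  \int[m1]_a \int[m2]_b \int[m3]_c f (a, (b, c)) =
  \int[m3]_c \int[m2]_b \int[m1]_a f (a, (b, c)).
Proof.
move=> mf f0.
have mfac d (T : measurableType d) (a : T -> A) (b : T -> B) (c : T -> C) :
    measurable_fun setT a -> measurable_fun setT b -> measurable_fun setT c ->
    measurable_fun setT (fun t => f (a t, (b t, c t))).
  move=> ma mb mc; apply: (measurableT_comp mf).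
  by apply: measurable_fun_pair => //; exact: measurable_fun_pair.
transitivity (\int[m1]_a \int[m3]_c \int[m2]_b f (a, (b, c))).
  apply: eq_integral => a _.
  apply: (fubini_tonelli (fun q => f (a, (q.1, q.2)))) => //.
  exact: mfac.
transitivity (\int[m3]_c \int[m1]_a \int[m2]_b f (a, (b, c))).
  apply: (fubini_tonelli (fun q => \int[m2]_b f (q.1, (b, q.2)))) => //; last first.
    by move=> q; exact: integral_ge0.
  apply: (measurable_fun_fubini_tonelli_F (m2 := m2)
    (fun p : (A * C) * B => f (p.1.1, (p.2, p.1.2)))) => //.
  apply: mfac => //.
  - by apply: (measurableT_comp measurable_fst); exact: measurable_fst.
  - by apply: (measurableT_comp measurable_snd); exact: measurable_fst.
apply: eq_integral => c _.
apply: (fubini_tonelli (fun q => f (q.1, (q.2, c)))) => //.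
exact: mfac.
Qed.

Lemma measurable_integral2_l (f : A * (B * C) -> \bar R) : measurable_fun setT f ->
  (forall p, 0 <= f p) ->
  measurable_fun setT (fun a => \int[m2]_b \int[m3]_c f (a, (b, c))).
Proof.
move=> mf f0.
apply: (measurable_fun_fubini_tonelli_F (m2 := m2)
  (fun q => \int[m3]_c f (q.1, (q.2, c)))) => //; last first.
  by move=> q; exact: integral_ge0.
apply: (measurable_fun_fubini_tonelli_F (m2 := m3)
  (fun p : (A * B) * C => f (p.1.1, (p.1.2, p.2)))) => //.
apply: (measurableT_comp mf).
apply: measurable_fun_pair.
  by apply: (measurableT_comp measurable_fst); exact: measurable_fst.
apply: measurable_fun_pair => //.
by apply: (measurableT_comp measurable_snd); exact: measurable_fst.
Qed.

Lemma measurable_integral2_r (f : A * (B * C) -> \bar R) : measurable_fun setT f ->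
  (forall p, 0 <= f p) ->
  measurable_fun setT (fun c => \int[m2]_b \int[m1]_a f (a, (b, c))).
Proof.
move=> mf f0.
apply: (measurable_fun_fubini_tonelli_G (m1 := m2)
  (fun q => \int[m1]_a f (a, q))) => //; last first.
  by move=> q; exact: integral_ge0.
exact: (measurable_fun_fubini_tonelli_G (m1 := m1) f).
Qed.

End tonelli3.

Section kernel.
Context {R : realType} {n m : nat}.
Local Notation mu k := (lebesgue_cV k : {sigma_finite_measure set 'cV[R]_k -> \bar R}).
Local Notation unif01 := (@unif01 R).

(** Squared Euclidean norm, as opposed to [|u|], which is the maximum norm. *)
Definition nsq k (u : 'cV[R]_k) : R := \sum_i u i ord0 ^+ 2.

Lemma nsq_ge0 k (u : 'cV[R]_k) : 0 <= nsq u.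
Proof. by apply: sumr_ge0 => i _; rewrite sqr_ge0. Qed.

Lemma measurable_nsq d (T : measurableType d) k (f : T -> 'cV[R]_k) :
  measurable_fun setT f -> measurable_fun setT (fun t => nsq (f t)).
Proof.
move=> mf; apply: measurable_sum => i; apply: measurable_funX.
exact: (measurableT_comp (measurable_coord_cV i)).
Qed.

(** Lagrange's identity: twice the gap is a sum of squares of 2 by 2 minors. *)
Lemma CauchySchwarz_nsq k (u w : 'cV[R]_k) :
  (\sum_i u i ord0 * w i ord0) ^+ 2 <= nsq u * nsq w.
Proof.
rewrite -subr_ge0 -(pmulr_rge0 _ (ltr0n R 2)).
have -> : 2 * (nsq u * nsq w - (\sum_i u i ord0 * w i ord0) ^+ 2) =
  \sum_i \sum_j (u i ord0 * w j ord0 - u j ord0 * w i ord0) ^+ 2.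
  have E1 : nsq u * nsq w = \sum_i \sum_j (u i ord0 * w j ord0) ^+ 2.
    rewrite /nsq mulr_suml; apply: eq_bigr => i _.
    by rewrite mulr_sumr; apply: eq_bigr => j _; rewrite exprMn.
  have E2 : (\sum_i u i ord0 * w i ord0) ^+ 2 =
      \sum_i \sum_j (u i ord0 * w j ord0) * (u j ord0 * w i ord0).
    rewrite expr2 mulr_suml; apply: eq_bigr => i _.
    by rewrite mulr_sumr; apply: eq_bigr => j _; ring.
  rewrite mulrBr mulr_natl mulr2n {2}E1 exchange_big/= E1 E2 mulr_sumr.
  rewrite -big_split/= -sumrB; apply: eq_bigr => i _.
  rewrite -big_split/= mulr_sumr -sumrB; apply: eq_bigr => j _; ring.
by apply: sumr_ge0 => i _; apply: sumr_ge0 => j _; rewrite sqr_ge0.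
Qed.

Variables (W2 : 'M[R]_(n, m)) (rho V F : 'cV[R]_n -> R) (G : 'I_n -> 'cV[R]_n -> R).
Let X := supp rho.
Hypotheses (oX : open X) (mF : measurable_fun setT F).
Hypothesis cX : forall x y (s : R), X x -> X y -> 0 <= s <= 1 -> X (x + s *: (y - x)).
Hypothesis mG : forall i, measurable_fun setT (G i).
Hypothesis iG : forall i r, (mu n).-integrable (X `&` [set x | `|x| <= r]) (EFin \o G i).
Hypothesis dF : forall i x, X x -> is_derive x (e_ i) F (G i x).
Hypothesis GX : forall i x, ~ X x -> G i x = 0.
Hypotheses (mrho : measurable_fun setT rho) (rho0 : forall x, 0 <= rho x).
Hypotheses (mV : measurable_fun setT V) (V0 : forall x, 0 <= V x).
Hypothesis VX : forall x, X x -> 0 < V x.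
Hypothesis VW : forall x u, V (x + W2 *m u) = V x.

Definition grad2 (x : 'cV[R]_n) : 'cV[R]_m := W2^T *m \col_i G i x.

Let dir (x : 'cV[R]_n) (u : 'cV[R]_m) : \sum_(j < n) (W2 *m u) j ord0 * G j x =
  \sum_(l < m) u l ord0 * grad2 x l ord0.
Proof.
under eq_bigr do rewrite mxE mulr_suml.
rewrite exchange_big/=; apply: eq_bigr => l _.
rewrite /grad2 mxE mulr_sumr; apply: eq_bigr => j _.
by rewrite !mxE; ring.
Qed.

Let mgrad2 : measurable_fun setT grad2.
Proof.
apply: measurable_fun_mulmx; apply: measurable_fun_cVP => i.
by under eq_fun do rewrite mxE; exact: mG.
Qed.

(** Joint density of [x] and of the displacement to a second point drawn from the conditional law on
    the same fibre. *)
Let k2 (x : 'cV[R]_n) (u : 'cV[R]_m) := rho x * rho (x + W2 *m u) / V x.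

Let k2_ge0 x u : 0 <= k2 x u.
Proof. by rewrite /k2 divr_ge0// mulr_ge0. Qed.

Let mxu d (T : measurableType d) (x : T -> 'cV[R]_n) (u : T -> 'cV[R]_m) :
  measurable_fun setT x -> measurable_fun setT u ->
  measurable_fun setT (fun t => x t + W2 *m u t).
Proof. by move=> mx mu_; apply: measurable_fun_addr_cV => //; exact: measurable_fun_mulmx. Qed.

Let mVi d (T : measurableType d) (x : T -> 'cV[R]_n) :
  measurable_fun setT x -> measurable_fun setT (fun t => (V (x t))^-1).
Proof.
move=> mx; under eq_fun do rewrite -powR_inv1//.
by apply: (measurableT_comp (measurable_powR _)); exact: (measurableT_comp mV).
Qed.

Let mk2 d (T : measurableType d) (x : T -> 'cV[R]_n) (u : T -> 'cV[R]_m) :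
  measurable_fun setT x -> measurable_fun setT u ->
  measurable_fun setT (fun t => k2 (x t) (u t)).
Proof.
move=> mx mu_; apply: measurable_funM; last exact: mVi.
apply: measurable_funM; first exact: (measurableT_comp mrho).
by apply: (measurableT_comp mrho); exact: mxu.
Qed.

(** The integrand centred at the intermediate point: the gradient is taken at [p.2.2], and the
    densities sit at the two ends of the segment through it. *)
Let Phi (p : 'cV[R]_m * (measurableTypeR R * 'cV[R]_n)) : R :=
  nsq p.1 * nsq (grad2 p.2.2) *
  (rho (p.2.2 + (- p.2.1) *: (W2 *m p.1)) *
   rho (p.2.2 + (1 - p.2.1) *: (W2 *m p.1)) / V p.2.2).

Let Phi_ge0 p : 0 <= Phi p.
Proof. by rewrite /Phi mulr_ge0 ?divr_ge0 ?mulr_ge0 ?nsq_ge0. Qed.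

Let mPhi : measurable_fun setT (EFin \o Phi).
Proof.
have m1 : measurable_fun setT
    (fun p : 'cV[R]_m * (measurableTypeR R * 'cV[R]_n) => p.1).
  exact: measurable_fst.
have m2 : measurable_fun setT
    (fun p : 'cV[R]_m * (measurableTypeR R * 'cV[R]_n) => p.2.1).
  by apply: (measurableT_comp measurable_fst); exact: measurable_snd.
have m3 : measurable_fun setT
    (fun p : 'cV[R]_m * (measurableTypeR R * 'cV[R]_n) => p.2.2).
  by apply: (measurableT_comp measurable_snd); exact: measurable_snd.
apply/measurable_EFinP; apply: measurable_funM.
  apply: measurable_funM; first exact: measurable_nsq.
  by apply: measurable_nsq; exact: (measurableT_comp mgrad2).
apply: measurable_funM; last exact: mVi.
have mshift (c : 'cV[R]_m * (measurableTypeR R * 'cV[R]_n) -> R) :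
    measurable_fun setT c ->
    measurable_fun setT (fun p : 'cV[R]_m * (measurableTypeR R * 'cV[R]_n) =>
      rho (p.2.2 + c p *: (W2 *m p.1))).
  move=> mc; apply: (measurableT_comp mrho); apply: measurable_fun_addr_cV => //.
  by apply: measurable_fun_scaler_cV => //; exact: measurable_fun_mulmx.
apply: measurable_funM; apply: mshift; first exact: measurable_funN.
exact: measurable_funB.
Qed.

Lemma kernel_bound (C : R) : 0 <= C ->
  (forall x, X x -> (\int[unif01]_s \int[mu m]_u
     (nsq u * (rho (x + (- s) *: (W2 *m u)) * rho (x + (1 - s) *: (W2 *m u))))%:E
     <= (C * V x * rho x)%:E)%E) ->
  (\int[mu n]_x \int[mu m]_u
     ((F x - F (x + W2 *m u)) ^+ 2 * (rho x * rho (x + W2 *m u) / V x))%:E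
   <= C%:E * \int[mu n]_x (nsq (grad2 x) * rho x)%:E)%E.
Proof.
move=> C0 hK.
have mS (x : 'cV[R]_n) u : measurable_fun [set: measurableTypeR R]
    (fun s => nsq (grad2 (x + s *: (W2 *m u)))).
  apply: measurable_nsq; apply: (measurableT_comp mgrad2).
  exact: measurable_segment.
have mJ : measurable_fun setT (fun p : 'cV[R]_n * 'cV[R]_m =>
    ((F p.1 - F (p.1 + W2 *m p.2)) ^+ 2 * k2 p.1 p.2)%:E).
  apply/measurable_EFinP; apply: measurable_funM; last first.
    by apply: mk2; [exact: measurable_fst|exact: measurable_snd].
  apply: measurable_funX; apply: measurable_funB.
    by apply: (measurableT_comp mF); exact: measurable_fst.
  apply: (measurableT_comp mF); apply: mxu; first exact: measurable_fst.
  exact: measurable_snd.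
have J0 (p : 'cV[R]_n * 'cV[R]_m) :
    (0 <= ((F p.1 - F (p.1 + W2 *m p.2)) ^+ 2 * k2 p.1 p.2)%:E)%E.
  by rewrite lee_fin mulr_ge0// sqr_ge0.
have -> : (\int[mu n]_x \int[mu m]_u
     ((F x - F (x + W2 *m u)) ^+ 2 * (rho x * rho (x + W2 *m u) / V x))%:E =
  \int[mu m]_u \int[mu n]_x ((F x - F (x + W2 *m u)) ^+ 2 * k2 x u)%:E)%E.
  exact: (fubini_tonelli _ mJ J0).
pose Psi (u : 'cV[R]_m) (x : 'cV[R]_n) (s : R) := nsq u * nsq (grad2 (x + s *: (W2 *m u))) * k2 x u.
have mPsi u : measurable_fun setT (fun p : 'cV[R]_n * measurableTypeR R => (Psi u p.1 p.2)%:E).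
  apply/measurable_EFinP; apply: measurable_funM; last first.
    by apply: mk2 => //; exact: measurable_fst.
  apply: measurable_funM => //; apply: measurable_nsq; apply: (measurableT_comp mgrad2).
  by apply: measurable_segment; [exact: measurable_fst|exact: measurable_snd].
have Psi0 u x s : 0 <= Psi u x s by rewrite /Psi mulr_ge0// mulr_ge0// nsq_ge0.
have step2 u : (\int[mu n]_x ((F x - F (x + W2 *m u)) ^+ 2 * k2 x u)%:E <=
    \int[mu n]_x \int[unif01]_s (Psi u x s)%:E)%E.
  apply: ae_ge0_le_integral => //.
  - by move=> x _; rewrite lee_fin mulr_ge0// sqr_ge0.
  - exact: (measurable_fun_pair1 u mJ).
  - by move=> x _; apply: integral_ge0 => s _; rewrite lee_fin.
  - apply: (measurable_fun_fubini_tonelli_F (m2 := unif01)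
      (fun p => (Psi u p.1 p.2)%:E)) => //.
    by move=> p; rewrite lee_fin.
  have := sqr_increment_ae_convex oX mF cX mG iG dF (W2 *m u).
  apply: filterS => x Hx _.
  (* If an endpoint lies off the support, the increment of [F] is uncontrolled but its weight
     vanishes. *)
  have [k20|k20] := eqVneq (k2 x u) 0.
    by rewrite k20 mulr0; apply: integral_ge0 => s _; rewrite lee_fin.
  have [rx rxu] : 0 < rho x /\ 0 < rho (x + W2 *m u).
    by split; rewrite lt_neqAle rho0 andbT eq_sym; apply: contra_neq k20;
      rewrite /k2 => ->; rewrite ?(mul0r,mulr0).
  have : ((F x - F (x + W2 *m u)) ^+ 2 * k2 x u)%:E%E = ((k2 x u)%:E * ((F x - F (x + W2 *m u)) ^+ 2)%:E)%E.
    by rewrite mulrC EFinM.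
  move=> ->.
  have mS2 : measurable_fun [set: measurableTypeR R]
      (fun s => (nsq u * nsq (grad2 (x + s *: (W2 *m u))))%:E).
    by apply/measurable_EFinP; apply: measurable_funM.
  have -> : (\int[unif01]_s (Psi u x s)%:E = (k2 x u)%:E *
      \int[unif01]_s (nsq u * nsq (grad2 (x + s *: (W2 *m u))))%:E)%E.
    rewrite -ge0_integralZl_EFin//; last first.
      by move=> s _; rewrite lee_fin mulr_ge0 ?nsq_ge0.
    by apply: eq_integral => s _; rewrite -EFinM mulrC.
  rewrite lee_wpmul2l ?lee_fin//; apply: le_trans (Hx rx rxu) _.
  apply: ge0_le_integral => //.
  - by move=> s _; rewrite lee_fin sqr_ge0.
  - apply/measurable_EFinP; apply: measurable_funX; apply: measurable_sum => i.
    apply: measurable_funM => //; apply: (measurableT_comp (mG i)).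
    exact: measurable_segment.
  - by move=> s _; rewrite lee_fin dir CauchySchwarz_nsq.
have step3 u : (\int[mu n]_x \int[unif01]_s (Psi u x s)%:E =
    \int[unif01]_s \int[mu n]_x (Phi (u, (s, x)))%:E)%E.
  transitivity (\int[unif01]_s \int[mu n]_x (Psi u x s)%:E)%E.
    have P0 (p : 'cV[R]_n * measurableTypeR R) : (0 <= (Psi u p.1 p.2)%:E)%E.
      by rewrite lee_fin.
    exact: (fubini_tonelli _ (mPsi u) P0).
  apply: eq_integral => s _.
  (* The translation is along the fibre and therefore leaves [V] unchanged. *)
  rewrite -[RHS](ge0_integral_shift_cV (s *: (W2 *m u))).
  - apply: eq_integral => x _; rewrite /Psi /Phi/=; congr (_ * _)%:E.
    rewrite /k2 -!addrA -!scalerDl subrr scale0r addr0 addrCA subrr addr0 scale1r.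
    by rewrite scalemxAr VW.
  - exact: (measurable_fun_pair2 s (measurable_fun_pair2 u mPhi)).
  - by move=> x; rewrite lee_fin Phi_ge0.
have Phi0 p : (0 <= (EFin \o Phi) p)%E by rewrite lee_fin Phi_ge0.
apply: (@le_trans _ _ (\int[mu m]_u \int[unif01]_s \int[mu n]_x (Phi (u, (s, x)))%:E)%E).
  apply: ge0_le_integral => //.
  - by move=> u _; apply: integral_ge0 => x _; rewrite lee_fin mulr_ge0// sqr_ge0.
  - exact: (measurable_fun_fubini_tonelli_G (m1 := mu n) _ mJ J0).
  - exact: (measurable_integral2_l unif01 (mu n) mPhi Phi0).
  - by move=> u _; rewrite -step3; exact: step2.
rewrite (tonelli_reverse (mu m) unif01 (mu n) mPhi Phi0).
have mSr : measurable_fun setT (fun x => (nsq (grad2 x) * rho x)%:E).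
  by apply/measurable_EFinP; apply: measurable_funM => //; exact: measurable_nsq.
have Sr0 x : (0 <= (nsq (grad2 x) * rho x)%:E)%E.
  by rewrite lee_fin mulr_ge0// nsq_ge0.
rewrite -ge0_integralZl_EFin//; apply: ge0_le_integral => //.
- by move=> x _; apply: integral_ge0 => s _; exact: integral_ge0.
- exact: (measurable_integral2_r (mu m) unif01 mPhi Phi0).
- exact: measurable_funeM.
(* The kernel hypothesis concerns points of the support; elsewhere the extended gradient vanishes,
   and with it both sides. *)
move=> x _ /=; have [Xx|/asboolP Xx] := boolP `[< X x >]; last first.
  have g0 : nsq (grad2 x) = 0.
    rewrite /nsq big1// => l _; rewrite /grad2 mxE big1 ?expr0n// => i _.
    by rewrite [X in _ * X]mxE GX// mulr0.
  rewrite g0 mul0r mule0 integral0_eq// => s _; rewrite integral0_eq// => u _.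
  by rewrite /Phi /fst /snd g0 mulr0 mul0r.
move/asboolP in Xx.
pose c := nsq (grad2 x) / V x.
have c0 : 0 <= c by rewrite divr_ge0 ?nsq_ge0.
pose K s u := nsq u * (rho (x + (- s) *: (W2 *m u)) * rho (x + (1 - s) *: (W2 *m u))).
have K0 s u : 0 <= K s u by rewrite /K !mulr_ge0// nsq_ge0.
have Vx := VX Xx.
have mK : measurable_fun setT (fun p : measurableTypeR R * 'cV[R]_m => (K p.1 p.2)%:E).
  have ms2 : measurable_fun setT (fun p : measurableTypeR R * 'cV[R]_m => W2 *m p.2).
    by apply: measurable_fun_mulmx; exact: measurable_snd.
  have ms1 : measurable_fun setT (fun p : measurableTypeR R * 'cV[R]_m => p.1).
    exact: measurable_fst.
  apply/measurable_EFinP; apply: measurable_funM.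
    by apply: measurable_nsq; exact: measurable_snd.
  apply: measurable_funM; apply: (measurableT_comp mrho);
    apply: measurable_fun_addr_cV => //; apply: measurable_fun_scaler_cV => //.
    exact: measurable_funN.
  exact: measurable_funB.
have -> : (\int[unif01]_s \int[mu m]_u (EFin \o Phi) (u, (s, x)) =
   c%:E * \int[unif01]_s \int[mu m]_u (K s u)%:E)%E.
  rewrite -ge0_integralZl_EFin//; first last.
  - apply: (measurable_fun_fubini_tonelli_F (m2 := mu m) _ mK) => p.
    by rewrite lee_fin.
  - by move=> s _; apply: integral_ge0 => u _; rewrite lee_fin.
  apply: eq_integral => s _; rewrite -ge0_integralZl_EFin//; first last.
  - exact: (measurable_fun_pair2 s mK).
  - by move=> u _; rewrite lee_fin.
  apply: eq_integral => u _; rewrite -EFinM /Phi/= /c /K; congr EFin; ring.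
apply: (@le_trans _ _ (c%:E * (C * V x * rho x)%:E)%E).
  by rewrite lee_wpmul2l ?lee_fin//; exact: hK.
rewrite -!EFinM lee_fin /c le_eqVlt; apply/orP; left; apply/eqP; field.
by rewrite gt_eqF.
Qed.

End kernel.

(** * Slices of the uniform and the Gaussian law *)

Section gaussian.
Context {R : realType}.
Local Notation mu k := (lebesgue_cV k : {sigma_finite_measure set 'cV[R]_k -> \bar R}).
Local Notation leb := (@lebesgue_measure R).
Local Notation unif01 := (@unif01 R).
Local Notation sqpi := (Num.sqrt (@pi R)).

Lemma nsqZ k (a : R) (u : 'cV[R]_k) : nsq (a *: u) = a ^+ 2 * nsq u.
Proof. by rewrite /nsq mulr_sumr; apply: eq_bigr => i _; rewrite mxE exprMn. Qed.

Lemma nsq_cons k (r : R) (u : 'cV[R]_k) : nsq (cons_cV (r, u)) = r ^+ 2 + nsq u.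
Proof.
rewrite /nsq big_ord_recl cons_cV0; congr (_ + _).
by apply: eq_bigr => i _; rewrite cons_cVS.
Qed.

Lemma measurable_expR_nsq d (T : measurableType d) k (c : R) (f : T -> 'cV[R]_k) :
  measurable_fun setT f ->
  measurable_fun setT (fun t => (expR (- (c * nsq (f t))))%:E).
Proof.
move=> mf; apply/measurable_EFinP; apply: (measurableT_comp (@measurable_expR R)).
by apply: measurable_funN; apply: measurable_funM => //; exact: measurable_nsq.
Qed.

(** The integral factors over the coordinates; the coefficient 1 puts the integrand into the form of
    [measurable_expR_nsq]. *)
Let gauss1 k : (\int[mu k]_u (expR (- (1 * nsq u)))%:E = (sqpi ^+ k)%:E)%E.
Proof.
elim: k => [|k IH].
  rewrite expr0 [LHS](_ : _ = \int[mu 0]_u (cst 1 u))%E.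
    by rewrite integral_cst//= mul1e diracT.
  by apply: eq_integral => u _; rewrite /nsq big_ord0 mulr0 oppr0 expR0.
rewrite ge0_integral_cV_succ; last 2 first.
- exact: measurable_expR_nsq.
- by move=> v; rewrite lee_fin expR_ge0.
transitivity (\int[leb]_r ((sqpi ^+ k)%:E * (gauss_fun r)%:E))%E.
  apply: eq_integral => r _; rewrite -IH muleC.
  rewrite -ge0_integralZl_EFin ?gauss_fun_ge0//; last exact: measurable_expR_nsq.
  apply: eq_integral => u _; rewrite -EFinM /gauss_fun -expRD nsq_cons.
  by congr (expR _)%:E; ring.
rewrite ge0_integralZl_EFin ?exprn_ge0 ?sqrtr_ge0//.
- by rewrite integralT_gauss -EFinM exprSr.
- by move=> r _; rewrite lee_fin gauss_fun_ge0.
- by apply/measurable_EFinP; exact: measurable_gauss_fun.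
Qed.

Lemma integral_gauss_cV k (a : R) (b : 'cV[R]_k) : 0 < a ->
  (\int[mu k]_u (expR (- nsq (b + a *: u)))%:E = (sqpi ^+ k / a ^+ k)%:E)%E.
Proof.
move=> a0; have := @ge0_integral_affine_cV R k a b
  (fun u => (expR (- (1 * nsq u)))%:E) (lt0r_neq0 a0).
rewrite gauss1 gtr0_norm// => /(_ _ _)/wrap[].
- exact: measurable_expR_nsq.
- by move=> v; rewrite lee_fin expR_ge0.
under eq_integral do rewrite mul1r addrC.
set I := (\int[_]_u _)%E => HI.
(* Dividing by [a ^+ k] requires a finite integral, and it is finite because its product with
   [a ^+ k] is. *)
have Ifin : I \is a fin_num.
  rewrite ge0_fin_numE; last by apply: integral_ge0 => v _; rewrite lee_fin expR_ge0.
  rewrite ltNge leye_eq; apply/negP => /eqP IE.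
  by move: HI; rewrite IE gt0_muley ?lte_fin ?exprn_gt0.
move: HI; rewrite -(fineK Ifin) -EFinM => -[->].
by rewrite mulrAC divff ?mul1r// expf_neq0// gt_eqF.
Qed.

Section exponential_average.
Variable beta : R.
Hypothesis beta0 : 0 <= beta.

Let cont_int (h : R -> R) : measurable_fun [set: R] h -> (forall s, 0 <= h s) ->
  (forall s, `[0, 1]%classic s -> h s <= beta) ->
  leb.-integrable `[0, 1] (EFin \o h).
Proof.
move=> mh h0 hb; apply: measurable_bounded_integrable => //=.
- by rewrite lebesgue_measure_itv/= lte_fin ltr01 -EFinB ltry.
- exact: measurable_funTS.
exists beta; split; first by rewrite num_real.
by move=> z bz s /hb hs /=; rewrite ger0_norm// (le_trans hs)// ltW.
Qed.

(** The antiderivative is [c * expR (p + s * q)]. Asking for [c * q = beta] instead of a quotient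
    includes the case [q = 0]; the sign condition bounds the integrand by [beta]. *)
Lemma integral_unif01_exp (c p q : R) : c * q = beta ->
  (forall s, 0 <= s <= 1 -> p + s * q <= 0) ->
  (\int[unif01]_s (beta * expR (p + s * q))%:E = (c * (expR (p + q) - expR p))%:E)%E.
Proof.
move=> cq pq.
have mh : measurable_fun [set: R] (fun s : R => beta * expR (p + s * q)).
  apply: measurable_funM => //; apply: (measurableT_comp (@measurable_expR R)).
  by apply: measurable_funD => //; exact: measurable_funM.
rewrite integral_unif01; last exact/measurable_EFinP.
have dphi (t : R) : `[0, 1]%classic t ->
    is_derive t 1 (fun s : R => c * expR (p + s * q)) (beta * expR (p + t * q)).
  move=> _.
  have d1 : is_derive t 1 (fun s : R => p + s * q) q.
    by apply: is_derive_eq; rewrite /GRing.scale/=; ring.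
  have d2 := @is_derive1_comp _ expR (fun s : R => p + s * q) t _ _ (is_derive_expR _) d1.
  have := is_deriveZ c d2; rewrite /GRing.scale/= -cq.
  by rewrite (_ : c * (expR (p + t * q) * q) = c * q * expR (p + t * q)); last by ring.
have ih : leb.-integrable `[0, 1] (EFin \o (fun s => beta * expR (p + s * q))).
  apply: cont_int => //; first by move=> s; rewrite mulr_ge0// expR_ge0.
  move=> s; rewrite /= in_itv/= => s01; rewrite ler_piMr// -expR0 ler_expR.
  exact: pq.
rewrite (integral_derive ltr01 dphi ih).
by rewrite mul1r mul0r addr0 mulrBr.
Qed.

(** The exact value is [8 * (1 - expR (- (beta / 8)))], bounded uniformly in [beta]. *)
Lemma integral_exp_left :
  (\int[unif01]_s (beta * expR (- (s * beta / 8)))%:E <= 8%:E)%E.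
Proof.
have := @integral_unif01_exp (- 8) 0 (- (beta / 8)).
under [in X in _ -> _ -> X = _]eq_integral do rewrite add0r mulrN mulrA.
move=> -> //; last first.
- by move=> s /andP[s0 _]; rewrite add0r mulrN oppr_le0 mulr_ge0// divr_ge0.
- by field.
by rewrite lee_fin expR0 add0r; have := expR_ge0 (- (beta / 8)); lra.
Qed.

Lemma integral_exp_right :
  (\int[unif01]_s (beta * expR (- ((1 - s) * beta / 8)))%:E <= 8%:E)%E.
Proof.
have := @integral_unif01_exp 8 (- (beta / 8)) (beta / 8).
under [in X in _ -> _ -> X = _]eq_integral => s _.
  rewrite (_ : - (beta / 8) + s * (beta / 8) = - ((1 - s) * beta / 8)); last by ring.
  over.
move=> -> //; last first.
- move=> s /andP[_ s1]; rewrite addrC subr_le0 ler_piMl// divr_ge0//.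
- by field.
by rewrite lee_fin addNr expR0; have := expR_ge0 (- (beta / 8)); lra.
Qed.

End exponential_average.

Lemma le_integral_unif01 (f g : R -> \bar R) :
  measurable_fun [set: measurableTypeR R] f ->
  measurable_fun [set: measurableTypeR R] g ->
  (forall s, 0 <= f s)%E -> (forall s, 0 <= g s)%E ->
  (forall s, 0 <= s <= 1 -> (f s <= g s)%E) ->
  (\int[unif01]_s f s <= \int[unif01]_s g s)%E.
Proof.
move=> mf mg f0 g0 fg; rewrite !integral_unif01//; apply: ge0_le_integral => //.
- exact: measurable_funTS.
- exact: measurable_funTS.
Qed.

Lemma nsqD k (x y : 'cV[R]_k) :
  nsq (x + y) = nsq x + 2 * (\sum_i x i ord0 * y i ord0) + nsq y.
Proof.
rewrite /nsq mulr_sumr -!big_split/=; apply: eq_bigr => i _.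
by rewrite mxE; ring.
Qed.

Lemma nsqE k (x : 'cV[R]_k) : nsq x = (x^T *m x) ord0 ord0.
Proof. by rewrite mxE; apply: eq_bigr => i _; rewrite mxE expr2. Qed.

Section isometry.
Variables (n m : nat) (W2 : 'M[R]_(n, m)).
Hypothesis W2W2 : W2^T *m W2 = 1%:M.

Lemma nsq_isometry u : nsq (W2 *m u) = nsq u.
Proof. by rewrite !nsqE trmx_mul -mulmxA (mulmxA _ W2) W2W2 mul1mx. Qed.

(** Pythagoras: moving along the fibre changes only the component [W2^T *m x]; the orthogonal part,
    of squared length [nsq x - nsq (W2^T *m x)], stays fixed. *)
Lemma nsq_slice x u :
  nsq (x + W2 *m u) = nsq x - nsq (W2^T *m x) + nsq (W2^T *m x + u).
Proof.
rewrite !nsqD nsq_isometry (_ : \sum_i x i ord0 * (W2 *m u) i ord0 =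
    \sum_l (W2^T *m x) l ord0 * u l ord0); first by ring.
have dotE k (y z : 'cV[R]_k) : \sum_i y i ord0 * z i ord0 = (y^T *m z) ord0 ord0.
  by rewrite mxE; apply: eq_bigr => i _; rewrite mxE.
by rewrite !dotE trmx_mul trmxK mulmxA.
Qed.

End isometry.

Section kernel.
Variables (m : nat) (b : 'cV[R]_m).
Let beta := nsq b.

(** Squared displacement times the Gaussian weights of the two ends, relative to the weight of the
    centre [b]. *)
Let h (s : R) (u : 'cV[R]_m) := nsq u *
  expR (- ((nsq (b + (- s) *: u) + nsq (b + (1 - s) *: u) - nsq b) / 2)).

Let beta0 : 0 <= beta. Proof. exact: nsq_ge0. Qed.

Let h0 s u : 0 <= h s u.
Proof. by rewrite /h mulr_ge0 ?nsq_ge0 ?expR_ge0. Qed.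

Let quadratic (s x y : R) : 0 <= s <= 1 / 2 ->
  ((x + (1 - s) * y) ^+ 2 + s * x ^+ 2) / 4 <=
  (x + (- s) * y) ^+ 2 + (x + (1 - s) * y) ^+ 2 - x ^+ 2.
Proof.
move=> /andP[s0 s1].
(* Coefficients of [x ^+ 2] and [x * y] in the difference of the two sides. Completing the square
   leaves the negated discriminant, nonnegative for [s <= 1 / 2] by [D0]. *)
pose A0 := 3 / 4 - s / 4; pose B0 := 3 / 2 - 7 / 2 * s.
have A00 : 0 < A0 by rewrite /A0; lra.
have D0 : 0 <= s * (21 / 4 - 11 / 2 * s - 7 / 4 * s ^+ 2).
  rewrite mulr_ge0//.
  have : s * s <= s * (1 / 2) by rewrite ler_wpM2l.
  by rewrite -expr2 => ?; lra.
rewrite -subr_ge0 -(pmulr_rge0 _ (_ : 0 < 4 * A0)) ?mulr_gt0//.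
have -> : 4 * A0 * ((x + (- s) * y) ^+ 2 + (x + (1 - s) * y) ^+ 2 - x ^+ 2 -
    ((x + (1 - s) * y) ^+ 2 + s * x ^+ 2) / 4) = (2 * A0 * x + B0 * y) ^+ 2 +
    s * (21 / 4 - 11 / 2 * s - 7 / 4 * s ^+ 2) * y ^+ 2.
  by rewrite /A0 /B0; field.
by rewrite addr_ge0 ?sqr_ge0// mulr_ge0// sqr_ge0.
Qed.

Let nsq_quadratic s u : 0 <= s <= 1 / 2 ->
  (nsq (b + (1 - s) *: u) + s * beta) / 4 <=
  nsq (b + (- s) *: u) + nsq (b + (1 - s) *: u) - nsq b.
Proof.
move=> s01; rewrite /beta /nsq mulr_sumr -!big_split/= -sumrB mulr_suml.
by apply: ler_sum => i _; rewrite !mxE; exact: quadratic.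
Qed.

(** For [s <= 1 / 2] one has [|u|^2 <= 4 |(1 - s) u|^2], and [(1 - s) u] is the difference of
    [b + (1 - s) u] and [b]. *)
Let nsq_le s u : 0 <= s <= 1 / 2 ->
  nsq u <= 8 * (nsq (b + (1 - s) *: u) + beta).
Proof.
move=> /andP[s0 s1]; rewrite /beta /nsq mulrDr !mulr_sumr -big_split/=.
apply: ler_sum => i _; rewrite !mxE; set x := b i ord0; set y := u i ord0.
have s2 : 1 / 4 <= (1 - s) ^+ 2.
  have : (1 / 2) * (1 / 2) <= (1 - s) * (1 - s) by rewrite ler_pM//; lra.
  by rewrite -expr2; lra.
have : 1 / 4 * y ^+ 2 <= (1 - s) ^+ 2 * y ^+ 2 by rewrite ler_wpM2r// sqr_ge0.
have : 0 <= (2 * x + (1 - s) * y) ^+ 2 by exact: sqr_ge0.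
have -> : (2 * x + (1 - s) * y) ^+ 2 =
  2 * (x + (1 - s) * y) ^+ 2 + 2 * x ^+ 2 - (1 - s) ^+ 2 * y ^+ 2 by ring.
by move=> ? ?; lra.
Qed.

Let t_expR (t : R) : 0 <= t -> t * expR (- (t / 8)) <= 16 * expR (- (t / 16)).
Proof.
move=> t0; rewrite (_ : - (t / 8) = - (t / 16) + - (t / 16)); last by field.
rewrite expRD mulrA ler_wpM2r ?expR_ge0// expRN ler_pdivrMr ?expR_gt0//.
by have := expR_ge1Dx (t / 16); lra.
Qed.

(* The remaining factor [beta * expR (- (s * beta / 8))] is unbounded in [b], but
   its average over [s] is at most 8. *)
Let h_le s u : 0 <= s <= 1 / 2 ->
  h s u <= (128 + 8 * (beta * expR (- (s * beta / 8)))) *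
    expR (- nsq (4^-1 *: b + ((1 - s) / 4) *: u)).
Proof.
move=> s01; have /andP[s0 s1] := s01.
have -> : nsq (4^-1 *: b + ((1 - s) / 4) *: u) = nsq (b + (1 - s) *: u) / 16.
  rewrite (_ : _ + _ = 4^-1 *: (b + (1 - s) *: u)); last first.
    by rewrite scalerDr scalerA mulrC.
  by rewrite nsqZ; field.
set v := nsq (b + (1 - s) *: u).
have v0 : 0 <= v by exact: nsq_ge0.
(* The rate 1/8 combines the 1/4 of the quadratic inequality with the 1/2 of the Gaussian. Half of
   the decay in [v] absorbs the factor [v] at the price of 16, hence 128 = 8 * 16; the other half
   remains as an integrable weight. *)
apply: (@le_trans _ _ (8 * (v + beta) * (expR (- (v / 8)) * expR (- (s * beta / 8))))).
  rewrite /h ler_pM ?nsq_ge0 ?expR_ge0//; first exact: nsq_le.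
  by rewrite -expRD ler_expR; have := nsq_quadratic u s01; rewrite -/v; lra.
have e1 : expR (- (s * beta / 8)) <= 1.
  by rewrite -expR0 ler_expR oppr_le0 divr_ge0// mulr_ge0.
have e2 : expR (- (v / 8)) <= expR (- (v / 16)) by rewrite ler_expR; lra.
have E1 : v * expR (- (v / 8)) * expR (- (s * beta / 8)) <= 16 * expR (- (v / 16)).
  rewrite (le_trans _ (t_expR v0))// ler_piMr// mulr_ge0// expR_ge0.
have E2 : beta * expR (- (s * beta / 8)) * expR (- (v / 8)) <=
    beta * expR (- (s * beta / 8)) * expR (- (v / 16)).
  by rewrite ler_wpM2l// mulr_ge0// expR_ge0.
have -> : 8 * (v + beta) * (expR (- (v / 8)) * expR (- (s * beta / 8))) =
  8 * (v * expR (- (v / 8)) * expR (- (s * beta / 8))) +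
  8 * (beta * expR (- (s * beta / 8)) * expR (- (v / 8))) by ring.
rewrite [leRHS](_ : _ = 8 * (16 * expR (- (v / 16))) +
  8 * (beta * expR (- (s * beta / 8)) * expR (- (v / 16)))); last by ring.
by rewrite lerD// ler_pM2l.
Qed.

Let mh : measurable_fun [set: measurableTypeR R * 'cV[R]_m] (fun p => (h p.1 p.2)%:E).
Proof.
have m2 : measurable_fun [set: measurableTypeR R * 'cV[R]_m] (fun p => p.2).
  exact: measurable_snd.
have m1 : measurable_fun [set: measurableTypeR R * 'cV[R]_m] (fun p => p.1).
  exact: measurable_fst.
have mb (c : measurableTypeR R * 'cV[R]_m -> R) : measurable_fun setT c ->
    measurable_fun setT (fun p => nsq (b + c p *: p.2)).
  move=> mc; apply: measurable_nsq; apply: measurable_fun_addr_cV => //.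
  exact: measurable_fun_scaler_cV.
apply/measurable_EFinP; apply: measurable_funM; first exact: measurable_nsq.
apply: (measurableT_comp (@measurable_expR R)); apply: measurable_funN.
apply: measurable_funM => //; apply: measurable_funB => //.
by apply: measurable_funD; apply: mb; [exact: measurable_funN|exact: measurable_funB].
Qed.

(** Bounds the Gaussian integrals of scale [(1 - s) / 4], a scale of at least 1/8 when
    [s <= 1 / 2]. *)
Let Bm := sqpi ^+ m * 8 ^+ m.

Let int_h_left s : 0 <= s <= 1 / 2 ->
  (\int[mu m]_u (h s u)%:E <= (Bm * (128 + 8 * (beta * expR (- (s * beta / 8)))))%:E)%E.
Proof.
move=> s01; have /andP[s0 s1] := s01; set c := 128 + _.
have c0 : 0 <= c by rewrite /c addr_ge0// !mulr_ge0// expR_ge0.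
have a0 : 0 < (1 - s) / 4 by lra.
apply: (@le_trans _ _ (\int[mu m]_u (c%:E * (expR (- nsq (4^-1 *: b + ((1 - s) / 4) *: u)))%:E)%E)%E).
  apply: ge0_le_integral => //.
  - by move=> u _; rewrite lee_fin.
  - exact: (measurable_fun_pair2 s mh).
  - apply: measurable_funeM; under eq_fun do rewrite -[nsq _]mul1r.
    apply: measurable_expR_nsq; apply: measurable_fun_addr_cV => //.
    exact: measurable_fun_scaler_cV.
  - by move=> u _; rewrite -EFinM lee_fin; exact: h_le.
rewrite ge0_integralZl_EFin//; last first.
  under eq_fun do rewrite -[nsq _]mul1r.
  apply: measurable_expR_nsq; apply: measurable_fun_addr_cV => //.
  exact: measurable_fun_scaler_cV.
rewrite integral_gauss_cV// -EFinM lee_fin mulrC ler_wpM2r// /Bm -exprVn ler_wpM2l ?exprn_ge0 ?sqrtr_ge0//.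
apply: lerXn2r; rewrite ?nnegrE ?invr_ge0 ?(ltW a0)//.
rewrite -[X in _ <= X]invrK lef_pV2 ?posrE ?invr_gt0//; lra.
Qed.

(** The reflection of [u] exchanges [s] with [1 - s], which reduces [s > 1 / 2] to the previous
    case; the bound adds both contributions so as to hold for all [s]. *)
Let int_h s : 0 <= s <= 1 -> (\int[mu m]_u (h s u)%:E <=
  (Bm * (128 + 8 * (beta * expR (- (s * beta / 8))) +
         8 * (beta * expR (- ((1 - s) * beta / 8)))))%:E)%E.
Proof.
move=> /andP[s0 s1].
have Bm0 : 0 <= Bm by rewrite mulr_ge0 ?exprn_ge0 ?sqrtr_ge0.
have e0 (t : R) : 0 <= beta * expR t by rewrite mulr_ge0// expR_ge0.
have [s12|s12] := leP s (1 / 2).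
  apply: le_trans (int_h_left _) _; first by rewrite s0.
  by rewrite lee_fin ler_wpM2l// lerDl mulr_ge0.
have n10 : (- 1 : R) != 0 by rewrite oppr_eq0 oner_neq0.
rewrite (ge0_integral_affine_cV 0 n10); last 2 first.
- exact: (measurable_fun_pair2 s mh).
- by move=> v; rewrite lee_fin.
rewrite normrN1 expr1n mul1e.
rewrite (_ : \int[_]_u _ = \int[mu m]_u (h (1 - s) u)%:E)%E.
  apply: le_trans (int_h_left _) _; first by apply/andP; split; lra.
  rewrite lee_fin ler_wpM2l// [X in _ <= X]addrAC lerDl mulr_ge0//.
apply: eq_integral => u _; rewrite addr0 scaleN1r /h; congr (_ * expR (- ((_ - _) / _)))%:E.
  by rewrite -scaleN1r nsqZ; ring.
have -> : (- s) *: - u = (1 - (1 - s)) *: u.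
  by rewrite scalerN scaleNr opprK; congr (_ *: _); ring.
by rewrite scalerN -scaleNr addrC.
Qed.

Lemma gauss_kernel_integral :
  (\int[unif01]_s \int[mu m]_u (nsq u *
    expR (- ((nsq (b + (- s) *: u) + nsq (b + (1 - s) *: u) - nsq b) / 2)))%:E
   <= (256 * (sqpi ^+ m * 8 ^+ m))%:E)%E.
Proof.
have Bm0 : 0 <= Bm by rewrite mulr_ge0 ?exprn_ge0 ?sqrtr_ge0.
have e0 (t : R) : 0 <= beta * expR t by rewrite mulr_ge0// expR_ge0.
have h0' p : (0 <= (h p.1 p.2)%:E)%E by rewrite lee_fin.
have me (c : R -> R) : measurable_fun [set: measurableTypeR R] c ->
   measurable_fun [set: measurableTypeR R] (fun s => (beta * expR (- (c s * beta / 8)))%:E).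
  move=> mc; apply/measurable_EFinP; apply: measurable_funM => //.
  apply: (measurableT_comp (@measurable_expR R)); apply: measurable_funN.
  by do 2 apply: measurable_funM => //.
have me1 := me id (@measurable_id _ _ _).
have me2 : measurable_fun [set: measurableTypeR R] (fun s => (beta * expR (- ((1 - s) * beta / 8)))%:E).
  by apply: me; exact: measurable_funB.
have g2 s : (0 <= 128%:E + 8%:E * (beta * expR (- (s * beta / 8)))%:E)%E.
  by rewrite -EFinM -EFinD lee_fin addr_ge0// mulr_ge0.
have g1 (x : R) : (0 <= 8%:E * (beta * expR x)%:E)%E.
  by rewrite -EFinM lee_fin mulr_ge0.
have g3 s : (0 <= 128%:E + 8%:E * (beta * expR (- (s * beta / 8)))%:E +
     8%:E * (beta * expR (- ((1 - s) * beta / 8)))%:E)%E by rewrite adde_ge0.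
apply: (@le_trans _ _ (\int[unif01]_s (Bm%:E * (128%:E + 8%:E * (beta * expR (- (s * beta / 8)))%:E +
     8%:E * (beta * expR (- ((1 - s) * beta / 8)))%:E)))%E).
  apply: le_integral_unif01.
  - exact: (measurable_fun_fubini_tonelli_F (m2 := mu m) _ mh h0').
  - apply: measurable_funeM; apply: emeasurable_funD; last exact: measurable_funeM.
    by apply: emeasurable_funD => //; exact: measurable_funeM.
  - by move=> s; apply: integral_ge0 => u _; rewrite lee_fin; exact: (h0 s u).
  - by move=> s; apply: mule_ge0; [rewrite lee_fin|exact: g3].
  - by move=> s s01; exact: int_h.
have mg2 : measurable_fun [set: measurableTypeR R]
    (fun s => 128%:E + 8%:E * (beta * expR (- (s * beta / 8)))%:E)%E.
  by apply: emeasurable_funD => //; exact: measurable_funeM.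
have mg1 : measurable_fun [set: measurableTypeR R]
    (fun s => 8%:E * (beta * expR (- ((1 - s) * beta / 8)))%:E)%E.
  exact: measurable_funeM.
have mg0 : measurable_fun [set: measurableTypeR R]
    (fun s => 8%:E * (beta * expR (- (s * beta / 8)))%:E)%E.
  exact: measurable_funeM.
have z0 (c : R -> R) s : [set: measurableTypeR R] s -> (0 <= (beta * expR (c s))%:E)%E.
  by rewrite lee_fin.
rewrite ge0_integralZl_EFin//;
  do ?[by move=> s _; exact: g3|exact: (emeasurable_funD mg2 mg1)].
rewrite ge0_integralD//;
  do ?[by move=> s _; exact: g2|by move=> s _; exact: g1|exact: mg2|exact: mg1].
rewrite ge0_integralD//; do ?[by move=> s _; exact: g1|exact: mg0].
rewrite !ge0_integralZl_EFin//; do ?[by move=> s _; rewrite lee_fin].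
rewrite integral_unif01_cst.
(* Each exponential average is at most 8, and 128 + 8 * 8 + 8 * 8 = 256. *)
apply: (@le_trans _ _ (Bm%:E * (128%:E + 8%:E * 8%:E + 8%:E * 8%:E))%E).
  rewrite lee_wpmul2l ?lee_fin// leeD//; last first.
    by rewrite lee_wpmul2l ?lee_fin//; exact: integral_exp_right.
  by rewrite leeD2l// lee_wpmul2l ?lee_fin//; exact: integral_exp_left.
suff : ((Bm * (128 + 8 * 8 + 8 * 8))%:E <= (256 * Bm)%:E)%E by [].
by rewrite lee_fin; lra.
Qed.

End kernel.

End gaussian.

(** * The kernel condition for the uniform and the Gaussian law *)

Section slices.
Context {R : realType} {n m : nat}.
Local Notation mu k := (lebesgue_cV k : {sigma_finite_measure set 'cV[R]_k -> \bar R}).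
Local Notation unif01 := (@unif01 R).
Variables (rho : 'cV[R]_n -> R) (W2 : 'M[R]_(n, m)).
Hypotheses (mrho : measurable_fun setT rho) (rho0 : forall x, 0 <= rho x).
Hypothesis W2W2 : W2^T *m W2 = 1%:M.

(** The marginal density at the projection of [x], with the fibre parametrised from [x] itself, so
    that its invariance along the fibre is a translation of [u]. *)
Definition slice_mass (x : 'cV[R]_n) : R := \int[mu m]_u rho (x + W2 *m u).

(* The mass that the kernel argument moves through [x] along segments parallel
   to the columns of [W2] is at most [C] times the mass of the slice at [x]. *)
Definition slice_kernel (C : R) : Prop := forall x, supp rho x ->
  0 < slice_mass x /\
  (\int[unif01]_s \int[mu m]_u
     (nsq u * (rho (x + (- s) *: (W2 *m u)) * rho (x + (1 - s) *: (W2 *m u))))%:E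
     <= (C * slice_mass x * rho x)%:E)%E.

Let mslice x : measurable_fun setT (fun u => (rho (x + W2 *m u))%:E).
Proof.
apply/measurable_EFinP; apply: (measurableT_comp mrho).
by apply: measurable_fun_addr_cV => //; exact: measurable_fun_mulmx.
Qed.

Lemma nsq_le_norm k (y : 'cV[R]_k) (B : R) : `|y| <= B -> nsq y <= k%:R * B ^+ 2.
Proof.
move=> yB; rewrite mulr_natl -[k in _ *+ k]card_ord -sumr_const.
apply: ler_sum => i _; rewrite -(real_normK (num_real (y i ord0))) ler_sqr ?nnegrE//.
  by rewrite (le_trans (norm_coord_cV_le y i)).
by rewrite (le_trans (normr_ge0 y)).
Qed.

Lemma norm_le_nsq k (y : 'cV[R]_k) : `|y| <= Num.sqrt (nsq y).
Proof.
apply: norm_cV_le; first exact: sqrtr_ge0.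
move=> i; rewrite -sqrtr_sqr ler_sqrt ?nsq_ge0// /nsq (bigD1 i)//= lerDl.
by apply: sumr_ge0 => j _; rewrite sqr_ge0.
Qed.

Definition cube k (r : R) : set 'cV[R]_k := [set u | forall i, u i ord0 \in `]- r, r[].

Lemma lebesgue_cV_cube k (r : R) : 0 < r ->
  mu k (@cube k r) = ((r + r) ^+ k)%:E.
Proof.
move=> r0; rewrite [LHS](lebesgue_cV_box (A := fun=> `]- r, r[%classic)); last first.
  by move=> i; exact: measurable_itv.
rewrite (eq_bigr (fun=> (r + r)%:E)); last first.
  move=> i _; rewrite lebesgue_measure_itv/= lte_fin gtrN// -EFinB opprK.
  by [].
elim: k => [|k IH]; first by rewrite big_ord0 expr0.
by rewrite big_ord_recl IH exprS EFinM.
Qed.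

Lemma measurable_cube k (r : R) : measurable (@cube k r).
Proof.
rewrite (_ : @cube k r = \bigcap_(i in [set: 'I_k])
    ((fun v : 'cV[R]_k => v i ord0) @^-1` `]- r, r[%classic)).
  apply: fin_bigcap_measurable => // i _.
  by rewrite -[X in measurable X]setTI; exact: measurable_coord_cV.
by apply/seteqP; split => [v Av i _|v Av i]; exact: Av.
Qed.

Section uniform.
Variables (B c : R).
Hypotheses (orho : open (supp rho)) (Brho : forall x, supp rho x -> `|x| <= B).
Hypotheses (c0 : 0 < c) (rhoc : forall x, supp rho x -> rho x = c).

Let rho_out x : ~ supp rho x -> rho x = 0.
Proof. by move=> /negP; rewrite -leNgt => rx; apply/le_anti; rewrite rx rho0. Qed.

Let rho_le x : rho x <= c.
Proof.
have [/asboolP/rhoc ->//|/asboolP/rho_out ->] := boolP `[< supp rho x >].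
exact: ltW.
Qed.

(** Bounds the squared Euclidean diameter of the support: two of its points differ by at most
    [B + B] in each coordinate. *)
Let D2 := n%:R * (B + B) ^+ 2.

Let D20 : 0 <= D2. Proof. by rewrite mulr_ge0// sqr_ge0. Qed.

Let diam x y : supp rho x -> supp rho y -> nsq (y - x) <= D2.
Proof.
move=> /Brho xB /Brho yB; apply: nsq_le_norm.
by rewrite (le_trans (ler_normB _ _))// lerD.
Qed.

Let slice_fin x : supp rho x -> (\int[mu m]_u (rho (x + W2 *m u))%:E < +oo)%E.
Proof.
move=> Xx; pose r := Num.sqrt D2 + 1.
have r0 : 0 < r by rewrite ltr_wpDl ?sqrtr_ge0.
pose Q := @cube m r.
have mQ : measurable Q by exact: measurable_cube.
apply: (@le_lt_trans _ _ (\int[mu m]_u (c%:E * (\1_Q u)%:E))%E); last first.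
  rewrite ge0_integralZl_EFin ?(ltW c0)//; last first.
    by apply/measurable_EFinP; exact: measurable_indic.
  by rewrite integral_indic// setIT [X in (_ * X)%E](lebesgue_cV_cube m r0) -EFinM ltry.
apply: ge0_le_integral => //.
- by move=> u _; rewrite lee_fin.
- by apply: measurable_funeM; apply/measurable_EFinP; exact: measurable_indic.
move=> u _; rewrite -EFinM lee_fin indicE.
have [Xu|/asboolP Xu] := boolP `[< supp rho (x + W2 *m u) >]; last first.
  by rewrite (rho_out Xu) mulr_ge0// ltW.
move/asboolP in Xu; rewrite mem_set ?mulr1//.
have ur : `|u| < r.
  rewrite (le_lt_trans (norm_le_nsq u))// ltr_pwDr// ler_sqrt//.
  by have := diam Xx Xu; rewrite addrC addKr nsq_isometry.
move=> i; rewrite in_itv/= -ltr_norml.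
exact: le_lt_trans (norm_coord_cV_le u i) ur.
Qed.

Let slice_pos x : supp rho x -> (0 < \int[mu m]_u (rho (x + W2 *m u))%:E)%E.
Proof.
move=> Xx; have /nbhs_ballP[e /= e0 eX] := orho Xx.
(* Euclidean lengths in the cube of this radius stay below [e], since [m < (m + 1)^2]. *)
pose r := e / (m%:R + 1).
have m1 : 0 < m%:R + 1 :> R by rewrite ltr_wpDl.
have r0 : 0 < r by rewrite divr_gt0.
pose Q := @cube m r.
have mQ : measurable Q by exact: measurable_cube.
apply: (@lt_le_trans _ _ (\int[mu m]_u (c%:E * (\1_Q u)%:E))%E).
  rewrite ge0_integralZl_EFin ?(ltW c0)//; last first.
    by apply/measurable_EFinP; exact: measurable_indic.
  rewrite integral_indic// setIT [X in (_ * X)%E](lebesgue_cV_cube m r0) -EFinM lte_fin.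
  by rewrite mulr_gt0// exprn_gt0// addr_gt0.
apply: ge0_le_integral => //.
- by move=> u _; rewrite -EFinM lee_fin mulr_ge0// ltW.
- by apply: measurable_funeM; apply/measurable_EFinP; exact: measurable_indic.
move=> u _; rewrite -EFinM lee_fin indicE; case: (boolP (u \in Q)) => [/set_mem Qu|_].
  rewrite mulr1 rhoc//; apply: eX; rewrite -ball_normE/= opprD addrA subrr sub0r normrN.
  have ur : `|u| <= r.
    apply: norm_cV_le; first exact: ltW.
    by move=> i; have := Qu i; rewrite in_itv/= -ltr_norml => /ltW.
  rewrite (le_lt_trans (norm_le_nsq _))// nsq_isometry.
  rewrite -[ltRHS]gtr0_norm// -sqrtr_sqr ltr_sqrt ?exprn_gt0//.
  rewrite (le_lt_trans (nsq_le_norm ur))// /r expr_div_n mulrCA gtr_pMr ?exprn_gt0//.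
  rewrite ltr_pdivrMr ?exprn_gt0// mul1r sqrrD1 -addrA ltr_wpDl ?sqr_ge0//.
  by rewrite mulr2n -addrA ltrDl ltr_wpDl.
  exact: W2W2.
by rewrite /= mulr0.
Qed.

(** A dilation by [a] multiplies the integral by [|a| ^- m], which is at most [2 ^+ m]. *)
Let slice_scaled x a : a != 0 -> 1 / 2 <= `|a| ->
  (\int[mu m]_u (rho (x + a *: (W2 *m u)))%:E <=
   (2 ^+ m)%:E * \int[mu m]_u (rho (x + W2 *m u))%:E)%E.
Proof.
move=> a0 a12.
rewrite (ge0_integral_affine_cV 0 a0 (mslice x)); last by move=> u; rewrite lee_fin.
under [X in (_ <= _ * (_ * X))%E]eq_integral do rewrite addr0 -scalemxAr.
rewrite muleA -EFinM -exprMn -[leLHS]mul1e lee_wpmul2r//.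
  by apply: integral_ge0 => u _; rewrite lee_fin.
by rewrite lee_fin exprn_ege1//; lra.
Qed.

Lemma uniform_slice_kernel : slice_kernel (D2 * 2 ^+ m).
Proof.
move=> x Xx; split.
  by rewrite /slice_mass /Rintegral fine_gt0// slice_pos//= slice_fin.
have If : (\int[mu m]_u (rho (x + W2 *m u))%:E)%E = (slice_mass x)%:E.
  by rewrite /slice_mass /Rintegral fineK// ge0_fin_numE ?slice_fin// ltW// slice_pos.
rewrite (rhoc Xx) -[leRHS]integral_unif01_cst.
have msl (a : R) : measurable_fun setT (fun u => (rho (x + a *: (W2 *m u)))%:E).
  apply/measurable_EFinP; apply: (measurableT_comp mrho).
  apply: measurable_fun_addr_cV => //; apply: measurable_fun_scaler_cV => //.
  exact: measurable_fun_mulmx.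
pose K s u := nsq u * (rho (x + (- s) *: (W2 *m u)) * rho (x + (1 - s) *: (W2 *m u))).
have K0 s u : 0 <= K s u by rewrite /K !mulr_ge0// nsq_ge0.
have mK : measurable_fun setT (fun p : measurableTypeR R * 'cV[R]_m => (K p.1 p.2)%:E).
  have ms2 : measurable_fun setT (fun p : measurableTypeR R * 'cV[R]_m => W2 *m p.2).
    by apply: measurable_fun_mulmx; exact: measurable_snd.
  have ms1 : measurable_fun setT (fun p : measurableTypeR R * 'cV[R]_m => p.1).
    exact: measurable_fst.
  apply/measurable_EFinP; apply: measurable_funM.
    by apply: measurable_nsq; exact: measurable_snd.
  apply: measurable_funM; apply: (measurableT_comp mrho);
    apply: measurable_fun_addr_cV => //; apply: measurable_fun_scaler_cV => //.
    exact: measurable_funN.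
  exact: measurable_funB.
(* Where the integrand is nonzero both ends lie in the support and differ by [W2 *m u], so
   [nsq u <= D2]. One density is replaced by [c]; which one is kept is decided by whether [s] or
   [1 - s] is at least 1/2. *)
have KD s u : K s u <= D2 * c * rho (x + (- s) *: (W2 *m u)) /\
              K s u <= D2 * c * rho (x + (1 - s) *: (W2 *m u)).
  rewrite /K; set y := x + _; set z := x + _.
  have [/asboolP Xy|/asboolP/rho_out ->] := boolP `[< supp rho y >]; last first.
    by rewrite mul0r !mulr0; split; rewrite // mulr_ge0// mulr_ge0// ltW.
  have [/asboolP Xz|/asboolP/rho_out ->] := boolP `[< supp rho z >]; last first.
    by rewrite !mulr0; split; rewrite // mulr_ge0// mulr_ge0// ltW.
  rewrite !rhoc// -mulrA; split; rewrite ler_wpM2r ?mulr_ge0 ?(ltW c0)//;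
  have := diam Xy Xz; rewrite /y /z opprD addrACA subrr add0r -scalerBl;
  by rewrite opprK subrK scale1r nsq_isometry.
have Kbound s a : 1 / 2 <= `|a| ->
    (forall u, K s u <= D2 * c * rho (x + a *: (W2 *m u))) ->
    (\int[mu m]_u (K s u)%:E <= (D2 * 2 ^+ m * slice_mass x * c)%:E)%E.
  move=> a12 Ka.
  have a0 : a != 0 by rewrite -normr_eq0 gt_eqF//; lra.
  apply: (@le_trans _ _ (\int[mu m]_u ((D2 * c)%:E * (rho (x + a *: (W2 *m u)))%:E))%E).
    apply: ge0_le_integral => //.
    - by move=> u _; rewrite lee_fin.
    - exact: (measurable_fun_pair2 s mK).
    - exact: measurable_funeM.
    - by move=> u _; rewrite -EFinM lee_fin; exact: Ka.
  have Dc : 0 <= D2 * c by rewrite mulr_ge0// ltW.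
  rewrite ge0_integralZl_EFin//; last by move=> u _; rewrite lee_fin.
  apply: le_trans (lee_wpmul2l _ (slice_scaled x a0 a12)) _; first by rewrite lee_fin.
  by rewrite If -!EFinM lee_fin le_eqVlt; apply/orP; left; apply/eqP; ring.
apply: le_integral_unif01.
- apply: (measurable_fun_fubini_tonelli_F (m2 := mu m) _ mK) => p.
  by rewrite lee_fin.
- exact: measurable_cst.
- by move=> s; apply: integral_ge0 => u _; rewrite lee_fin; exact: K0.
- move=> s; rewrite lee_fin mulr_ge0 ?(ltW c0)// mulr_ge0//.
    by rewrite mulr_ge0// exprn_ge0.
  by apply: fine_ge0; apply: integral_ge0 => u _; rewrite lee_fin.
move=> s /andP[s0 s1]; have [s12|s12] := leP s (1 / 2).
  by apply: (Kbound s (1 - s)) => [|u]; [rewrite ger0_norm; lra|have [] := KD s u].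
by apply: (Kbound s (- s)) => [|u]; [rewrite normrN ger0_norm; lra|have [] := KD s u].
Qed.

End uniform.

Section gaussian_law.
Variable k0 : R.
Hypotheses (k00 : 0 < k0) (rhoE : forall x, rho x = k0 * expR (- (nsq x / 2))).

(** The factor of the density that is constant along the fibre. *)
Let A x := k0 * expR (- ((nsq x - nsq (W2^T *m x)) / 2)).

Let A0 x : 0 < A x. Proof. by rewrite mulr_gt0// expR_gt0. Qed.

Let sliceE x u : rho (x + W2 *m u) = A x * expR (- (nsq (W2^T *m x + u) / 2)).
Proof.
rewrite rhoE nsq_slice// /A -mulrA -expRD; congr (_ * expR _); by field.
Qed.

Let a : R := (Num.sqrt 2)^-1.

Let a0 : 0 < a. Proof. by rewrite invr_gt0 sqrtr_gt0. Qed.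

(** Equal to [(2 pi)^(m / 2)], the total mass of [expR (- (nsq u / 2))]. *)
Definition gauss_mass : R := Num.sqrt pi ^+ m / a ^+ m.

Let M0 : 0 < gauss_mass.
Proof. by rewrite divr_gt0// exprn_gt0// sqrtr_gt0 pi_gt0. Qed.

Let sliceI x : (\int[mu m]_u (rho (x + W2 *m u))%:E = (A x * gauss_mass)%:E)%E.
Proof.
rewrite EFinM -(integral_gauss_cV (a *: (W2^T *m x)) a0).
rewrite -ge0_integralZl_EFin ?(ltW (A0 x))//.
- apply: eq_integral => u _; rewrite sliceE -EFinM; congr (_ * expR (- _))%:E.
  by rewrite -scalerDr nsqZ /a exprVn sqr_sqrtr// mulrC.
- under eq_fun do rewrite -[nsq _]mul1r.
  apply: measurable_expR_nsq; apply: measurable_fun_addr_cV => //.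
  exact: measurable_fun_scaler_cV.
Qed.

Lemma gauss_slice_kernel :
  slice_kernel (256 * (Num.sqrt pi ^+ m * 8 ^+ m) / gauss_mass).
Proof.
move=> x _; have mE : slice_mass x = A x * gauss_mass.
  by rewrite /slice_mass /Rintegral sliceI.
rewrite mE; split; first exact: mulr_gt0.
set b := W2^T *m x.
have rE : rho x = A x * expR (- (nsq b / 2)).
  by have := sliceE x 0; rewrite mulmx0 !addr0.
(* Each density contributes one [A x]; the exponential is split off because [rho x] contains it too,
   and what remains is the kernel of [gauss_kernel_integral]. *)
pose c := A x ^+ 2 * expR (- (nsq b / 2)).
have c0 : 0 <= c by rewrite mulr_ge0 ?sqr_ge0 ?expR_ge0.
pose h s u := nsq u *
  expR (- ((nsq (b + (- s) *: u) + nsq (b + (1 - s) *: u) - nsq b) / 2)).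
have mh : measurable_fun [set: measurableTypeR R * 'cV[R]_m] (fun p => (h p.1 p.2)%:E).
  have m2 : measurable_fun [set: measurableTypeR R * 'cV[R]_m] (fun p => p.2).
    exact: measurable_snd.
  have m1 : measurable_fun [set: measurableTypeR R * 'cV[R]_m] (fun p => p.1).
    exact: measurable_fst.
  have mb (d : measurableTypeR R * 'cV[R]_m -> R) : measurable_fun setT d ->
      measurable_fun setT (fun p => nsq (b + d p *: p.2)).
    move=> mc; apply: measurable_nsq; apply: measurable_fun_addr_cV => //.
    exact: measurable_fun_scaler_cV.
  apply/measurable_EFinP; apply: measurable_funM; first exact: measurable_nsq.
  apply: (measurableT_comp (@measurable_expR R)); apply: measurable_funN.
  apply: measurable_funM => //; apply: measurable_funB => //.
  by apply: measurable_funD; apply: mb; [exact: measurable_funN|exact: measurable_funB].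
have h0 s u : 0 <= h s u by rewrite /h mulr_ge0 ?nsq_ge0 ?expR_ge0.
rewrite [leLHS](_ : _ = c%:E * \int[unif01]_s \int[mu m]_u (h s u)%:E)%E.
  apply: le_trans (lee_wpmul2l _ (gauss_kernel_integral b)) _; first by rewrite lee_fin.
  rewrite -EFinM lee_fin rE /c le_eqVlt; apply/orP; left; apply/eqP; field.
  by rewrite gt_eqF.
rewrite -ge0_integralZl_EFin//;
  do ?[by move=> s _; apply: integral_ge0 => u _; rewrite lee_fin].
  apply: eq_integral => s _; rewrite -ge0_integralZl_EFin//;
    do ?[by move=> u _; rewrite lee_fin]; do ?[exact: (measurable_fun_pair2 s mh)].
  apply: eq_integral => u _; rewrite -EFinM !scalemxAr !sliceE -/b.
  set e1 := expR _; set e2 := expR _; set p := A x.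
  have E : e1 * e2 = expR (- (nsq b / 2)) *
      expR (- ((nsq (b + (- s) *: u) + nsq (b + (1 - s) *: u) - nsq b) / 2)).
    by rewrite /e1 /e2 -!expRD; congr expR; field.
  rewrite (_ : _ * _ = p ^+ 2 * nsq u * (e1 * e2)); last by ring.
  by rewrite E /c /h -/p; congr EFin; ring.
apply: (measurable_fun_fubini_tonelli_F (m2 := mu m) _ mh) => p.
by rewrite lee_fin.
Qed.

End gaussian_law.
End slices.

(** * The sampling error *)

Section law_with_density.
Local Open Scope ereal_scope.
Import HBNNSimple.

(** The hypothesis is the case of indicators; linearity gives the simple functions [h k], and both
    sides pass to the limit by monotone convergence. *)
Lemma ge0_integral_density d (T : measurableType d) (R : realType)
    (mu nu : {measure set T -> \bar R}) (q : T -> R) (g : T -> \bar R) :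
  measurable_fun setT q -> (forall x, (0 <= q x)%R) ->
  (forall A, measurable A -> nu A = \int[mu]_(x in A) (q x)%:E) ->
  measurable_fun setT g -> (forall x, 0 <= g x) ->
  \int[nu]_x g x = \int[mu]_x ((q x)%:E * g x).
Proof.
move=> mq q0 nuE mg g0; pose h := nnsfun_approx measurableT mg.
have mh k : measurable_fun setT (fun x => (h k x)%:E).
  by apply/measurable_EFinP; exact: measurable_funP.
have mqE : measurable_fun setT (EFin \o q) by exact/measurable_EFinP.
have hE k : \int[nu]_x (h k x)%:E = \int[mu]_x ((q x)%:E * (h k x)%:E).
  rewrite integralT_nnsfun sintegralE.
  transitivity (\sum_(r \in range (h k))
      \int[mu]_x ((q x)%:E * (r%:E * (\1_(h k @^-1` [set r]) x)%:E))); last first.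
    rewrite -ge0_integral_fsum//.
    - apply: eq_integral => x _; rewrite -ge0_mule_fsumr; last first.
        by move=> r; exact: nnfun_muleindic_ge0.
      by congr (_ * _); under eq_fsbigr do rewrite -EFinM; rewrite fsumEFin// -fimfunE.
    - move=> r; apply: emeasurable_funM => //; apply: measurable_funeM.
      by apply/measurable_EFinP; exact: measurable_indic.
    - by move=> r x _; rewrite mule_ge0 ?lee_fin//; exact: nnfun_muleindic_ge0.
  apply: eq_fsbigr => r _; have [r0|r0] := ltP r 0%R.
    rewrite preimage_nnfun0// measure0 mule0 integral0_eq// => x _.
    by rewrite indic0 mule0 mule0.
  under [RHS]eq_integral do rewrite muleCA.
  rewrite ge0_integralZl_EFin//.
  - rewrite nuE//; congr (_ * _); rewrite integral_mkcond epatch_indic.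
    by [].
  - by move=> x _; rewrite mule_ge0// lee_fin.
  - apply: emeasurable_funM => //.
    by apply/measurable_EFinP; exact: measurable_indic.
transitivity (limn (fun k => \int[nu]_x (h k x)%:E)).
  rewrite -monotone_convergence//.
  - apply: eq_integral => x _; apply/esym/cvg_lim => //.
    exact: cvg_nnsfun_approx.
  - by move=> k x _; rewrite lee_fin.
  - by move=> x _ a b ab; rewrite lee_fin; exact/lefP/nd_nnsfun_approx.
under eq_fun do rewrite hE.
rewrite -monotone_convergence//.
- apply: eq_integral => x _; apply/cvg_lim => //.
  by apply: cvgeZl => //; exact: cvg_nnsfun_approx.
- by move=> k; exact: emeasurable_funM.
- by move=> k x _; rewrite mule_ge0// lee_fin.
- move=> x _ a b ab; rewrite lee_wpmul2l// lee_fin//; exact/lefP/nd_nnsfun_approx.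
Qed.

Lemma ge0_integral_law d d' (Omega : measurableType d) (T : measurableType d')
    (R : realType) (P : {measure set Omega -> \bar R})
    (mu : {measure set T -> \bar R}) (Z : Omega -> T) (q : T -> R) (g : T -> \bar R) :
  measurable_fun setT Z -> measurable_fun setT q -> (forall x, (0 <= q x)%R) ->
  (forall A, measurable A -> P (Z @^-1` A) = \int[mu]_(x in A) (q x)%:E) ->
  measurable_fun setT g -> (forall x, 0 <= g x) ->
  \int[P]_w g (Z w) = \int[mu]_x ((q x)%:E * g x).
Proof.
move=> mZ mq q0 PZ mg g0.
pose Zm : {mfun Omega >-> T} := HB.pack Z (isMeasurableFun.Build _ _ _ _ _ mZ).
rewrite -(@ge0_integral_density _ _ _ mu (pushforward P Zm) q g)//.
by rewrite (ge0_integral_pushforward (phi := Z) mZ)//.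
Qed.

End law_with_density.

Section sampling_error.
Context {R : realType} {n k m : nat}.
Local Notation mu k := (lebesgue_cV k : {sigma_finite_measure set 'cV[R]_k -> \bar R}).
Variables (f rho : 'cV[R]_n -> R) (W1 : 'M[R]_(n, k)) (W2 : 'M[R]_(n, m)).
Hypotheses (mrho : measurable_fun setT rho) (rho0 : forall x, 0 <= rho x).
Hypotheses (oX : open (supp rho)) (mf : measurable_fun (supp rho) f).
Hypotheses (W11 : W1^T *m W1 = 1%:M) (W12 : W1 *m W1^T + W2 *m W2^T = 1%:M).
Hypothesis mass0 : forall x, supp rho x -> 0 < slice_mass rho W2 x.

Local Notation F := (patch (cst 0) (supp rho) f).

Let mX : measurable (supp rho). Proof. exact: measurable_open_cV. Qed.

Let mF : measurable_fun [set: 'cV[R]_n] (F : 'cV[R]_n -> R).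
Proof. exact/(measurable_restrictT f mX). Qed.

Lemma slice_mass_ge0 x : 0 <= slice_mass rho W2 x.
Proof. by apply: fine_ge0; apply: integral_ge0 => u _; rewrite lee_fin. Qed.

Let mslice2 : measurable_fun setT (fun p : 'cV[R]_n * 'cV[R]_m => p.1 + W2 *m p.2).
Proof.
apply: measurable_fun_addr_cV; first exact: measurable_fst.
by apply: measurable_fun_mulmx; exact: measurable_snd.
Qed.

Lemma measurable_slice_mass : measurable_fun setT (slice_mass rho W2).
Proof.
apply: (measurableT_comp (fine_measurable measurableT)).
have mr2 : measurable_fun setT (fun p : 'cV[R]_n * 'cV[R]_m => (rho (p.1 + W2 *m p.2))%:E).
  by apply/measurable_EFinP; exact: (measurableT_comp mrho mslice2).
apply: (measurable_fun_fubini_tonelli_F (m2 := mu m) _ mr2) => p.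
by rewrite lee_fin.
Qed.

Lemma slice_mass_shift x v : slice_mass rho W2 (x + W2 *m v) = slice_mass rho W2 x.
Proof.
rewrite /slice_mass /Rintegral; congr fine.
rewrite -[RHS](ge0_integral_shift_cV v).
- by apply: eq_integral => u _; rewrite mulmxDr -addrA [W2 *m v + _]addrC.
- apply/measurable_EFinP; apply: (measurableT_comp mrho).
  by apply: measurable_fun_addr_cV => //; exact: measurable_fun_mulmx.
- by move=> u; rewrite lee_fin.
Qed.

Lemma slice_split (x : 'cV[R]_n) (z : 'cV[R]_m) :
  W1 *m (W1^T *m x) + W2 *m (z + W2^T *m x) = x + W2 *m z.
Proof. by rewrite mulmxDr addrCA !mulmxA -mulmxDl W12 mul1mx addrC. Qed.

Let mslice (y : 'cV[R]_k) : measurable_fun [set: 'cV[R]_m] (fun z => W1 *m y + W2 *m z).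
Proof. by apply: measurable_fun_addr_cV => //; exact: measurable_fun_mulmx. Qed.

Lemma marginal_densityE x : marginal_density rho W1 W2 (W1^T *m x) = slice_mass rho W2 x.
Proof.
rewrite /marginal_density /slice_mass /Rintegral.
rewrite -(ge0_integral_shift_cV (W2^T *m x)); first last.
- by move=> z; rewrite lee_fin.
- by apply/measurable_EFinP; exact: measurableT_comp mrho (mslice _).
by congr fine; apply: eq_integral => u _; rewrite slice_split.
Qed.

Lemma norm_mulmx_le p q (A : 'M[R]_(p, q)) :
  exists2 M : R, 0 <= M & forall v : 'cV[R]_q, `|A *m v| <= M * `|v|.
Proof.
exists (\sum_i \sum_j `|A i j|); first by apply: sumr_ge0 => i _; exact: sumr_ge0.
move=> v; apply: norm_cV_le.
  by rewrite mulr_ge0//; apply: sumr_ge0 => i _; exact: sumr_ge0.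
move=> i; rewrite mxE (le_trans (ler_norm_sum _ _ _))// (bigD1 i)//= mulrDl ler_wpDr//.
  by rewrite mulr_ge0//; apply: sumr_ge0 => l _; exact: sumr_ge0.
rewrite mulr_suml; apply: ler_sum => j _; rewrite normrM ler_wpM2l//.
exact: norm_coord_cV_le.
Qed.

(** The affine map [h] is a continuous section of the projection, so the preimage of the support
    under it is a neighbourhood inside the image. Openness makes the domain on which the samples are
    jointly measurable a measurable set. *)
Lemma open_active_set : open (active_set rho W1).
Proof.
rewrite openE => _ [x Xx <-].
pose h (y : 'cV[R]_k) := x + W1 *m (y - W1^T *m x).
have hh : h @^-1` supp rho `<=` active_set rho W1.
  move=> y Xy; exists (h y) => //.
  by rewrite /h mulmxDr mulmxA W11 mul1mx addrC subrK.
have /nbhs_ballP[e /= e0 eX] := oX Xx.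
have [M M0 MW] := norm_mulmx_le W1.
apply/nbhs_ballP; exists (e / (M + 1)); first by rewrite /= divr_gt0// ltr_wpDl.
move=> y; rewrite -ball_normE/= ltr_pdivlMr ?ltr_wpDl// => yx.
apply: hh; apply: eX; rewrite -ball_normE/= opprD addrA subrr sub0r normrN.
rewrite (le_lt_trans (MW _))// -normrN opprB mulrC (le_lt_trans _ yx)//.
by rewrite ler_wpM2l// lerDl.
Qed.

(** The gap is the empirical variance of the [s j], that is the average of [(mean - s j) ^+ 2]. *)
Lemma sqr_sub_mean_le (N : nat) (a : R) (s : 'I_N -> R) : (0 < N)%N ->
  (a - N%:R^-1 * \sum_(j < N) s j) ^+ 2 <= N%:R^-1 * \sum_(j < N) (a - s j) ^+ 2.
Proof.
move=> N0; have N0R : N%:R != 0 :> R by rewrite pnatr_eq0 -lt0n.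
set mean := N%:R^-1 * _; have sE : \sum_(j < N) s j = N%:R * mean.
  by rewrite /mean mulrA mulfV// mul1r.
have sum_sqr (b : R) : \sum_(j < N) (b - s j) ^+ 2 =
    N%:R * b ^+ 2 - 2 * b * (N%:R * mean) + \sum_(j < N) s j ^+ 2.
  rewrite -sE mulr_sumr -[N in N%:R]card_ord mulr_natl -sumr_const -sumrB -big_split/=.
  by apply: eq_bigr => j _; ring.
have : 0 <= \sum_(j < N) (mean - s j) ^+ 2 by apply: sumr_ge0 => j _; exact: sqr_ge0.
rewrite !sum_sqr; set Q := \sum_(j < N) _ => h.
rewrite -(@ler_pM2l _ N%:R) ?ltr0n// mulVKf// -subr_ge0.
by rewrite (_ : _ - _ = N%:R * mean ^+ 2 - 2 * mean * (N%:R * mean) + Q)//; ring.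
Qed.

Section samples.
Context d (Omega : measurableType d) (P : probability Omega R) (N : nat).
Variable Z : 'I_N -> 'cV[R]_k -> Omega -> 'cV[R]_m.
Hypotheses (N0 : (0 < N)%N) (hZ : iid_cond_samples rho W1 W2 P Z).

Let D := supp rho `*` [set: Omega].

Let mD : measurable D. Proof. exact: measurableX. Qed.

(** Samples are known to be measurable only over the active set; the extension by 0 lets Tonelli run
    on the whole product. *)
Let ZD j : 'cV[R]_n * Omega -> 'cV[R]_m := (fun p => Z j (W1^T *m p.1) p.2) \_ D.

Let S j (p : 'cV[R]_n * Omega) := F (W1 *m (W1^T *m p.1) + W2 *m ZD j p).

Let mS j : measurable_fun setT (S j).
Proof.
have m1 : measurable_fun [set: 'cV[R]_n * Omega] (fun p => W1^T *m p.1).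
  by apply: measurable_fun_mulmx; exact: measurable_fst.
apply: (measurableT_comp mF); apply: measurable_fun_addr_cV.
  exact: measurable_fun_mulmx.
apply: measurable_fun_mulmx; apply/(measurable_restrictT _ mD).
have [mZ _ _ _] := hZ.
apply: (@measurable_comp _ _ _ _ _ _ (active_set rho W1 `*` [set: Omega])
  (fun p => Z j p.1 p.2) D (fun p => (W1^T *m p.1, p.2))) => //.
- by apply: measurableX => //; exact: measurable_open_cV open_active_set.
- by move=> _ [[x w] [Xx _] <-]; split => //; exists x.
- apply: (measurable_funS measurableT) => //.
  by apply/measurable_fun_pairP; split => //; exact: measurable_snd.
Qed.

Let K (p : 'cV[R]_n * Omega) := (F p.1 - N%:R^-1 * \sum_(j < N) S j p) ^+ 2 * rho p.1.

Let mK : measurable_fun setT (fun p => (K p)%:E).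
Proof.
have m1 : measurable_fun [set: 'cV[R]_n * Omega] (fun p => p.1) by exact: measurable_fst.
apply/measurable_EFinP; apply: measurable_funM; last exact: (measurableT_comp mrho).
apply: measurable_funX; apply: measurable_funB; first exact: (measurableT_comp mF).
by apply: measurable_funM => //; exact: measurable_sum.
Qed.

Let K0 p : (0 <= (K p)%:E)%E.
Proof. by rewrite lee_fin mulr_ge0// sqr_ge0. Qed.

Let V := slice_mass rho W2.

Let L (x : 'cV[R]_n) (u : 'cV[R]_m) :=
  (F x - F (x + W2 *m u)) ^+ 2 * (rho x * rho (x + W2 *m u) / V x).

Let L0 x u : 0 <= L x u.
Proof. by rewrite mulr_ge0 ?sqr_ge0// divr_ge0 ?mulr_ge0 ?slice_mass_ge0. Qed.

Let mL : measurable_fun setT (fun p => (L p.1 p.2)%:E).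
Proof.
have m1 : measurable_fun [set: 'cV[R]_n * 'cV[R]_m] (fun p => p.1) by exact: measurable_fst.
apply/measurable_EFinP; apply: measurable_funM.
  apply: measurable_funX; apply: measurable_funB.
    exact: (measurableT_comp mF m1).
  exact: (measurableT_comp mF mslice2).
apply: measurable_funM.
  by apply: measurable_funM; [exact: measurableT_comp mrho m1|
                              exact: measurableT_comp mrho mslice2].
under eq_fun do rewrite /V -powR_inv1 ?slice_mass_ge0//.
apply: (measurableT_comp (measurable_powR _)).
exact: (measurableT_comp measurable_slice_mass m1).
Qed.

Let sampled j x : supp rho x ->
  (\int[P]_w (((F x - S j (x, w)) ^+ 2 * rho x)%:E) = \int[mu m]_u (L x u)%:E)%E.
Proof.
move=> Xx; have [_ mZ PZ _] := hZ.
have Yx : active_set rho W1 (W1^T *m x) by exists x.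
pose y := W1^T *m x.
pose g (z : 'cV[R]_m) := ((F x - F (W1 *m y + W2 *m z)) ^+ 2 * rho x)%:E.
have mg : measurable_fun setT g.
  apply/measurable_EFinP; apply: measurable_funM => //; apply: measurable_funX.
  by apply: measurable_funB => //; exact: measurableT_comp mF (mslice _).
have g0 z : (0 <= g z)%E by rewrite lee_fin mulr_ge0// sqr_ge0.
have q0 z : 0 <= cond_density rho W1 W2 y z.
  by rewrite divr_ge0// marginal_densityE ltW// mass0.
have mq : measurable_fun setT (cond_density rho W1 W2 y).
  by apply: measurable_funM => //; exact: measurableT_comp mrho (mslice _).
transitivity (\int[P]_w g (Z j y w))%E.
  apply: eq_integral => w _; rewrite /g /S /ZD patchE mem_set//.
rewrite (ge0_integral_law (mZ _ Yx j) mq q0 (PZ _ Yx j))//.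
rewrite -[LHS](ge0_integral_shift_cV (W2^T *m x)); last 2 first.
- by apply: emeasurable_funM => //; exact/measurable_EFinP.
- by move=> z; rewrite mule_ge0// lee_fin.
apply: eq_integral => u _.
rewrite -EFinM /cond_density /g slice_split marginal_densityE /L; congr EFin.
by ring.
Qed.

Let K_le x : supp rho x -> (\int[P]_w (K (x, w))%:E <= \int[mu m]_u (L x u)%:E)%E.
Proof.
move=> Xx.
have mSx j : measurable_fun setT (fun w => ((F x - S j (x, w)) ^+ 2 * rho x)%:E).
  apply/measurable_EFinP; apply: measurable_funM => //; apply: measurable_funX.
  by apply: measurable_funB => //; exact: (measurable_fun_pair2 x (mS j)).
apply: (@le_trans _ _ (\int[P]_w ((N%:R^-1)%:E *
    \sum_(j < N) ((F x - S j (x, w)) ^+ 2 * rho x)%:E))%E).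
  apply: ge0_le_integral => //.
  - exact: (measurable_fun_pair2 x mK).
  - by apply: measurable_funeM; exact: emeasurable_sum.
  move=> w _; rewrite sumEFin -EFinM lee_fin /K /= -mulr_suml mulrA ler_wpM2r//.
  exact: sqr_sub_mean_le.
rewrite ge0_integralZl_EFin ?invr_ge0//; last 2 first.
- by move=> w _; apply: sume_ge0 => j _; rewrite lee_fin mulr_ge0// sqr_ge0.
- exact: emeasurable_sum.
rewrite ge0_integral_sum//; last by move=> j w _; rewrite lee_fin mulr_ge0// sqr_ge0.
under eq_bigr do rewrite sampled//.
have sum_cst q (I : \bar R) : (\sum_(j < q) I = q%:R%:E * I)%E.
  elim: q => [|q IH]; first by rewrite big_ord0 mul0e.
  by rewrite big_ord_recr/= IH -natr1 EFinD ge0_muleDl ?mul1e ?lee_fin.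
rewrite sum_cst muleA -EFinM mulVf ?mul1e//.
by rewrite pnatr_eq0 -lt0n.
Qed.

Lemma sampling_error_le :
  (\int[P]_w \int[mu n]_(x in supp rho)
     ((f x - mc_approx f rho W1 W2 Z x w) ^+ 2 * rho x)%:E
   <= \int[mu n]_x \int[mu m]_u
      ((F x - F (x + W2 *m u)) ^+ 2 *
       (rho x * rho (x + W2 *m u) / slice_mass rho W2 x))%:E)%E.
Proof.
have -> : (\int[P]_w \int[mu n]_(x in supp rho)
     ((f x - mc_approx f rho W1 W2 Z x w) ^+ 2 * rho x)%:E =
   \int[P]_w \int[mu n]_x (K (x, w))%:E)%E.
  apply: eq_integral => w _; rewrite integral_mkcond; apply: eq_integral => x _.
  rewrite patchE; case: ifPn => [Xx|/negP Xx]; last first.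
    rewrite /K /= (_ : rho x = 0) ?mulr0//; apply/eqP; rewrite eq_le rho0 andbT leNgt.
    by apply/negP => Xx'; apply: Xx; exact/mem_set.
  rewrite /K /mc_approx /mc_average /= [F x]patchE Xx.
  congr (((_ - _ * _) ^+ 2 * _)%:E); apply: eq_bigr => j _.
  by rewrite /S /ZD patchE mem_set//=; split => //; exact/set_mem.
have mKt : measurable_fun setT (fun p : Omega * 'cV[R]_n => (K (p.2, p.1))%:E).
  by apply: (measurableT_comp mK); exact: measurable_swap.
have -> : (\int[P]_w \int[mu n]_x (K (x, w))%:E =
    \int[mu n]_x \int[P]_w (K (x, w))%:E)%E.
  exact: (fubini_tonelli _ mKt).
apply: ge0_le_integral => //.
- by move=> x _; apply: integral_ge0.
- exact: (measurable_fun_fubini_tonelli_F (m2 := P) _ mK).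
- apply: (measurable_fun_fubini_tonelli_F (m2 := mu m) _ mL) => p.
  by rewrite lee_fin L0.
move=> x _; have [/asboolP Xx|/asboolP Xx] := boolP `[< supp rho x >]; first exact: K_le.
rewrite integral0_eq ?integral_ge0//; first by move=> u _; rewrite lee_fin L0.
move=> w _; rewrite /K /= (_ : rho x = 0) ?mulr0//; apply/eqP.
by rewrite eq_le rho0 andbT leNgt; exact/negP.
Qed.

End samples.
End sampling_error.

(** * The trace of the projected gradient covariance *)

Section orthogonal_split.
Context {R : realType} {n : nat}.

Lemma hcat_orthogonal k (hk : (k <= n)%N) (A1 : 'M[R]_(n, k)) (A2 : 'M[R]_(n, n - k)) :
  (hcat hk A1 A2)^T *m hcat hk A1 A2 = 1%:M ->
  [/\ A1^T *m A1 = 1%:M, A2^T *m A2 = 1%:M, A2^T *m A1 = 0 &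
      A1 *m A1^T + A2 *m A2^T = 1%:M].
Proof.
(* Once [n - k] is generalised, eliminating [e] removes the cast. For a square matrix orthogonality
   also gives the product in the other order. *)
have gen p q (e : (p + q)%N = n) (B1 : 'M[R]_(n, p)) (B2 : 'M[R]_(n, q)) :
    let B := castmx (erefl n, e) (row_mx B1 B2) in
    B^T *m B = 1%:M -> [/\ B1^T *m B1 = 1%:M, B2^T *m B2 = 1%:M, B2^T *m B1 = 0 &
      B1 *m B1^T + B2 *m B2^T = 1%:M].
  case: _ / e B1 B2 => B1 B2; rewrite castmx_id/= => BB; have := mulmx1C BB.
  move: BB; rewrite tr_row_mx mul_col_row mul_row_col scalar_mx_block.
  by move=> /eq_block_mx[? ? ? ?] ->.
exact: gen.
Qed.

Lemma hcat_col k (hk : (k <= n)%N) (A1 : 'M[R]_(n, k)) (A2 : 'M[R]_(n, n - k))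
  (i : 'I_n) (ik : (i < k)%N) : hcat hk A1 A2 *m e_ i = A1 *m e_ (Ordinal ik).
Proof.
apply/colP => l; rewrite -!colE !mxE castmxE mxE; case: splitP => j /= ij.
  by congr (A1 _ _); [exact: val_inj|exact: val_inj].
by have := ik; rewrite [X in (X < _)%N]ij ltnNge leq_addr.
Qed.

Lemma enormE (x : 'cV[R]_n) : enorm x = Num.sqrt (nsq x).
Proof. by []. Qed.

Lemma nsq_delta (i : 'I_n) : nsq (e_ i : 'cV[R]_n) = 1.
Proof.
rewrite /nsq (bigD1 i)//= mxE !eqxx expr1n big1 ?addr0// => j ji.
by rewrite mxE (negPf ji) expr0n.
Qed.

Lemma nsq_mulmx_le_opnorm (A : 'M[R]_n) (x : 'cV[R]_n) (r : R) :
  opnorm A <= r -> nsq x <= 1 -> nsq (A *m x) <= r ^+ 2.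
Proof.
move=> Ar x1; suff Axr : enorm (A *m x) <= r.
  rewrite -(sqr_sqrtr (nsq_ge0 (A *m x))) ler_sqr ?nnegrE ?sqrtr_ge0//.
  exact: le_trans (sqrtr_ge0 _) Axr.
apply: le_trans Ar; apply: ub_le_sup; last first.
  by exists x => //=; rewrite -sqrtr1 ler_sqrt.
(* The supremum is an upper bound only of a bounded set; Cauchy-Schwarz on each row bounds it by the
   Frobenius norm. *)
exists (Num.sqrt (\sum_i nsq (row i A)^T)) => _ [y y1 <-].
rewrite ler_sqrt; last by apply: sumr_ge0 => i _; exact: nsq_ge0.
apply: ler_sum => i _; rewrite mxE.
have := CauchySchwarz_nsq (row i A)^T y.
under eq_bigr do rewrite mxE mxE; move=> /le_trans; apply.
rewrite ler_piMr ?nsq_ge0//.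
by rewrite -(sqr_sqrtr (nsq_ge0 y)) exprn_ile1// sqrtr_ge0.
Qed.

Lemma mxtrace_diag_conj m (W : 'M[R]_n) (lam : 'I_n -> R) (A : 'M[R]_(n, m)) :
  \tr (A^T *m (W *m diag_mx (\row_i lam i) *m W^T) *m A) =
  \sum_i lam i * nsq (A^T *m (W *m e_ i)).
Proof.
rewrite [RHS](eq_bigr (fun i => \sum_l lam i * (A^T *m W) l i ^+ 2)); last first.
  move=> i _; rewrite /nsq mulr_sumr; apply: eq_bigr => l _.
  by rewrite mulmxA -colE mxE.
rewrite exchange_big; apply: eq_bigr => l _.
rewrite (_ : A^T *m _ *m A = A^T *m W *m diag_mx (\row_i lam i) *m (A^T *m W)^T); last first.
  by rewrite trmx_mul trmxK !mulmxA.
rewrite mul_mx_diag [LHS]mxE; apply: eq_bigr => i _.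
by rewrite [X in X * _]mxE [(_^T) i l]mxE [(\row_i lam i) _ _]mxE; ring.
Qed.

Lemma tail_trace_le k (hk : (k <= n)%N) (W What : 'M[R]_n) (lam : 'I_n -> R)
    (W1 : 'M[R]_(n, k)) (W2 : 'M[R]_(n, n - k)) (eps : R) :
  W^T *m W = 1%:M -> (forall i, 0 <= lam i) ->
  What = hcat hk W1 W2 -> What^T *m What = 1%:M -> opnorm (W - What) <= eps ->
  0 < eps ->
  \tr (W2^T *m (W *m diag_mx (\row_i lam i) *m W^T) *m W2) <=
  (eps * Num.sqrt (\sum_(i < n | (i < k)%N) lam i) +
   Num.sqrt (\sum_(i < n | (k <= i)%N) lam i)) ^+ 2.
Proof.
move=> WW lam0 WhE WhO We e0; rewrite WhE in WhO.
have [_ _ W21 W12] := hcat_orthogonal WhO.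
have proj v : nsq (W2^T *m v) <= nsq v.
  have -> : nsq v = nsq (W1^T *m v) + nsq (W2^T *m v).
    rewrite !nsqE !trmx_mul !trmxK
      (_ : v^T *m v = v^T *m (W1 *m W1^T + W2 *m W2^T) *m v) ; last by rewrite W12 mulmx1.
    by rewrite mulmxDr mulmxDl !mulmxA mxE.
  by rewrite lerDr nsq_ge0.
rewrite mxtrace_diag_conj (bigID (fun i : 'I_n => (i < k)%N))/=.
set a := \sum_(i < n | (i < k)%N) lam i; set b := \sum_(i < n | (k <= i)%N) lam i.
have a0 : 0 <= a by exact: sumr_ge0.
have b0 : 0 <= b by exact: sumr_ge0.
(* Only the nonnegative cross term of the square separates this from the bound. *)
apply: (@le_trans _ _ (eps ^+ 2 * a + b)); last first.
  rewrite sqrrD exprMn !sqr_sqrtr// lerD2r lerDl mulrn_wge0// mulr_ge0 ?sqrtr_ge0//.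
  by rewrite mulr_ge0 ?sqrtr_ge0// ltW.
apply: lerD.
  rewrite /a mulr_sumr; apply: ler_sum => i ik; rewrite mulrC ler_wpM2r//.
  (* For [i < k] the column [What *m e_ i] is a column of [W1], which [W2^T] annihilates. *)
  have -> : W2^T *m (W *m e_ i) = W2^T *m ((W - What) *m e_ i).
    by rewrite mulmxBl mulmxBr [in RHS]WhE (hcat_col _ _ _ ik) (mulmxA W2^T W1) W21 mul0mx subr0.
  rewrite (le_trans (proj _))// nsq_mulmx_le_opnorm//.
  by rewrite nsq_delta.
rewrite (eq_bigl (fun i : 'I_n => (k <= i)%N)); last by move=> i; rewrite -leqNgt.
apply: ler_sum => i _; rewrite -[leRHS]mulr1 ler_wpM2l// (le_trans (proj _))//.
by rewrite nsq_isometry// nsq_delta.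
Qed.

End orthogonal_split.

(** * The gradient extended by zero and its energy *)

Section extended_gradient.
Context {R : realType} {n : nat}.
Local Notation mu k := (lebesgue_cV k : {sigma_finite_measure set 'cV[R]_k -> \bar R}).
Variables f rho : 'cV[R]_n -> R.
Hypotheses (mrho : measurable_fun setT rho) (rho0 : forall x, 0 <= rho x).
Hypotheses (oX : open (supp rho)) (mf : measurable_fun (supp rho) f).
Hypothesis hdf : square_integrable_partials f rho.

Definition partial (i : 'I_n) : 'cV[R]_n -> R :=
  patch (cst 0) (supp rho) ('D_(e_ i) f).

Local Notation F := (patch (cst 0) (supp rho) f).

Let mX : measurable (supp rho). Proof. exact: measurable_open_cV. Qed.

Let rho_out x : ~ supp rho x -> rho x = 0.
Proof. by move=> /negP; rewrite -leNgt => rx; apply/le_anti; rewrite rx rho0. Qed.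

Lemma partial_in i x : supp rho x -> partial i x = 'D_(e_ i) f x.
Proof. by move=> Xx; rewrite /partial patchE mem_set. Qed.

Lemma partial_out i x : ~ supp rho x -> partial i x = 0.
Proof. by move=> Xx; rewrite /partial patchE memNset. Qed.

Lemma measurable_extension : measurable_fun [set: 'cV[R]_n] (F : 'cV[R]_n -> R).
Proof. exact/(measurable_restrictT f mX). Qed.

Lemma is_derive_extension i x : supp rho x -> is_derive x (e_ i) F (partial i x).
Proof.
move=> Xx; rewrite partial_in//; apply: (@near_eq_is_derive _ _ _ f).
  by have := oX Xx; apply: filterS => y Xy; rewrite patchE mem_set.
by apply: derivableP; exact: hdf.1.
Qed.

(** A limit of difference quotients of the zero extension with steps [1 / (N + 1)]; since the
    support is open, the extension has the partial derivatives of [f] there. *)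
Lemma measurable_partial i : measurable_fun setT (partial i).
Proof.
apply/(measurable_restrictT (T2 := R) ('D_(e_ i) f) mX).
apply: (@measurable_fun_cvg _ _ R (supp rho)
  (fun (N : nat) (x : 'cV[R]_n) =>
    ((@harmonic R N)^-1 * (F (x + @harmonic R N *: e_ i) - F x) : R))).
  move=> N; apply: (measurable_funS measurableT) => //.
  apply: measurable_funM => //; apply: measurable_funB; last exact: measurable_extension.
  by apply: (measurableT_comp measurable_extension); exact: measurable_shift_cV.
move=> x Xx; have dF := is_derive_extension i Xx.
have := @ex_derive _ _ _ _ _ _ _ dF; rewrite /derivable => /cvg_ex[l hl].
have lE : l = 'D_(e_ i) f x.
  by rewrite -(partial_in i Xx) -(@derive_val _ _ _ _ _ _ _ dF); apply/esym/cvg_lim.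
rewrite -lE; have /cvg_at_rightP hr := cvg_dnbhs_at_right hl.
under eq_cvg do rewrite [x + _]addrC.
apply: (hr (@harmonic R)).
by split; [move=> N; exact: harmonic_gt0|exact: cvg_harmonic].
Qed.

Let sqr_integrable i : (mu n).-integrable setT (EFin \o (fun x => partial i x ^+ 2 * rho x)).
Proof.
have := hdf.2 i; rewrite integrable_mkcond//; apply: eq_integrable => // x _.
rewrite patchE/=; case: ifPn => [/set_mem Xx|/negP Xx]; first by rewrite partial_in.
by rewrite partial_out ?expr0n ?mul0r//; apply: contra_not Xx => /mem_set.
Qed.

(** Only squares are integrable by hypothesis; they dominate the mixed products, so that trace and
    integral can be exchanged term by term. *)
Let mul_integrable i j :
  (mu n).-integrable setT (EFin \o (fun x => partial i x * partial j x * rho x)).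
Proof.
apply: (@le_integrable _ _ _ _ _ measurableT _
  (fun x => (partial i x ^+ 2 * rho x)%:E + (partial j x ^+ 2 * rho x)%:E)%E).
- apply/measurable_EFinP; apply: measurable_funM => //.
  by apply: measurable_funM; exact: measurable_partial.
- move=> x _; rewrite /= lee_fin -mulrDl !normrM !(ger0_norm (rho0 x)) ler_wpM2r//.
  rewrite (@ger0_norm _ (partial i x ^+ 2 + _)) ?addr_ge0 ?sqr_ge0//.
  rewrite -[partial i x ^+ 2]real_normK ?num_real// -[partial j x ^+ 2]real_normK ?num_real//.
  move: `|partial i x| `|partial j x| (normr_ge0 (partial i x)) (normr_ge0 (partial j x)).
  move=> a b a0 b0; rewrite -subr_ge0 (_ : _ - _ = (a - b) ^+ 2 + a * b); last by ring.
  by rewrite addr_ge0 ?sqr_ge0 ?mulr_ge0.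
- exact: (integrableD measurableT (sqr_integrable i) (sqr_integrable j)).
Qed.

Lemma grad_energy m (W2 : 'M[R]_(n, m)) :
  (\int[mu n]_x (nsq (grad2 W2 partial x) * rho x)%:E =
   (\tr (W2^T *m grad_cov f rho *m W2))%:E)%E.
Proof.
have covE i j : grad_cov f rho i j = \int[mu n]_x (partial i x * partial j x * rho x).
  rewrite mxE /Rintegral [in LHS]integral_mkcond; congr fine.
  apply: eq_integral => x _; rewrite patchE; case: ifPn => [/set_mem Xx|/negP Xx].
    by rewrite mxE big_ord1 !mxE !partial_in.
  by rewrite partial_out ?mul0r//; apply: contra_not Xx => /mem_set.
have nsqE2 x : nsq (grad2 W2 partial x) * rho x =
    \sum_l \sum_a \sum_b W2 a l * W2 b l * (partial a x * partial b x * rho x).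
  rewrite /nsq mulr_suml; apply: eq_bigr => l _.
  rewrite /grad2 mxE expr2 mulr_suml mulr_suml; apply: eq_bigr => a _.
  rewrite mulr_sumr mulr_suml; apply: eq_bigr => b _.
  by rewrite !mxE; ring.
have i3 l a b : (mu n).-integrable setT
    (EFin \o (fun x => W2 a l * W2 b l * (partial a x * partial b x * rho x))).
  by have := integrableZl measurableT (W2 a l * W2 b l) (mul_integrable a b).
have i2 l a := integrable_sumr (index_enum 'I_n) (i3 l a).
have i1 l := integrable_sumr (index_enum 'I_n) (i2 l).
have i0 := integrable_sumr (index_enum 'I_m) i1.
under eq_integral do rewrite nsqE2.
rewrite -[LHS]fineK; last exact: (integrable_fin_num measurableT i0).
congr EFin; rewrite -/(Rintegral _ _ _) Rintegral_sum//.
rewrite [RHS]/mxtrace; apply: eq_bigr => l _; rewrite Rintegral_sum//.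
transitivity (\sum_a \sum_b W2 a l * W2 b l * grad_cov f rho a b).
  apply: eq_bigr => a _; rewrite Rintegral_sum//; apply: eq_bigr => b _.
  by rewrite RintegralZl// covE.
rewrite exchange_big mxE; apply: eq_bigr => b _ /=.
rewrite mxE mulr_suml; apply: eq_bigr => a _.
by rewrite [(W2^T) l a]mxE; ring.
Qed.

(** On a bounded part of the support [|p| <= 1 + p^2 <= 1 + c^-1 p^2 rho], and the constant 1 is
    integrable there as the indicator of a cube. *)
Lemma partial_locally_integrable i r :
  (exists2 c : R, 0 < c & forall x, supp rho x -> `|x| <= r -> c <= rho x) ->
  (mu n).-integrable (supp rho `&` [set x | `|x| <= r]) (EFin \o partial i).
Proof.
move=> [c c0 rhoc]; set D := supp rho `&` _.
have mD : measurable D by apply: measurableI => //; exact: measurable_ball_cV.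
have mp : measurable_fun D (EFin \o partial i).
  by apply/measurable_EFinP; apply: (measurable_funS measurableT) => //; exact: measurable_partial.
pose Q := @cube R n (`|r| + 1).
have mQ : measurable Q by exact: measurable_cube.
have r1 : 0 < `|r| + 1 by rewrite ltr_wpDl.
have iQ : (mu n).-integrable D (EFin \o \1_Q).
  apply: (integrableS measurableT) => //; apply/integrableP; split.
    by apply/measurable_EFinP; exact: measurable_indic.
  under eq_integral do rewrite /= ger0_norm//.
  by rewrite integral_indic// setIT [X in (X < _)%E](lebesgue_cV_cube n r1) ltry.
have iS : (mu n).-integrable D (fun x => (c^-1)%:E * (partial i x ^+ 2 * rho x)%:E)%E.
  apply: integrableZl => //.
  by apply: (integrableS measurableT) => //; exact: sqr_integrable.
apply: (le_integrable mD mp _ (integrableD mD iQ iS)) => x [Xx /= xr].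
rewrite lee_fin [leRHS]ger0_norm; last first.
  by rewrite addr_ge0// mulr_ge0 ?invr_ge0 ?(ltW c0)// mulr_ge0// sqr_ge0.
rewrite indicE mem_set/=; last first.
  move=> j; rewrite in_itv/= -ltr_norml (le_lt_trans (norm_coord_cV_le x j))//.
  by rewrite (le_lt_trans xr)// (le_lt_trans (ler_norm r))// ltrDl.
apply: (@le_trans _ _ (1 + partial i x ^+ 2)); last first.
  rewrite lerD2l mulrCA ler_peMr ?sqr_ge0// ler_pdivlMl// mulr1; exact: rhoc.
rewrite -[partial i x ^+ 2]real_normK ?num_real//.
move: `|partial i x| (normr_ge0 (partial i x)) => a a0.
rewrite -subr_ge0 (_ : _ - _ = (a - 1) ^+ 2 + a); last by ring.
by rewrite addr_ge0 ?sqr_ge0.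
Qed.

End extended_gradient.

(** * Properties shared by the two laws, and the final estimate *)

Section laws.
Context {R : realType} {n : nat}.
Variable rho : 'cV[R]_n -> R.

(* [K m] bounds the mass moved along slices of dimension [m], uniformly over the
   directions of these slices. *)
Definition admissible_law (K : nat -> R) : Prop :=
  [/\ forall x y s, supp rho x -> supp rho y -> 0 <= s <= 1 -> supp rho (x + s *: (y - x)),
      forall r : R, exists2 c : R, 0 < c & forall x, supp rho x -> `|x| <= r -> c <= rho x,
      forall m, 0 <= K m &
      forall m (W2 : 'M[R]_(n, m)), W2^T *m W2 = 1%:M -> slice_kernel rho W2 (K m)].

Lemma uniform_admissible : regular_density rho -> uniform_density rho ->
  bounded_set (supp rho) -> convex_set (supp rho : set (convex_lmodType 'cV[R]_n)) ->
  exists K, admissible_law K.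
Proof.
move=> [[mrho rho0 rho1] oX _ _ _] rhoc bX cX.
set c := (fine (lebesgue_cV n (supp rho)))^-1 in rhoc.
(* A density of integral 1 has nonempty support. One of its points gives [c > 0]; the formula for
   [c] alone does not, as [fine] sends an infinite volume to 0. *)
have [x0 Xx0] : exists x0, supp rho x0.
  apply/not_existsP => X0; suff : (0 = 1 :> \bar R)%E by move=> [/eqP]; rewrite eq_sym oner_eq0.
  rewrite -rho1 integral0_eq// => x _; congr EFin; apply/eqP.
  by rewrite eq_le rho0 andbT leNgt; apply/negP; exact: X0.
have c0 : 0 < c by rewrite /c -(rhoc _ Xx0); exact: Xx0.
have [B hB] : exists B : R, forall x, supp rho x -> `|x| <= B.
  have [B [_ hB]] := bX; exists (B + 1) => x Xx.
  by apply: hB => //; rewrite ltrDl.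
exists (fun m => n%:R * (B + B) ^+ 2 * 2 ^+ m); split.
- move=> x y s Xx Xy /andP[s0 s1].
  (* The weight [s] belongs to the first argument of the convex combination, hence [y] comes
     first. *)
  have /set_mem := cX y x (Itv01 s0 s1) (mem_set Xy) (mem_set Xx).
  congr (supp rho _); rewrite [LHS](_ : _ = s *: y + (1 - s) *: x)//.
  by rewrite scalerBl scale1r scalerBr addrCA.
- by move=> r; exists c => // x Xx _; rewrite rhoc.
- by move=> m; rewrite mulr_ge0 ?exprn_ge0// mulr_ge0// sqr_ge0.
- by move=> m W2 W22; exact: (uniform_slice_kernel mrho rho0 W22 oX hB c0 rhoc).
Qed.

Lemma std_normal_admissible : std_normal_density rho -> exists K, admissible_law K.
Proof.
move=> rhoE; pose k0 : R := Num.sqrt (2 * pi) ^- n.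
have k00 : 0 < k0 by rewrite invr_gt0 exprn_gt0// sqrtr_gt0 mulr_gt0// pi_gt0.
have rhoE' x : rho x = k0 * expR (- (nsq x / 2)).
  by rewrite rhoE enormE sqr_sqrtr ?nsq_ge0.
have XT x : supp rho x by rewrite /supp/= rhoE' mulr_gt0 ?expR_gt0.
exists (fun m => 256 * (Num.sqrt pi ^+ m * 8 ^+ m) / @gauss_mass R m); split => //.
- move=> r; exists (k0 * expR (- (n%:R * r ^+ 2 / 2))).
    by rewrite mulr_gt0 ?expR_gt0.
  move=> x _ xr; rewrite rhoE' ler_wpM2l ?(ltW k00)// ler_expR lerN2.
  by rewrite ler_wpM2r// nsq_le_norm.
- move=> m; rewrite divr_ge0//.
    by rewrite mulr_ge0// mulr_ge0// exprn_ge0// sqrtr_ge0.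
- by move=> m W2 W22; exact: (gauss_slice_kernel W22 k00 rhoE').
Qed.

End laws.

Theorem theorem4p7 (R : realType) (n : nat) (hn : (2 <= n)%N)
    (rho : 'cV[R]_n -> R) (hrho : regular_density rho)
    (hlaw : [/\ uniform_density rho, bounded_set (supp rho) &
                convex_set (supp rho : set (convex_lmodType 'cV[R]_n))] \/
            std_normal_density rho) :
  exists2 C : R, 0 < C &
  forall (d : measure_display) (Omega : measurableType d)
    (P : probability Omega R) (X : {RV P >-> 'cV[R]_n})
    (hX : has_density X rho)
    (f : 'cV[R]_n -> R) (hf : measurable_fun (supp rho) f)
    (hdf : square_integrable_partials f rho)
    (W : 'M[R]_n) (hW : W^T *m W = 1%:M)
    (lam : 'I_n -> R)
    (hlam : forall i j : 'I_n, (i <= j)%N -> lam j <= lam i)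
    (hlam0 : forall i, 0 <= lam i)
    (hC : grad_cov f rho = W *m diag_mx (\row_i lam i) *m W^T)
    (k : nat) (hk0 : (0 < k)%N) (hkn : (k < n)%N)
    (What1 : 'M[R]_(n, k)) (What2 : 'M[R]_(n, n - k)) (What : 'M[R]_n)
    (hWhat : What = hcat (ltnW hkn) What1 What2)
    (hWhatO : What^T *m What = 1%:M)
    (hint : cond_integrable f rho What1 What2)
    (eps : R) (heps : 0 < eps) (hdist : opnorm (W - What) <= eps)
    (N : nat) (hN : (1 <= N)%N)
    (Z : 'I_N -> 'cV[R]_k -> Omega -> 'cV[R]_(n - k))
    (hZ : iid_cond_samples rho What1 What2 P Z),
  (\int[P]_w \int[lebesgue_cV n]_(x in supp rho)
     ((f x - mc_approx f rho What1 What2 Z x w) ^+ 2 * rho x)%:E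
   <= (C * (1 + (Num.sqrt N%:R)^-1) ^+ 2 *
       (eps * Num.sqrt (\sum_(i < n | (i < k)%N) lam i) +
        Num.sqrt (\sum_(i < n | (k <= i)%N) lam i)) ^+ 2)%:E)%E.
Proof.
have [[mrho rho0 _] oX _ _ _] := hrho.
have [K [cX rho_lb K0 hK]] : exists K, admissible_law rho K.
  case: hlaw => [[hu hb hc]|]; first exact: uniform_admissible.
  exact: std_normal_admissible.
(* [C] must not depend on [k], hence on the dimension [n - k] of the slices. *)
pose C := 1 + \sum_(m < n.+1) K m.
have C0 : 0 < C by rewrite ltr_pwDl// sumr_ge0.
exists C => //.
move=> d Omega P X _ f hf hdf W hW lam _ hlam0 hC k hk0 hkn W1 W2 What hWhat hWhatO _ eps
  heps hdist N hN Z hZ.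
have WhO := hWhatO; rewrite hWhat in WhO.
have [W11 W22 _ W12] := hcat_orthogonal WhO.
have KC : K (n - k)%N <= C.
  have nk : (n - k < n.+1)%N by rewrite ltnS leq_subr.
  rewrite /C (bigD1 (Ordinal nk))//= addrCA lerDl addr_ge0//.
  by apply: sumr_ge0.
have hKC x : supp rho x -> 0 < slice_mass rho W2 x /\ _ := hK _ _ W22 x.
apply: (le_trans (sampling_error_le mrho rho0 oX hf W11 W12 (fun x Xx => (hKC x Xx).1) hN hZ)).
have mG i := measurable_partial oX hf hdf i.
have iG i r := partial_locally_integrable rho0 oX hf hdf i (rho_lb r).
have dF i x := is_derive_extension oX hdf i (x := x).
have mF := measurable_extension oX hf.
have kern x : supp rho x -> (\int[unif01]_s \int[lebesgue_cV (n - k)]_u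
      (nsq u * (rho (x + (- s) *: (W2 *m u)) * rho (x + (1 - s) *: (W2 *m u))))%:E <=
    (C * slice_mass rho W2 x * rho x)%:E)%E.
  move=> Xx; apply: le_trans (hKC x Xx).2 _.
  by rewrite lee_fin ler_wpM2r// ler_wpM2r// ltW//; exact: (hKC x Xx).1.
apply: le_trans.
  apply: (kernel_bound oX mF cX mG iG dF _ mrho rho0 _ _ _ _ (ltW C0) kern).
  - by move=> i x; exact: partial_out.
  - exact: measurable_slice_mass.
  - by move=> x; exact: slice_mass_ge0.
  - by move=> x /hKC[].
  - by move=> x u; exact: slice_mass_shift.
rewrite (grad_energy mrho rho0 oX hf hdf) hC -EFinM lee_fin.
have hT := tail_trace_le hW hlam0 hWhat hWhatO hdist heps.
(* The estimate so far carries no [N]; the factor containing it is at least 1. *)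
rewrite -mulrA ler_wpM2l ?(ltW C0)// (le_trans hT)// ler_peMl ?sqr_ge0//.
by rewrite exprn_ege1// lerDl invr_ge0 sqrtr_ge0.
Qed.
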